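(* Let $f=(f_1,\dots,f_n)$ be an $n$-tuple of power series with the model property. Let $J\ne H^\infty(\mathbb B_f)$ be a WOT-closed two-sided ideal of the Hardy algebra $H^\infty(\mathbb B_f)$ and let $(B_1,\dots,B_n)\in\mathcal V_{f,J}^{cnc}(\mathcal N_{f,J})$ be the corresponding universal model. Let $\mathcal K$ be a Hilbert space. A (closed) subspace $\mathcal M\subseteq\mathcal N_{f,J}\otimes\mathcal K$ is invariant under each operator $B_1\otimes I_{\mathcal K},\dots,B_n\otimes I_{\mathcal K}$ if and only if there exist a Hilbert space $\mathcal G$ and an operator $\Theta:\mathcal N_{f,J}\otimes\mathcal G\to\mathcal N_{f,J}\otimes\mathcal K$ with the following properties: (i) $\Theta$ is a partial isometry and $\Theta(B_i\otimes I_{\mathcal G})=(B_i\otimes I_{\mathcal K})\Theta$, $i=1,\dots,n$; (ii) $\mathcal M=\Theta(\mathcal N_{f,J}\otimes\mathcal G)$.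
   Context: Words and series. $\mathbb F_n^+$ is the free semigroup of words in the letters $1,\dots,n$, with empty word $\varnothing$; $|\alpha|$ is the length of $\alpha$. For an $n$-tuple $Y=(Y_1,\dots,Y_n)$ of elements of a unital algebra, $Y_\alpha:=Y_{i_1}\cdots Y_{i_k}$ if $\alpha=i_1\cdots i_k$, and $Y_\varnothing:=1$. Power series are formal power series $\psi=\sum_\alpha a_\alpha Z_\alpha$ with complex coefficients in noncommuting indeterminates $Z_1,\dots,Z_n$. For $Y\in B(\mathcal H)^n$ put $\psi(Y):=\sum_{k\ge0}\sum_{|\alpha|=k}a_\alpha Y_\alpha$ (series over $k$); $\mathcal C_\psi(\mathcal H)$ (resp. $\mathcal C_\psi^{SOT}(\mathcal H)$) is the set of $Y$ for which this converges in norm (resp. in the strong operator topology, SOT). $\mathcal C_\psi^{rad}(\mathcal H)$ is the set of $Y$ for which there is $\delta\in(0,1)$ with $rY\in\mathcal C_\psi(\mathcal H)$ for $r\in(\delta,1)$ and $\text{SOT-}\lim_{r\to1}\psi(rY)$ exists; then $\psi(Y)$ denotes this limit. For an $n$-tuple $f=(f_1,\dots,f_n)$ of power series these conditions are required for every $f_i$. $[B(\mathcal H)^n]_r:=\{X\in B(\mathcal H)^n:\|\sum_iX_iX_i^*\|^{1/2}<r\}$. A free holomorphic function on $[B(\mathcal H)^n]_\gamma$ is (the evaluation map of) a power series with $\limsup_k(\sum_{|\alpha|=k}|a_\alpha|^2)^{1/2k}\le1/\gamma$. Model property. $\mathbb H^2(f)$ denotes the Hilbert space with orthonormal basis $\{f_\alpha\}_{\alpha\in\mathbb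 F_n^+}$ ($f_\varnothing=1$), whose elements are the series $\sum_\alpha c_\alpha f_\alpha$, $\sum|c_\alpha|^2<\infty$. $f$ has the model property ($f\in\mathcal M$) if one of the following holds. ($\mathcal A$) $f$ is an $n$-tuple of noncommutative polynomials and there is an $n$-tuple $q$ of polynomials with $f\circ q=q\circ f=\mathrm{id}$. ($\mathcal S$) $f(0)=0$, each $f_i$ has nonzero radius of convergence, the matrix of linear coefficients of $f$ is invertible ($\det J_f(0)\ne0$; then elements of $\mathbb H^2(f)$ are formal power series), $Z_1,\dots,Z_n\in\mathbb H^2(f)$, each $M_{Z_i}\psi:=Z_i\psi$ is a bounded operator on $\mathbb H^2(f)$, and $M_{f_j}=f_j(M_{Z_1},\dots,M_{Z_n})$, where $M_{f_j}\psi:=f_j\psi$ and $(M_{Z_1},\dots,M_{Z_n})$ is in $\mathcal C_f^{SOT}(\mathbb H^2(f))$ or $\mathcal C_f^{rad}(\mathbb H^2(f))$. ($\mathcal F$) for some $\gamma>0$, $f$ is an $n$-tuple of free holomorphic functions on $[B(\mathcal H)^n]_\gamma$ ($\mathcal H$ infinite dimensional) with range in $[B(\mathcal H)^n]_1$, there is no nonzero free holomorphic $G$ on $[B(\mathcal H)^n]_1$ with $G\circ f=0$ (then $\mathbb H^2(f)=\{G\circ f: G=\sum c_\alpha Z_\alpha,\ \sum|c_\alpha|^2<\infty\}$), the coordinate functions lie in $\mathbb H^2(f)$, and the boundedness of $M_{Z_i}$ and $M_{f_j}=f_j(M_{Z_1},\dots,M_{Z_n})$ hold as in ($\mathcal S$).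 The universal model of the noncommutative domain $\mathbb B_f$ is $M_Z=(M_{Z_1},\dots,M_{Z_n})$. Universal model of a variety. $H^\infty(\mathbb B_f)$ is the WOT-closure (weak operator topology) in $B(\mathbb H^2(f))$ of all polynomials in $M_{Z_1},\dots,M_{Z_n}$ and the identity. For a WOT-closed two-sided ideal $J$ of it, $\mathcal N_{f,J}:=\mathbb H^2(f)\ominus\overline{J\mathbb H^2(f)}$ and the corresponding universal model is $(B_1,\dots,B_n)$ with $B_i:=P_{\mathcal N_{f,J}}M_{Z_i}|_{\mathcal N_{f,J}}$. (The assertion $(B_1,\dots,B_n)\in\mathcal V_{f,J}^{cnc}(\mathcal N_{f,J})$ in the claim is a recalled fact: this $n$-tuple belongs to the completely non-coisometric part of the noncommutative variety defined by $J$, i.e. $\psi(B_1,\dots,B_n)=P_{\mathcal N_{f,J}}\psi|_{\mathcal N_{f,J}}=0$ for all $\psi\in J$; it is not a hypothesis or conclusion.) *)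

(* Defs.v *)
From HB Require Import structures.
From mathcomp Require Import all_boot all_order all_algebra.
From mathcomp Require Import complex sesquilinear ring.
From mathcomp Require Import all_classical all_reals all_analysis.

Set Implicit Arguments.
Unset Strict Implicit.
Unset Printing Implicit Defensive.

Import Order.TTheory GRing.Theory Num.Theory.
Import numFieldNormedType.Exports.

Local Open Scope classical_set_scope.
Local Open Scope ring_scope.

(** Complex Hilbert spaces *)

(* {dot H for conj} is linear in its first argument. *)
HB.mixin Record isHilbert (R : realType) H & CompleteNormedModule R[i] H := {
  inner : {dot H for (@Num.conj R[i])} ;
  inner_norm : forall x : H, inner x x = `|x| ^+ 2
}.

#[short(type="hilbertType")]
HB.structure Definition Hilbert (R : realType) :=
  {H of isHilbert R H & CompleteNormedModule R[i] H}.

Section HilbertTheory.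
Context {R : realType} {H : hilbertType R}.
Implicit Types x y : H.

Lemma inner_conj x y : inner x y = (inner y x)^*.
Proof. by rewrite (@hermC _ false) /= expr0 mul1r. Qed.

Lemma inner_cauchy_schwarz x y : `|inner x y| <= `|x| * `|y|.
Proof.
have [->|y0] := eqVneq y 0; first by rewrite linear0r !normr0 mulr0.
have b0 : 0 < `|y| ^+ 2 by rewrite exprn_gt0// normr_gt0.
have bc : Num.conj (`|y| ^+ 2) = `|y| ^+ 2.
  by apply/CrealP; rewrite realX// normr_real.
suff : 0 <= `|y| ^+ 2 * (`|y| ^+ 2 * `|x| ^+ 2 - `|inner x y| ^+ 2).
  rewrite pmulr_rge0// subr_ge0 -exprMn ler_sqr ?nnegrE ?mulr_ge0//.
  by rewrite mulrC.
have -> : `|y| ^+ 2 * (`|y| ^+ 2 * `|x| ^+ 2 - `|inner x y| ^+ 2) =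
    `|(- inner x y) *: y + `|y| ^+ 2 *: x| ^+ 2.
  have E (a b : R[i]) : inner (a *: y + b *: x) (a *: y + b *: x) =
      a * (Num.conj a * inner y y + Num.conj b * inner y x) +
      b * (Num.conj a * inner x y + Num.conj b * inner x x).
    rewrite linearDl !linearDr !linearZl_LR /= !linearZr_LR /=.
    by rewrite /GRing.scale/=; ring.
  rewrite -[RHS]inner_norm E bc !inner_norm (inner_conj y x) rmorphN /= normCK.
  by ring.
by rewrite exprn_ge0.
Qed.

End HilbertTheory.

Section OrthoComplement.
Context {R : realType} {H : hilbertType R}.
Implicit Types (A : set H) (x y : H).

Definition orthocomp A : set H := [set x | forall y, A y -> inner x y = 0].

Definition orthocomp_pred A : {pred H} := mem (orthocomp A).

Lemma orthocomp_predP A x : (x \in orthocomp_pred A) <-> orthocomp A x.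
Proof. by split=> [/set_mem|/mem_set]. Qed.

Fact orthocomp_submod A : submod_closed (orthocomp_pred A).
Proof.
split=> [|a x y /orthocomp_predP Ax /orthocomp_predP Ay]; apply/orthocomp_predP.
  by move=> z _; rewrite linear0l.
by move=> z Az; rewrite linearPl/= Ax// Ay// mulr0 addr0.
Qed.

HB.instance Definition _ A :=
  GRing.isSubmodClosed.Build _ _ (orthocomp_pred A) (orthocomp_submod A).

(* The closed subspace orthocomp A, as a Hilbert space in its own right. *)
Record ocomp A : predArgType :=
  Ocomp { ocomp_val :> H ; _ : ocomp_val \in orthocomp_pred A }.

HB.instance Definition _ A := [isSub for @ocomp_val A].
HB.instance Definition _ A := [Choice of ocomp A by <:].
HB.instance Definition _ A := [SubChoice_isSubLmodule of ocomp A by <:].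

Definition ocomp_norm A (x : ocomp A) : R[i] := `|\val x|.

Fact ocomp_normD A (x y : ocomp A) :
  ocomp_norm (x + y) <= ocomp_norm x + ocomp_norm y.
Proof. by rewrite /ocomp_norm linearD ler_normD. Qed.

Fact ocomp_normZ A (l : R[i]) (x : ocomp A) :
  ocomp_norm (l *: x) = `|l| * ocomp_norm x.
Proof. by rewrite /ocomp_norm linearZ normrZ. Qed.

Fact ocomp_norm_eq0 A (x : ocomp A) : ocomp_norm x = 0 -> x = 0.
Proof. by move/normr0_eq0 => x0; apply/val_inj. Qed.

HB.instance Definition _ A := Lmodule_isNormed.Build R[i] (ocomp A)
  (@ocomp_normD A) (@ocomp_normZ A) (@ocomp_norm_eq0 A).

Fact ocomp_complete A (F : set_system (ocomp A)) :
  ProperFilter F -> cauchy F -> cvg F.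
Proof.
move=> FF /cauchy_ballP cF.
have : cvg ((fun x : ocomp A => \val x) @ F).
  apply/cauchy_cvgP/cauchy_ballP => e e0.
  rewrite near_map2; apply: filterS (cF e e0) => -[x x'] /=.
  by rewrite -!ball_normE.
move=> /cvg_ex[l Fl].
have lA : l \in orthocomp_pred A.
  apply/orthocomp_predP => y Ay.
  apply/eqP; rewrite -normr_le0; apply/ler_addgt0Pl => e e0; rewrite addr0.
  have y1 : 0 < `|y| + 1 by rewrite ltr_pwDr.
  have /cvgrPdist_lt/(_ (e / (`|y| + 1))) := Fl.
  rewrite divr_gt0// => /(_ isT) Fe; near F => x.
  have -> : inner l y = inner (l - \val x) y.
    rewrite linearBl /=; have /orthocomp_predP -> // := valP x.
    by rewrite subr0.
  apply: (le_trans (inner_cauchy_schwarz _ _)).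
  have : `|l - \val x| <= e / (`|y| + 1).
    by apply/ltW; near: x; exact: Fe.
  rewrite ler_pdivlMr// => /(le_trans _); apply.
  by rewrite ler_wpM2l// lerDl.
apply/cvg_ex; exists (Ocomp lA); apply/cvgrPdist_lt => e e0.
have /cvgrPdist_lt/(_ e e0) := Fl; by rewrite near_simpl; apply: filterS.
Unshelve. all: by end_near. Qed.

HB.instance Definition _ A := Uniform_isComplete.Build (ocomp A) 
  (@ocomp_complete A).

Definition ocomp_inner A (x y : ocomp A) : R[i] := inner (\val x) (\val y).

Fact ocomp_innerBl A (y : ocomp A) : zmod_morphism (@ocomp_inner A ^~ y).
Proof. by move=> x z; exact: linearBl. Qed.

Fact ocomp_innerBr A (y : ocomp A) : zmod_morphism (@ocomp_inner A y).
Proof. by move=> x z; exact: linearBr. Qed.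

Fact ocomp_innerZl A (y : ocomp A) : scalable_for *%R (@ocomp_inner A ^~ y).
Proof. by move=> a x; exact: linearZl_LR. Qed.

Fact ocomp_innerZr A (y : ocomp A) :
  scalable_for (@Num.conj R[i] \; *%R) (@ocomp_inner A y).
Proof. by move=> a x; exact: linearZr_LR. Qed.

HB.instance Definition _ A := isBilinear.Build _ _ _ _ _ _ (@ocomp_inner A)
  (@ocomp_innerBl A) (@ocomp_innerBr A) (@ocomp_innerZl A) (@ocomp_innerZr A).

Fact ocomp_inner_herm A (x y : ocomp A) :
  ocomp_inner x y = (-1) ^+ false * Num.conj (ocomp_inner y x).
Proof. exact: hermC. Qed.

HB.instance Definition _ A := isHermitianSesquilinear.Build _ _ _ _
  (@ocomp_inner A) (@ocomp_inner_herm A).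

Fact ocomp_inner_gt0 A (x : ocomp A) : x != 0 -> 0 < ocomp_inner x x.
Proof. by move=> x0; rewrite /ocomp_inner neq0_dnorm_gt0. Qed.

HB.instance Definition _ A := isDotProduct.Build _ _
  (@ocomp_inner A) (@ocomp_inner_gt0 A).

Fact ocomp_inner_norm A (x : ocomp A) : ocomp_inner x x = `|x| ^+ 2.
Proof. exact: inner_norm. Qed.

HB.instance Definition _ A := isHilbert.Build R (ocomp A)
  (@ocomp_inner_norm A).

End OrthoComplement.

Section Operators.
Context {R : realType}.
Implicit Types H K : hilbertType R.

Definition rnorm (V : normedZmodType R[i]) (x : V) : R := complex.Re `|x|.

(* T belongs to B(H, K); operators are kept as plain functions. *)
Definition bounded_op H K (T : H -> K) : Prop := linear T /\ continuous T.

Definition opnorm H K (T : H -> K) : R :=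
  sup [set rnorm (T x) | x in [set x : H | rnorm x <= 1]].

Definition adjoint H K (T : H -> K) (S : K -> H) : Prop :=
  forall x y, inner (T x) y = inner x (S y).

Definition partial_isometry H K (T : H -> K) : Prop :=
  bounded_op T /\
  forall x, orthocomp [set z | T z = 0] x -> `|T x| = `|x|.

Definition closed_subspace H (S : set H) : Prop :=
  [/\ S 0, forall (a : R[i]) x y, S x -> S y -> S (a *: x + y) & closed S].

Definition infinite_dimensional H : Prop :=
  ~ exists m (v : 'I_m -> H), forall x, exists c : 'I_m -> R[i],
      x = \sum_(i < m) c i *: v i.

(* The orthogonal projection of H onto orthocomp A; such a y exists and is
   unique, so the default value of xget plays no role. *)
Definition oproj H (A : set H) (x : H) : ocomp A :=
  xget 0 [set y : ocomp A | forall z : ocomp A, inner (x - \val y) (\val z) = 0].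

(* Neighbourhoods in the weak operator topology are given by finitely many
   matrix coefficients. *)
Definition wot_closure H (A : set (H -> H)) : set (H -> H) :=
  [set T | bounded_op T /\
    forall m (x y : 'I_m -> H) (eps : R), 0 < eps ->
      exists2 S, A S & forall k, rnorm (inner (T (x k) - S (x k)) (y k)) < eps].

(* A Hilbert space tensor product of H and K (it is unique up to a unitary
   that respects elementary tensors). *)
Record tensor_product H K := TensorProduct {
  tensor_space :> hilbertType R ;
  tensor : {bilinear H -> K -> tensor_space} ;
  inner_tensor : forall x x' y y',
    inner (tensor x y) (tensor x' y') = inner x x' * inner y y' ;
  dense_tensor : dense [set z | exists m (x : 'I_m -> H) (y : 'I_m -> K),
    z = \sum_(i < m) tensor (x i) (y i)] }.

(* The operator T (x) I_K, which exists and is unique when T is bounded. *)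
Definition ampliation H K (P : tensor_product H K) (T : H -> H) : P -> P :=
  xget (idfun : P -> P) [set S : P -> P | bounded_op S /\
    forall x y, S (tensor P x y) = tensor P (T x) y].

End Operators.

(** Noncommutative power series *)

Section Series.
Context {R : realType} {n : nat}.

Definition word := seq 'I_n.
Definition ncseries := word -> R[i].

Definition wsum (V : nmodType) (k : nat) (F : word -> V) : V :=
  \sum_(w : k.-tuple 'I_n) F w.

Definition nc1 : ncseries := fun w => (w == [::])%:R.
Definition ncX (i : 'I_n) : ncseries := fun w => (w == [:: i])%:R.
Definition ncmul (a b : ncseries) : ncseries :=
  fun w => \sum_(k < (size w).+1) a (take k w) * b (drop k w).
Definition ncword (g : 'I_n -> ncseries) (w : word) : ncseries :=
  foldr (fun i a => ncmul (g i) a) nc1 w.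

(* The sum of the a_w g_w over the words w with |w| < d. *)
Definition nctrunc (a : ncseries) (g : 'I_n -> ncseries) (d : nat) : ncseries :=
  fun v => \sum_(k < d) wsum k (fun w => a w * ncword g w v).

Definition degree_lt (d : nat) (p : ncseries) : Prop :=
  forall w, (d <= size w)%N -> p w = 0.
Definition is_poly (p : ncseries) : Prop := exists d, degree_lt d p.

(* p is a polynomial and r = p(g_1, ..., g_n) *)
Definition poly_comp (p : ncseries) (g : 'I_n -> ncseries) (r : ncseries) : Prop :=
  exists2 d, degree_lt d p & r = nctrunc p g d.

Definition jacobian0 (f : 'I_n -> ncseries) : 'M[R[i]]_n :=
  \matrix_(i, j) f i [:: j].

(* limsup_k (sum_(|w| = k) |a_w|^2)^(1/2k) <= 1/gamma *)
Definition free_holomorphic (gamma : R) (a : ncseries) : Prop :=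
  (limn_esup (fun k : nat =>
     ((wsum k (fun w => rnorm (a w) ^+ 2)) `^ ((2 * k)%:R^-1))%:E)
   <= (gamma^-1)%:E)%E.

Section Evaluation.
Context {H : hilbertType R}.
Implicit Types (a : ncseries) (Y : 'I_n -> H -> H) (T : H -> H).

Definition opword Y (w : word) : H -> H := foldr (fun i T => Y i \o T) idfun w.

Definition optrunc a Y (d : nat) : H -> H :=
  fun x => \sum_(k < d) wsum k (fun w => a w *: opword Y w x).

(* a(Y) = T, the series over k converging in norm *)
Definition norm_eval a Y T : Prop := bounded_op T /\
  (fun d => opnorm (fun x => optrunc a Y d x - T x)) @ \oo --> (0 : R).

Definition sot_eval a Y T : Prop := bounded_op T /\
  forall x, (fun d => optrunc a Y d x) @ \oo --> T x.

Definition rad_eval a Y T : Prop := bounded_op T /\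
  exists delta : R, 0 < delta < 1 /\ exists F : R -> H -> H,
    (forall r, delta < r < 1 ->
       norm_eval a (fun i x => (r%:C)%C *: Y i x) (F r)) /\
    (forall x, F r x @[r --> 1^'-] --> T x).

(* Y is in the set C_f^SOT or C_f^rad, and T = f(Y). *)
Definition sot_or_rad_eval (f : 'I_n -> ncseries) Y (T : 'I_n -> H -> H) : Prop :=
  (forall j, sot_eval (f j) Y (T j)) \/ (forall j, rad_eval (f j) Y (T j)).

(* The open ball [B(H)^n]_r: the norm of (sum_i X_i X_i^* )^(1/2) is below r. *)
Definition row_ball (r : R) : set ('I_n -> H -> H) :=
  [set X | (forall i, bounded_op (X i)) /\
    exists2 X' : 'I_n -> H -> H, (forall i, adjoint (X i) (X' i)) &
      Num.sqrt (opnorm (fun x => \sum_i X i (X' i x))) < r].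

(* (a o f)(X) = T *)
Definition comp_eval a (f : 'I_n -> ncseries) (X : 'I_n -> H -> H) T : Prop :=
  exists2 Y, (forall j, norm_eval (f j) X (Y j)) & norm_eval a Y T.

End Evaluation.
End Series.

Arguments word : clear implicits.
Arguments ncseries : clear implicits.

(** The model property *)

(* The Hilbert space H^2(f) is any Hilbert space H together with an orthonormal
   basis e indexed by words, e w standing for f_w.  Its element h stands for the
   series \sum_w (coef e h w) f_w. *)

Section ModelProperty.
Context {R : realType} {n : nat}.
Variables (E H : hilbertType R) (f : 'I_n -> ncseries R n) (e : word n -> H).
Variable (M : 'I_n -> H -> H).

Definition orthonormal_basis : Prop :=
  (forall v w, inner (e v) (e w) = (v == w)%:R) /\
  dense [set h | exists d (c : word n -> R[i]),
    h = \sum_(k < d) wsum k (fun w => c w *: e w)].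

Definition coef (h : H) : ncseries R n := fun w => inner h (e w).

(* The formal power series of h when f(0) = 0: as f_w has no term of degree
   less than |w|, each coefficient is a finite sum. *)
Definition formal_series (h : H) : ncseries R n :=
  fun v => nctrunc (coef h) f (size v).+1 v.

(* In case (A), the coordinate multiplications act on the polynomials, which
   are the finite combinations of the f_w and so are dense in H^2(f). *)
Record modelA : Prop := ModelA {
  modelA_poly : forall i, is_poly (f i) ;
  modelA_inv : exists q : 'I_n -> ncseries R n, [/\ forall i, is_poly (q i),
    forall i, poly_comp (f i) q (ncX i) & forall i, poly_comp (q i) f (ncX i)] ;
  modelA_bounded : forall i, bounded_op (M i) ;
  modelA_mulZ : forall i h p, poly_comp (coef h) f p ->
    poly_comp (coef (M i h)) f (ncmul (ncX i) p) }.

Record modelS : Prop := ModelS {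
  modelS_f0 : forall i, f i [::] = 0 ;
  modelS_radius : forall i, exists2 r, 0 < r & free_holomorphic r (f i) ;
  modelS_jacobian : \det (jacobian0 f) != 0 ;
  modelS_coord : forall i, exists h, formal_series h = ncX i ;
  modelS_bounded : forall i, bounded_op (M i) ;
  modelS_mulZ : forall i h,
    formal_series (M i h) = ncmul (ncX i) (formal_series h) ;
  modelS_mulf : exists2 T : 'I_n -> H -> H, sot_or_rad_eval f M T &
    forall j h, formal_series (T j h) = ncmul (f j) (formal_series h) }.

(* In case (F), h stands for the function X |-> (coef h o f)(X) on
   [B(E)^n]_gamma. *)
Definition modelF : Prop :=
  exists2 gamma : R, 0 < gamma & [/\
    forall i, free_holomorphic gamma (f i),
    forall X : 'I_n -> E -> E, row_ball gamma X ->
      exists2 Y, row_ball 1 Y & forall j, norm_eval (f j) X (Y j),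
    forall G, free_holomorphic 1 G ->
      (forall X : 'I_n -> E -> E, row_ball gamma X ->
        comp_eval G f X (fun=> 0)) ->
      forall w, G w = 0,
    forall i, exists h, forall X : 'I_n -> E -> E, row_ball gamma X ->
      comp_eval (coef h) f X (X i) &
    [/\ forall i, bounded_op (M i),
      forall i h (X : 'I_n -> E -> E) V, row_ball gamma X ->
        comp_eval (coef h) f X V -> comp_eval (coef (M i h)) f X (X i \o V) &
      exists2 T : 'I_n -> H -> H, sot_or_rad_eval f M T &
        forall j h (X : 'I_n -> E -> E) V Yj, row_ball gamma X ->
          comp_eval (coef h) f X V -> norm_eval (f j) X Yj ->
          comp_eval (coef (T j h)) f X (Yj \o V)]].

(* f has the model property, (H, e) is H^2(f) and M is the universal model
   (M_{Z_1}, ..., M_{Z_n}). *)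
Definition universal_model : Prop :=
  orthonormal_basis /\ [\/ modelA, modelS | modelF].

End ModelProperty.

Section Variety.
Context {R : realType} {n : nat} {H : hilbertType R}.
Variables (M : 'I_n -> H -> H) (J : set (H -> H)).

Definition hardy_algebra : set (H -> H) :=
  wot_closure [set T | exists p d, T = optrunc p M d].

Record wot_closed_ideal : Prop := WotClosedIdeal {
  ideal_sub : J `<=` hardy_algebra ;
  ideal_0 : J (fun=> 0) ;
  ideal_lin : forall (a : R[i]) S T, J S -> J T -> J (fun x => a *: S x + T x) ;
  ideal_mull : forall S T, hardy_algebra S -> J T -> J (S \o T) ;
  ideal_mulr : forall S T, hardy_algebra S -> J T -> J (T \o S) ;
  ideal_closed : wot_closure J `<=` J }.

(* The space H^2(f) (-) closure (J H^2(f)). *)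
Definition variety_space :=
  ocomp (closure [set y : H | exists2 T, J T & exists h, y = T h]).

Definition variety_model (i : 'I_n) (x : variety_space) : variety_space :=
  oproj _ (M i (\val x)).

End Variety.

(* Main.v *)
Require Import Defs.
From HB Require Import structures.
From mathcomp Require Import all_boot all_order all_algebra.
From mathcomp Require Import complex sesquilinear ring lra.
From mathcomp Require Import all_classical all_reals all_analysis.

Set Implicit Arguments.
Unset Strict Implicit.
Unset Printing Implicit Defensive.

Import Order.TTheory GRing.Theory Num.Theory.
Import numFieldNormedType.Exports.

Local Open Scope classical_set_scope.
Local Open Scope ring_scope.

(** Why the theorem holds. Write M for the universal model on H = H^2(f), with
    orthonormal basis e_w, N for the model space of J and B for the compression of
    M to N. If Theta : N (x) G -> N (x) K intertwines the ampliations of B, then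
    the range of Theta is clearly invariant. The content is the converse.

    Whatever form the model property takes, two facts about H^2(f) are needed
    (universal_model_structure). The left multiplications T_j by f_j, which send e_w
    to e_(jw), are strong limits of polynomials in M, and the M_i commute with the
    right multiplications e_w -> e_(wg). Each follows from associativity of the
    product of series once it is known that a vector is determined by its symbol:
    the composition inverse of f gives this for polynomials, invertibility of the
    Jacobian for formal power series, and the absence of nonzero G with G o f = 0
    for free holomorphic functions.

    Let S be a closed subspace of N (x) K invariant under the ampliations of B. Its
    preimage S' in H (x) K under the projection to N (x) K is invariant under the
    ampliations of M, since N is co-invariant, and then under those of the T_j. This
    last step needs that strong convergence of a sequence of operators passes to
    ampliations, which is the uniform boundedness principle (ampliation_sot). The T_j
    are isometries with orthogonal ranges, so S' has a Wold decomposition: with W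
    the part of S' orthogonal to all T_j S', there is an isometry V of H (x) W onto
    S' sending e_v (x) w to T_v w (wold_range). All operators that commute with the
    right multiplications are intertwined by V (wold_intertwine), in particular
    the M_i and the elements of J, because commuting with right multiplications
    is preserved by weak limits.

    Now Theta is V restricted to N (x) W and followed by the projection to N (x) K.
    The projection maps S' onto S and, composed with V, annihilates the complement of
    N (x) W, by the intertwining relation for elements of J. Hence Theta has range
    S and is a coisometry onto it, and it intertwines the ampliations of B because
    V intertwines those of M (invariant_subspace_partial_isometry).

    The tensor products of H and N with a space G are realized inside the
    square-summable sequences of vectors of G (tensor_product_ex and
    tensor_product_ocomp_ex). *)

(** * Norms with real values and convergence of sequences *)

Section Norm.
Context {R : realType}.

Lemma normE (V : normedZmodType R[i]) (x : V) : `|x| = (rnorm x)%:C%C.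
Proof. by rewrite /rnorm RRe_real ?normr_real. Qed.

Lemma rnorm_ge0 (V : normedZmodType R[i]) (x : V) : 0 <= rnorm x.
Proof. by have := normr_ge0 x; rewrite normE -[0]/(0%:C%C) lecR. Qed.

Lemma rnormD (V : normedZmodType R[i]) (x y : V) :
  rnorm (x + y) <= rnorm x + rnorm y.
Proof. by have := ler_normD x y; rewrite !normE -rmorphD /= lecR. Qed.

Lemma rnormN (V : normedZmodType R[i]) (x : V) : rnorm (- x) = rnorm x.
Proof. by rewrite /rnorm normrN. Qed.

Lemma rnormB (V : normedZmodType R[i]) (x y : V) : rnorm (x - y) = rnorm (y - x).
Proof. by rewrite /rnorm distrC. Qed.

Lemma rnorm0 (V : normedZmodType R[i]) : rnorm (0 : V) = 0.
Proof. by rewrite /rnorm normr0. Qed.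

Lemma rnorm0_eq0 (V : normedZmodType R[i]) (x : V) : rnorm x = 0 -> x = 0.
Proof. by move=> x0; apply/normr0_eq0; rewrite normE x0. Qed.

Lemma rnorm_le0 (V : normedZmodType R[i]) (x : V) : rnorm x <= 0 -> x = 0.
Proof. by move=> x0; apply/rnorm0_eq0/le_anti; rewrite x0 rnorm_ge0. Qed.

Lemma rnormZ (V : normedModType R[i]) a (x : V) :
  rnorm (a *: x) = rnorm a * rnorm x.
Proof.
apply: (@complexI R); rewrite rmorphM/= -!normE.
by rewrite normrZ.
Qed.

Lemma rnormM (a b : R[i]) : rnorm (a * b) = rnorm a * rnorm b.
Proof. by apply: (@complexI R); rewrite rmorphM/= -!normE normrM. Qed.

Lemma rnormC (a : R[i]) : rnorm a^* = rnorm a.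
Proof. by rewrite /rnorm norm_conjC. Qed.

Lemma rnorm_real (r : R) : 0 <= r -> rnorm (r%:C)%C = r.
Proof. by move=> r0; rewrite /rnorm ger0_norm// lecR. Qed.

Lemma ler_eps (a b : R) : (forall e, 0 < e -> a <= b + e) -> a <= b.
Proof. by move=> h; apply/ler_addgt0Pr. Qed.

End Norm.

Section Tends.
Context {R : realType}.
Implicit Types V : normedZmodType R[i].

(** Norm convergence with a real-valued norm, so that one notion serves for
    vectors and for complex scalars. *)
Definition tends V (u : nat -> V) (l : V) :=
  forall eps : R, 0 < eps -> exists N, forall d, (N <= d)%N -> rnorm (u d - l) < eps.

Lemma tends_cst V (l : V) : tends (fun=> l) l.
Proof. by move=> e e0; exists 0%N => d _; rewrite subrr rnorm0. Qed.

Lemma eq_tends V (u v : nat -> V) l : (exists N, forall d, (N <= d)%N -> u d = v d) ->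
  tends u l -> tends v l.
Proof.
move=> [N uv] ul e /ul[N' h]; exists (maxn N N') => d.
by rewrite geq_max => /andP[a b]; rewrite -uv// h.
Qed.

Lemma tendsD V (u v : nat -> V) l m : tends u l -> tends v m ->
  tends (fun d => u d + v d) (l + m).
Proof.
move=> ul vm e e0; have e2 : 0 < e / 2 by rewrite divr_gt0.
have [N h] := ul _ e2; have [N' h'] := vm _ e2.
exists (maxn N N') => d; rewrite geq_max => /andP[a b].
rewrite opprD addrACA (le_lt_trans (rnormD _ _))//.
by rewrite [ltRHS](splitr e) ltrD ?h ?h'.
Qed.

Lemma tendsN V (u : nat -> V) l : tends u l -> tends (fun d => - u d) (- l).
Proof.
move=> ul e /ul[N h]; exists N => d Nd.
by rewrite -opprD rnormN h.
Qed.

Lemma tendsB V (u v : nat -> V) l m : tends u l -> tends v m ->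
  tends (fun d => u d - v d) (l - m).
Proof. by move=> ul vm; apply: tendsD => //; apply: tendsN. Qed.

Lemma tends_le V (W : normedZmodType R[i]) (u : nat -> V) (v : nat -> W) l m (C : R) :
  (forall d, rnorm (v d - m) <= C * rnorm (u d - l)) -> tends u l -> tends v m.
Proof.
move=> h ul e e0.
have C0 : 0 < `|C| + 1 by rewrite ltr_pwDr.
have [N hN] := ul (e / (`|C| + 1)) (divr_gt0 e0 C0).
exists N => d /hN; rewrite ltr_pdivlMr// => /(le_lt_trans _); apply.
apply: (le_trans (h d)); rewrite mulrC ler_wpM2l ?rnorm_ge0//.
by rewrite (le_trans (ler_norm _))// lerDl.
Qed.

Lemma tendsZ (V : normedModType R[i]) (u : nat -> V) l a : tends u l ->
  tends (fun d => a *: u d) (a *: l).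
Proof.
by apply: (@tends_le _ _ _ _ _ _ (rnorm a)) => d; rewrite -scalerBr rnormZ.
Qed.

Lemma tendsM (u : nat -> R[i]) l a : tends u l ->
  tends (fun d => a * u d) (a * l).
Proof.
by apply: (@tends_le _ _ _ _ _ _ (rnorm a)) => d; rewrite -mulrBr rnormM.
Qed.

Lemma tends_conj (u : nat -> R[i]) l : tends u l -> tends (fun d => (u d)^*) l^*.
Proof.
by apply: (@tends_le _ _ _ _ _ _ 1) => d; rewrite -rmorphB rnormC mul1r.
Qed.

Lemma tends_uniq V (u : nat -> V) l m : tends u l -> tends u m -> l = m.
Proof.
move=> ul um; apply/eqP; rewrite -subr_eq0; apply/eqP/rnorm_le0/ler_eps => e e0.
have := tendsB ul um; move=> /(_ e e0)[N /(_ N (leqnn N))].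
by rewrite subrr sub0r rnormN add0r => /ltW.
Qed.

Lemma tends_bound V (u : nat -> V) l : tends u l ->
  exists C, forall d, rnorm (u d) <= C.
Proof.
move=> /(_ 1 ltr01)[N h].
exists (rnorm l + 1 + \sum_(k < N) rnorm (u k)) => d.
have [Nd|dN] := leqP N d.
  rewrite -[u d](subrK l) addrC (le_trans (rnormD _ _))//.
  apply: ler_wpDr; first by rewrite sumr_ge0// => *; exact: rnorm_ge0.
  by rewrite lerD2l ltW// h.
rewrite (bigD1 (Ordinal dN))//= addrCA lerDl addr_ge0 ?rnorm_ge0//.
  by rewrite addr_ge0 ?rnorm_ge0.
by rewrite sumr_ge0// => *; exact: rnorm_ge0.
Qed.

Lemma ler_tends0 (e : R) : 0 < e -> exists N, forall d, (N <= d)%N -> d.+1%:R^-1 < e.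
Proof.
move=> e0; exists (Num.truncn e^-1) => d Nd.
rewrite invf_plt ?posrE//; apply: (lt_le_trans (truncnS_gt _)).
by rewrite ler_nat ltnS.
Qed.

Lemma tends_inv V (u : nat -> V) l : (forall d, rnorm (u d - l) < d.+1%:R^-1) ->
  tends u l.
Proof.
move=> h e /ler_tends0[N hN]; exists N => d /hN; exact: lt_trans.
Qed.

Lemma tendsP (H : normedModType R[i]) (u : nat -> H) l :
  tends u l <-> u @ \oo --> l.
Proof.
split=> [ul|].
  apply/cvgrPdist_lt => e e0.
  have e0' : 0 < complex.Re e by move: e0; rewrite ltcE => /andP[].
  have ee : e = (complex.Re e)%:C%C by rewrite RRe_real// gtr0_real.
  have [N h] := ul _ e0'; exists N => // d Nd.
  by rewrite distrC normE ee ltcR h.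
move=> /cvgrPdist_lt ul e e0.
have [|N _ h] := ul (e%:C)%C; first by rewrite ltcR.
exists N => d Nd; have := h d Nd; by rewrite distrC normE ltcR.
Qed.

End Tends.

(** * Inner products, bounded operators and closed subspaces *)

Section Inner.
Context {R : realType} {H : hilbertType R}.
Implicit Types x y z : H.

Lemma innerDl x y z : inner (x + y) z = inner x z + inner y z.
Proof. exact: linearDl. Qed.
Lemma innerDr x y z : inner z (x + y) = inner z x + inner z y.
Proof. exact: linearDr. Qed.
Lemma innerBl x y z : inner (x - y) z = inner x z - inner y z.
Proof. exact: linearBl. Qed.
Lemma innerZl a x z : inner (a *: x) z = a * inner x z.
Proof. exact: linearZl_LR. Qed.
Lemma innerZr a x z : inner z (a *: x) = a^* * inner z x.
Proof. exact: linearZr_LR. Qed.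
Lemma inner0l z : inner 0 z = 0. Proof. exact: linear0l. Qed.
Lemma inner0r z : inner z 0 = 0. Proof. exact: linear0r. Qed.
Lemma inner_suml I (r : seq I) (P : pred I) F z :
  inner (\sum_(i <- r | P i) F i) z = \sum_(i <- r | P i) inner (F i) z.
Proof. exact: linear_sumlz. Qed.
Lemma inner_sumr I (r : seq I) (P : pred I) F z :
  inner z (\sum_(i <- r | P i) F i) = \sum_(i <- r | P i) inner z (F i).
Proof. exact: linear_sumr. Qed.
Lemma innerPl a x y z : inner (a *: x + y) z = a * inner x z + inner y z.
Proof. by rewrite innerDl innerZl. Qed.

Lemma inner_sym0 x y : inner x y = 0 -> inner y x = 0.
Proof. by move=> xy; rewrite inner_conj xy rmorph0. Qed.

Lemma innerxx x : inner x x = (rnorm x ^+ 2)%:C%C.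
Proof. by rewrite inner_norm normE rmorphXn. Qed.

Lemma cauchy_schwarz x y : rnorm (inner x y) <= rnorm x * rnorm y.
Proof.
by have := inner_cauchy_schwarz x y; rewrite !normE -rmorphM/= lecR.
Qed.

Definition rdot x y : R := complex.Re (inner x y).

Lemma rnormD2 x y : rnorm (x + y) ^+ 2 = rnorm x ^+ 2 + rnorm y ^+ 2 + 2 * rdot x y.
Proof.
apply: (@complexI R); rewrite -innerxx !innerDl !innerDr !innerxx (inner_conj y x).
rewrite /rdot; case: (inner x y) => a b /=.
by apply/eqP; rewrite eq_complex/=; apply/andP; split; apply/eqP; ring.
Qed.

Lemma rdotNr x y : rdot x (- y) = - rdot x y.
Proof. by rewrite /rdot -scaleN1r innerZr rmorphN1 mulN1r raddfN. Qed.

Lemma rnormB2 x y : rnorm (x - y) ^+ 2 = rnorm x ^+ 2 + rnorm y ^+ 2 - 2 * rdot x y.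
Proof. by rewrite rnormD2 rnormN rdotNr mulrN. Qed.

Lemma pythagoras x y : inner x y = 0 ->
  rnorm (x + y) ^+ 2 = rnorm x ^+ 2 + rnorm y ^+ 2.
Proof. by move=> xy; rewrite rnormD2 /rdot xy mulr0 addr0. Qed.

Lemma parallelogram x y :
  rnorm (x + y) ^+ 2 + rnorm (x - y) ^+ 2 = 2 * rnorm x ^+ 2 + 2 * rnorm y ^+ 2.
Proof. by rewrite rnormD2 rnormB2; ring. Qed.

Lemma inner_eq0 x : (forall y, inner x y = 0) -> x = 0.
Proof.
move=> /(_ x); rewrite innerxx => /(@complexI R)/eqP.
by rewrite sqrf_eq0 => /eqP/rnorm0_eq0.
Qed.

Lemma inner_inj x y : (forall z, inner x z = inner y z) -> x = y.
Proof.
move=> h; apply/eqP; rewrite -subr_eq0; apply/eqP/inner_eq0 => z.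
by rewrite innerBl h subrr.
Qed.

Lemma tends_innerl (u : nat -> H) l y : tends u l ->
  tends (fun d => inner (u d) y) (inner l y).
Proof.
apply: (@tends_le _ _ _ _ _ _ _ (rnorm y)) => d.
by rewrite -innerBl mulrC cauchy_schwarz.
Qed.

Lemma ler_sqr_nneg (a b : R) : 0 <= a -> 0 <= b -> (a <= b) = (a ^+ 2 <= b ^+ 2).
Proof. by move=> a0 b0; rewrite ler_sqr ?nnegrE. Qed.

End Inner.

Section Topology.
Context {R : realType}.
Implicit Types H K : hilbertType R.

Lemma nbhs_rnorm H (x : H) (A : set H) :
  nbhs x A <-> exists2 e : R, 0 < e & forall y, rnorm (x - y) < e -> A y.
Proof.
split=> [/nbhs_ballP[e /= e0 xA]|[e e0 xA]].
  have e0' : 0 < complex.Re e by move: e0; rewrite ltcE => /andP[].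
  have ee : e = (complex.Re e)%:C%C by rewrite RRe_real// gtr0_real.
  exists (complex.Re e) => // y xy; apply: xA.
  by rewrite -ball_normE/= normE ee ltcR.
apply/nbhs_ballP; exists (e%:C)%C => /=; first by rewrite ltcR.
by move=> y; rewrite -ball_normE/= normE ltcR => /xA.
Qed.

Lemma closureP H (A : set H) (x : H) :
  closure A x <-> forall e : R, 0 < e -> exists2 a, A a & rnorm (x - a) < e.
Proof.
split=> [cA e e0|h B /nbhs_rnorm[e /h[a Aa xa]] hB].
  have [|a [Aa xa]] := cA [set y | rnorm (x - y) < e]; last by exists a.
  by apply/nbhs_rnorm; exists e.
by exists a; split => //; exact: hB.
Qed.

Lemma closedP H (A : set H) : closed A <->
  forall x, (forall e : R, 0 < e -> exists2 a, A a & rnorm (x - a) < e) -> A x.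
Proof. by split=> h x => [/closureP/h|/closureP/h]. Qed.

Lemma closed_tends H (A : set H) (u : nat -> H) l : closed A ->
  (forall d, A (u d)) -> tends u l -> A l.
Proof.
move=> /closedP cA uA ul; apply: cA => e /ul[N /(_ _ (leqnn N)) h].
by exists (u N); rewrite // rnormB.
Qed.

Lemma denseP H (A : set H) : dense A <->
  forall x (e : R), 0 < e -> exists2 a, A a & rnorm (x - a) < e.
Proof.
split=> [dA x e e0|h O [x Ox] oO].
  have [||a [xa Aa]] := dA (ball x (e%:C)%C); last first.
  - by exists a => //; move: xa; rewrite -ball_normE/= normE ltcR.
  - exact: ball_open.
  - by exists x; apply: ballxx; rewrite ltcR.
have /nbhs_rnorm[e /(h x)[a Aa xa] hB] : nbhs x O by exact: open_nbhs_nbhs.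
by exists a; split => //; exact: hB.
Qed.

Lemma cauchy_tends H (u : nat -> H) :
  (forall e : R, 0 < e -> exists N, forall m n, (N <= m)%N -> (N <= n)%N ->
     rnorm (u m - u n) < e) -> exists l, tends u l.
Proof.
move=> h; have : cvg (u @ \oo).
  apply: cauchy_cvg; apply: cauchy_exP => e e0.
  have e0' : 0 < complex.Re e by move: e0; rewrite ltcE => /andP[].
  have ee : e = (complex.Re e)%:C%C by rewrite RRe_real// gtr0_real.
  have [N hN] := h _ e0'; exists (u N); exists N => // n Nn.
  by rewrite -ball_normE/= normE ee ltcR hN.
by move=> /cvg_ex[l ul]; exists l; apply/tendsP.
Qed.

Lemma bounded_opP H K (T : H -> K) : bounded_op T <->
  linear T /\ exists2 C : R, 0 <= C & forall x, rnorm (T x) <= C * rnorm x.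
Proof.
split=> [[lT cT]|[lT [C C0 hC]]]; (split => //);
  pose T' : {linear H -> K} := HB.pack T (GRing.isLinear.Build _ _ _ _ _ lT).
  have /linear_bounded_continuous/linear_boundedP : continuous T' by [].
  move=> [M [Mr hM]].
  have M1 : M < (`|complex.Re M| + 1)%:C%C.
    rewrite -(RRe_real Mr) ltcR; apply: (le_lt_trans (ler_norm _)).
    by rewrite ltrDl.
  exists (`|complex.Re M| + 1); first by rewrite addr_ge0.
  by move=> x; have := hM _ M1 x; rewrite !normE -rmorphM/= lecR.
change (continuous T'); apply/linear_bounded_continuous/linear_boundedP.
exists (C%:C)%C; split; first by rewrite realE lecR C0.
move=> r Cr x.
have := hC x; rewrite -lecR rmorphM/= -!normE => /le_trans; apply.
by rewrite ler_wpM2r// ltW.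
Qed.

Lemma opP H K (T : H -> K) a x y : bounded_op T ->
  T (a *: x + y) = a *: T x + T y.
Proof. by case=> + _; apply. Qed.

Lemma opD H K (T : H -> K) x y : bounded_op T -> T (x + y) = T x + T y.
Proof. by move=> bT; have := opP 1 x y bT; rewrite !scale1r. Qed.

Lemma op0 H K (T : H -> K) : bounded_op T -> T 0 = 0.
Proof.
by move=> bT; have := opP (-1) 0 0 bT; rewrite !scaleN1r addNr => ->; rewrite addNr.
Qed.

Lemma opZ H K (T : H -> K) a x : bounded_op T -> T (a *: x) = a *: T x.
Proof. by move=> bT; have := opP a x 0 bT; rewrite (op0 bT) !addr0. Qed.

Lemma opB H K (T : H -> K) x y : bounded_op T -> T (x - y) = T x - T y.
Proof. by move=> bT; rewrite -scaleN1r opD// opZ// scaleN1r. Qed.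

Lemma op_sum H K (T : H -> K) I (r : seq I) (P : pred I) F : bounded_op T ->
  T (\sum_(i <- r | P i) F i) = \sum_(i <- r | P i) T (F i).
Proof.
move=> bT; elim/big_rec2 : _ => [|i x y _ <-]; first exact: op0.
exact: opD.
Qed.

Lemma bounded_id H : bounded_op (idfun : H -> H).
Proof. by apply/bounded_opP; split => //; exists 1 => // x; rewrite mul1r. Qed.

Lemma bounded_comp H K (L : hilbertType R) (S : K -> L) (T : H -> K) :
  bounded_op S -> bounded_op T -> bounded_op (S \o T).
Proof.
move=> bS bT; apply/bounded_opP; split.
  by move=> a x y /=; rewrite (opP a x y bT) (opP _ _ _ bS).
have [_ [C C0 hC]] := (bounded_opP _).1 bS.
have [_ [D D0 hD]] := (bounded_opP _).1 bT.
exists (C * D) => [|x /=]; first exact: mulr_ge0.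
by rewrite (le_trans (hC _))// -mulrA ler_wpM2l.
Qed.

Lemma bounded_lin H K a (S T : H -> K) : bounded_op S -> bounded_op T ->
  bounded_op (fun x => a *: S x + T x).
Proof.
move=> bS bT; apply/bounded_opP; split.
  move=> b x y /=; rewrite (opP b x y bT) (opP b x y bS) !scalerDr !scalerA (mulrC a) addrACA.
  by rewrite -!scalerA.
have [_ [C C0 hC]] := (bounded_opP _).1 bS.
have [_ [D D0 hD]] := (bounded_opP _).1 bT.
exists (rnorm a * C + D) => [|x /=]; first by rewrite addr_ge0 ?mulr_ge0 ?rnorm_ge0.
rewrite (le_trans (rnormD _ _))// rnormZ mulrDl lerD// -mulrA.
by rewrite ler_wpM2l ?rnorm_ge0.
Qed.

Lemma bounded_0 H K : bounded_op (fun=> 0 : K) (H := H).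
Proof.
apply/bounded_opP; split => [a x y|]; first by rewrite scaler0 addr0.
by exists 0 => // x; rewrite rnorm0 mul0r.
Qed.

Lemma bounded_sub H K (S T : H -> K) : bounded_op S -> bounded_op T ->
  bounded_op (fun x => S x - T x).
Proof.
move=> bS bT; have := bounded_lin (-1) bT bS.
by congr bounded_op; apply/funext => x; rewrite scaleN1r addrC.
Qed.

Lemma bounded_sum H K I (r : seq I) (P : pred I) (S : I -> H -> K) :
  (forall i, bounded_op (S i)) -> bounded_op (fun x => \sum_(i <- r | P i) S i x).
Proof.
move=> bS; elim: r => [|i r IH].
  have -> : (fun x => \sum_(i <- [::] | P i) S i x) = (fun=> 0).
    by apply/funext => x; rewrite big_nil.
  exact: bounded_0.
have -> : (fun x => \sum_(j <- i :: r | P j) S j x) =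
    (fun x => (P i)%:R *: S i x + \sum_(j <- r | P j) S j x).
  apply/funext => x; rewrite big_cons; case: (P i); first by rewrite scale1r.
  by rewrite scale0r add0r.
exact: bounded_lin.
Qed.

Lemma tends_op H K (T : H -> K) u l : bounded_op T -> tends u l ->
  tends (T \o u) (T l).
Proof.
move=> bT; have [_ [C C0 hC]] := (bounded_opP _).1 bT.
by apply: tends_le => d /=; rewrite -opB//; exact: hC.
Qed.

End Topology.

Section Projection.
Context {R : realType}.
Implicit Types H K : hilbertType R.

Lemma csub0 H (S : set H) : closed_subspace S -> S 0.
Proof. by case. Qed.
Lemma csubP H (S : set H) a x y : closed_subspace S -> S x -> S y -> S (a *: x + y).
Proof. by case=> _ + _; apply. Qed.
Lemma csubD H (S : set H) x y : closed_subspace S -> S x -> S y -> S (x + y).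
Proof. by move=> cS; have := @csubP _ _ 1 x y cS; rewrite scale1r. Qed.
Lemma csubZ H (S : set H) a x : closed_subspace S -> S x -> S (a *: x).
Proof. by move=> cS Sx; have := csubP a cS Sx (csub0 cS); rewrite addr0. Qed.
Lemma csubB H (S : set H) x y : closed_subspace S -> S x -> S y -> S (x - y).
Proof. by move=> cS Sx Sy; have := csubP (-1) cS Sy Sx; rewrite scaleN1r addrC. Qed.
Lemma csub_tends H (S : set H) u l : closed_subspace S -> (forall d, S (u d)) ->
  tends u l -> S l.
Proof. by case=> _ _ cS; exact: closed_tends. Qed.

Lemma closed_subspace_seq H (S : set H) : S 0 ->
  (forall (a : R[i]) x y, S x -> S y -> S (a *: x + y)) ->
  (forall u l, (forall d, S (u d)) -> tends u l -> S l) -> closed_subspace S.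
Proof.
move=> S0 SP St; split => //; apply/closedP => x h.
have {}h d : exists a, S a /\ rnorm (x - a) < d.+1%:R^-1.
  by have [|a Sa xa] := h d.+1%:R^-1; [rewrite invr_gt0|exists a].
have [u hu] := choice h.
apply: (St u) => [d|]; first by have [] := hu d.
by apply: tends_inv => d; rewrite rnormB; have [] := hu d.
Qed.

Lemma closed_orthocomp H (A : set H) : closed_subspace (orthocomp A).
Proof.
apply: closed_subspace_seq => [y _|a x y hx hy z Az|u l hu ul z Az].
- by rewrite inner0l.
- by rewrite innerPl hx// hy// mulr0 addr0.
- apply: (tends_uniq (tends_innerl z ul)).
  by apply: eq_tends (@tends_cst _ _ 0); exists 0%N => d _; rewrite hu.
Qed.

(** By the parallelogram law, a minimizing sequence for the distance from x to S
    is Cauchy; its limit p is the nearest point, and comparing p with p + t s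
    shows that x - p is orthogonal to s. *)
Lemma projection H (S : set H) x : closed_subspace S ->
  exists2 p, S p & forall s, S s -> inner (x - p) s = 0.
Proof.
move=> cS; pose D := [set rnorm (x - s) ^+ 2 | s in S].
have D0 : D (rnorm (x - 0) ^+ 2) by exists 0 => //; exact: csub0.
have Dlb : lbound D 0 by move=> _ [s _ <-]; exact: sqr_ge0.
have hiD : has_inf D by split; [exists (rnorm (x - 0) ^+ 2)|exists 0].
have infD s : S s -> inf D <= rnorm (x - s) ^+ 2.
  by move=> Ss; apply: ge_inf; [exists 0|exists s].
have h d : exists s, S s /\ rnorm (x - s) ^+ 2 < inf D + d.+1%:R^-1.
  have [|_ [s Ss <-] hs] := @inf_adherent _ D d.+1%:R^-1 _ hiD.
    by rewrite invr_gt0.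
  by exists s.
have [u hu] := choice h.
have uu m n : rnorm (u m - u n) ^+ 2 <= 2 * (m.+1%:R^-1 + n.+1%:R^-1).
  have := parallelogram (x - u m) (x - u n).
  have -> : x - u m - (x - u n) = u n - u m by rewrite opprB addrCA addrAC subrr add0r.
  rewrite (rnormB (u n)).
  have [Sm hm] := hu m; have [Sn hn] := hu n.
  have Smn : S (2^-1 *: (u m + u n)) by apply: csubZ => //; exact: csubD.
  have -> : x - u m + (x - u n) = (2 : R[i]) *: (x - 2^-1 *: (u m + u n)).
    rewrite scalerBr scalerA divff ?pnatr_eq0// scale1r opprD addrACA.
    by rewrite scaler_nat mulr2n.
  rewrite rnormZ exprMn.
  have -> : rnorm (2 : R[i]) = 2 by rewrite -[2]/(2%:R) -(rmorph_nat (@real_complex R)) rnorm_real.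
  have := infD _ Smn.
  move: hm hn; set A := rnorm _ ^+ 2; set B := rnorm _ ^+ 2; set C := rnorm _ ^+ 2.
  set E := rnorm _ ^+ 2; set p := _^-1; set q := _^-1; lra.
have [e e0|p up] := @cauchy_tends _ _ u.
  have [N hN] := ler_tends0 (divr_gt0 (exprn_gt0 2 e0) (ltr0n R 4)).
  exists N => m n /hN + /hN; move: (uu m n).
  move=> h1 h2 h3; rewrite -(ltr_pXn2r (n := 2))// ?nnegrE ?rnorm_ge0// ?ltW//.
  move: h1 h2 h3; set A := rnorm _ ^+ 2; set B := e ^+ 2.
  set p := _^-1; set q := _^-1; lra.
have Sp : S p by apply: (csub_tends cS) up => d; have [] := hu d.
exists p => // s Ss.
have hp : rnorm (x - p) ^+ 2 <= inf D.
  rewrite -[leRHS]sqr_sqrtr; last first.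
    by apply: lb_le_inf => //; exists (rnorm (x - 0) ^+ 2).
  rewrite -ler_sqr_nneg ?rnorm_ge0 ?sqrtr_ge0//.
  apply: ler_eps => e e0.
  have i0 : 0 <= inf D by apply: lb_le_inf => //; exists (rnorm (x - 0) ^+ 2).
  have [N1 h1] := up (e/2) (divr_gt0 e0 (ltr0n R 2)).
  have e2 : 0 < (e/2) ^+ 2 by rewrite exprn_gt0// divr_gt0.
  have [N2 h2] := ler_tends0 e2.
  have {h1} h1 := h1 _ (leq_maxl N1 N2); have {h2} h2 := h2 _ (leq_maxr N1 N2).
  set N := maxn _ _ in h1 h2.
  have [_ h3] := hu N.
  have h4 : rnorm (x - u N) <= Num.sqrt (inf D) + e / 2.
    rewrite ler_sqr_nneg ?rnorm_ge0//; last by rewrite addr_ge0 ?sqrtr_ge0// divr_ge0// ltW.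
    rewrite sqrrD sqr_sqrtr//.
    have : 0 <= Num.sqrt (inf D) * (e / 2) by rewrite mulr_ge0 ?sqrtr_ge0// divr_ge0// ltW.
    move: h3 h2; rewrite -mulr_natl; set A := Num.sqrt _ * _; set B := inf D; set C := _^-1; lra.
  have -> : x - p = (x - u N) + (u N - p) by rewrite addrA subrK.
  rewrite (le_trans (rnormD _ _))//; move: h4 h1; lra.
have [s0|s0] := eqVneq s 0; first by rewrite s0 inner0r.
set c := inner (x - p) s.
have n0 : 0 < rnorm s.
  by rewrite lt_neqAle rnorm_ge0 andbT eq_sym; apply: contraNneq s0 => /rnorm0_eq0 ->.
(* The value of t that minimizes the distance from x to p + t s. *)
pose t : R[i] := c / ((rnorm s ^+ 2)%:C)%C.
have Sts : S (p + t *: s) by apply: csubD => //; exact: csubZ.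
have := le_trans hp (infD _ Sts).
rewrite opprD addrA (rnormB2 (x - p)) rnormZ exprMn {1}/t rnormM.
rewrite /rdot innerZr -/c.
have rV : rnorm (((rnorm s ^+ 2)%:C)%C^-1) = (rnorm s ^+ 2)^-1.
  by rewrite -(fmorphV (@real_complex R)) rnorm_real// invr_ge0 sqr_ge0.
have -> : complex.Re (t^* * c) = rnorm c ^+ 2 / rnorm s ^+ 2.
  rewrite /t rmorphM/= fmorphV/=.
  have -> : (((rnorm s ^+ 2)%:C)%C)^* = ((rnorm s ^+ 2)%:C)%C.
    by apply/CrealP; rewrite realE lecR sqr_ge0.
  rewrite mulrAC [c^* * c]mulrC -normCK normE -rmorphXn.
  by rewrite -(fmorphV (@real_complex R)) -rmorphM.
rewrite rV => h1.
apply: rnorm_le0.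
have : rnorm c ^+ 2 / rnorm s ^+ 2 <= 0.
  move: h1.
  have -> : (rnorm c * (rnorm s ^+ 2)^-1) ^+ 2 * rnorm s ^+ 2 = rnorm c ^+ 2 / rnorm s ^+ 2.
    by field; rewrite gt_eqF.
  by lra.
rewrite pmulr_lle0 ?invr_gt0 ?exprn_gt0// => h2.
rewrite leNgt; apply/negP => c0; have := exprn_gt0 2 c0; lra.
Qed.

End Projection.

(** * Adjoints, total families and extension of operators *)

Section Riesz.
Context {R : realType}.
Implicit Types H K : hilbertType R.

(** A nonzero functional is given by a multiple of any vector z orthogonal to its
    kernel, since x - (phi x / phi z) z lies in the kernel. *)
Lemma riesz H (phi : H -> R[i]) (C : R) :
  (forall a x y, phi (a *: x + y) = a * phi x + phi y) ->
  (forall x, rnorm (phi x) <= C * rnorm x) ->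
  exists y, forall x, phi x = inner x y.
Proof.
move=> lphi bphi.
have phi0 : phi 0 = 0 by apply: rnorm_le0; rewrite (le_trans (bphi 0))// rnorm0 mulr0.
have phiZ a x : phi (a *: x) = a * phi x by rewrite -[a *: x]addr0 lphi phi0 addr0.
have phiB x y : phi (x - y) = phi x - phi y.
  by rewrite addrC -scaleN1r lphi mulN1r addrC.
have [h|/existsNP[x0 /eqP x0phi]] := pselect (forall x, phi x = 0).
  by exists 0 => x; rewrite h inner0r.
have cK : closed_subspace [set x | phi x = 0].
  apply: closed_subspace_seq => [//|a x y /= hx hy|u l /= hu ul].
    by rewrite lphi hx hy mulr0 addr0.
  have h : tends (phi \o u) (phi l).
    by apply: tends_le ul => d /=; rewrite -phiB; exact: bphi.
  apply: (tends_uniq h); apply: eq_tends (@tends_cst _ _ 0).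
  by exists 0%N => d _; rewrite /= hu.
have [p /= p0 hp] := projection x0 cK.
set z := x0 - p in hp.
have phiz : phi z = phi x0 by rewrite phiB p0 subr0.
have z0 : inner z z != 0.
  rewrite innerxx -[0]/(0%:C%C) (inj_eq (@complexI R)) sqrf_eq0.
  apply: contraNneq x0phi => /rnorm0_eq0 z0; by rewrite -phiz z0 phi0.
exists ((phi z / inner z z)^* *: z) => x; rewrite innerZr conjCK.
have : inner z (x - (phi x / phi z) *: z) = 0.
  by apply: hp => /=; rewrite phiB phiZ divfK ?subrr// phiz.
move/inner_sym0; rewrite innerBl innerZl => /eqP; rewrite subr_eq0 => /eqP ->.
by rewrite mulrCA [_ / inner z z * _]mulrAC -mulrA divff// mulr1 divfK// phiz.
Qed.

Definition adj H K (T : H -> K) (y : K) : H :=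
  xget 0 [set z | forall x, inner (T x) y = inner x z].

Lemma adjE H K (T : H -> K) x y : bounded_op T ->
  inner (T x) y = inner x (adj T y).
Proof.
move=> bT; rewrite /adj; case: xgetP => [z _ //|h]; exfalso.
have [_ [C C0 hC]] := (bounded_opP _).1 bT.
have [a u v|u|z hz] := @riesz _ (fun x => inner (T x) y) (C * rnorm y).
- by rewrite (opP _ _ _ bT) innerPl.
- by rewrite (le_trans (cauchy_schwarz _ _))// mulrAC ler_wpM2r// rnorm_ge0.
- exact: (h z).
Qed.

Lemma adjEr H K (T : H -> K) x y : bounded_op T ->
  inner (adj T y) x = inner y (T x).
Proof. by move=> bT; rewrite inner_conj -adjE// -inner_conj. Qed.

Lemma bounded_adj H K (T : H -> K) : bounded_op T -> bounded_op (adj T).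
Proof.
move=> bT; apply/bounded_opP; split.
  move=> a x y; apply: inner_inj => z.
  by rewrite adjEr// !innerPl !adjEr.
have [_ [C C0 hC]] := (bounded_opP _).1 bT.
exists C => // y; have [->|n0] := eqVneq (rnorm (adj T y)) 0.
  by rewrite mulr_ge0// rnorm_ge0.
have n1 : 0 < rnorm (adj T y) by rewrite lt_neqAle rnorm_ge0 eq_sym n0.
rewrite -(ler_pM2r n1) -expr2.
have -> : rnorm (adj T y) ^+ 2 = rnorm (inner (adj T y) (adj T y)).
  by rewrite innerxx rnorm_real// sqr_ge0.
rewrite -adjE// (le_trans (cauchy_schwarz _ _))// mulrAC.
by rewrite ler_wpM2r// rnorm_ge0.
Qed.

(** Equivalent to density of the linear span; in this form two bounded operators
    can be compared through their adjoints, without linear combinations. *)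
Definition total_fam H X (u : X -> H) := forall x, (forall i, inner x (u i) = 0) -> x = 0.

Lemma total_inj H X (u : X -> H) x y : total_fam u ->
  (forall i, inner x (u i) = inner y (u i)) -> x = y.
Proof.
move=> tu h; apply/eqP; rewrite -subr_eq0; apply/eqP/tu => i.
by rewrite innerBl h subrr.
Qed.

Lemma eq_on_total H K X (u : X -> H) (S T : H -> K) : total_fam u ->
  bounded_op S -> bounded_op T -> (forall i, S (u i) = T (u i)) -> forall x, S x = T x.
Proof.
move=> tu bS bT h x; apply: inner_inj => y.
rewrite !adjE//; congr (inner x _); apply: (total_inj tu) => i.
by rewrite !adjEr// h.
Qed.

Lemma zero_on_total H K X (u : X -> H) (T : H -> K) : total_fam u ->
  bounded_op T -> (forall i, T (u i) = 0) -> forall x, T x = 0.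
Proof. by move=> tu bT h; apply: (eq_on_total tu bT (bounded_0 _ _)). Qed.

Lemma closed_subspace_closure H (L : set H) : L 0 ->
  (forall (a : R[i]) x y, L x -> L y -> L (a *: x + y)) ->
  closed_subspace (closure L).
Proof.
move=> L0 LP; split; [|move=> a x y /closureP hx /closureP hy|exact: closed_closure].
  exact: subset_closure.
apply/closureP => e e0.
have e1 : 0 < e / 2 / (rnorm a + 1) by rewrite !divr_gt0// ltr_wpDl// rnorm_ge0.
have [x' Lx xx] := hx _ e1.
have [y' Ly yy] := hy _ (divr_gt0 e0 (ltr0n R 2)).
exists (a *: x' + y'); first exact: LP.
rewrite opprD addrACA -scalerBr (le_lt_trans (rnormD _ _))// [ltRHS](splitr e).
rewrite ler_ltD// rnormZ.
move: xx; rewrite ltr_pdivlMr; last by rewrite ltr_wpDl// rnorm_ge0.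
move/ltW; apply: le_trans; rewrite mulrC ler_wpM2l ?rnorm_ge0//.
by rewrite lerDl.
Qed.

Lemma total_closed H X (u : X -> H) (S : set H) : total_fam u ->
  closed_subspace S -> (forall i, S (u i)) -> forall x, S x.
Proof.
move=> tu cS Su x; have [p Sp hp] := projection x cS.
suff : x - p = 0 by move/eqP; rewrite subr_eq0 => /eqP ->.
by apply: tu => i; exact: hp.
Qed.

Definition lincomb H X (u : X -> H) (l : seq (R[i] * X)) : H :=
  \sum_(c <- l) c.1 *: u c.2.

Lemma lincomb_cat H X (u : X -> H) l m :
  lincomb u (l ++ m) = lincomb u l + lincomb u m.
Proof. by rewrite /lincomb big_cat. Qed.

Lemma lincombZ H X (u : X -> H) a l :
  lincomb u [seq (a * c.1, c.2) | c <- l] = a *: lincomb u l.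
Proof.
by rewrite /lincomb big_map scaler_sumr; apply: eq_bigr => c _; rewrite scalerA.
Qed.

Lemma total_dense H X (u : X -> H) x (e : R) : total_fam u -> 0 < e ->
  exists l, rnorm (x - lincomb u l) < e.
Proof.
move=> tu e0.
have /closureP/(_ e e0)[_ [l _ <-] h] : closure (range (lincomb u)) x.
  apply: (total_closed tu).
    apply: closed_subspace_closure => [|a _ _ [l _ <-] [m _ <-]].
      by exists [::] => //; rewrite /lincomb big_nil.
    by exists ([seq (a * c.1, c.2) | c <- l] ++ m); rewrite ?lincomb_cat ?lincombZ.
  move=> i; apply: subset_closure; exists [:: (1, i)] => //.
  by rewrite /lincomb big_seq1 scale1r.
by exists l.
Qed.

Lemma dense_total H (D : set H) x : dense D -> (forall d, D d -> inner x d = 0) -> x = 0.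
Proof.
move=> /denseP dD hD; apply: inner_eq0 => y.
apply: rnorm_le0; apply: ler_eps => e e0; rewrite add0r.
have x1 : 0 < rnorm x + 1 by rewrite ltr_wpDl ?rnorm_ge0.
have [d Dd] := dD y (e / (rnorm x + 1)) (divr_gt0 e0 x1).
rewrite ltr_pdivlMr// => h.
rewrite -(subrK d y) innerDr (hD d Dd) addr0 (le_trans (cauchy_schwarz _ _))//.
by rewrite mulrC (le_trans _ (ltW h))// ler_wpM2l ?rnorm_ge0// lerDl.
Qed.

(** Extension by continuity: the bound on finite combinations makes the images of
    any approximating sequence Cauchy, with a limit that depends on x alone. *)
Lemma extend H K X (u : X -> H) (v : X -> K) (C : R) : total_fam u -> 0 <= C ->
  (forall l, rnorm (lincomb v l) <= C * rnorm (lincomb u l)) ->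
  exists V : H -> K, [/\ bounded_op V, forall i, V (u i) = v i &
    forall x, rnorm (V x) <= C * rnorm x].
Proof.
move=> tu C0 hC.
pose rel x y := exists l : nat -> seq (R[i] * X),
  tends (fun d => lincomb u (l d)) x /\ tends (fun d => lincomb v (l d)) y.
have rel_ex x : exists y, rel x y.
  have hd (d : nat) : exists l, rnorm (lincomb u l - x) < d.+1%:R^-1.
    have [|l hl] := @total_dense _ _ u x d.+1%:R^-1 tu; first by rewrite invr_gt0.
    by exists l; rewrite rnormB.
  have [l hl] := choice hd.
  have ul : tends (fun d => lincomb u (l d)) x by exact: tends_inv.
  have [e e0|y hy] := @cauchy_tends _ _ (fun d => lincomb v (l d)); last first.
    by exists y, l.
  have e1 : 0 < e / 2 / (C + 1) by rewrite !divr_gt0// ltr_wpDl.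
  have [N hN] := ul _ e1; exists N => m n /hN hm /hN hn.
  have -> : lincomb v (l m) - lincomb v (l n) =
      lincomb v (l m ++ [seq (-1 * c.1, c.2) | c <- l n]).
    by rewrite lincomb_cat lincombZ scaleN1r.
  rewrite (le_lt_trans (hC _))// lincomb_cat lincombZ scaleN1r.
  have -> : lincomb u (l m) - lincomb u (l n) =
     (lincomb u (l m) - x) - (lincomb u (l n) - x) by rewrite opprB addrA subrK.
  have : rnorm (lincomb u (l m) - x - (lincomb u (l n) - x)) < e / (C + 1).
    rewrite (le_lt_trans (rnormD _ _))// rnormN.
    have -> : e / (C + 1) = e / 2 / (C + 1) + e / 2 / (C + 1).
      by rewrite -mulrDl -splitr.
    exact: ltrD.
  rewrite ltr_pdivlMr ?ltr_wpDl//; apply: le_lt_trans.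
  by rewrite mulrC ler_wpM2l ?rnorm_ge0// lerDl.
have rel_le x y : rel x y -> rnorm y <= C * rnorm x.
  move=> [l [ul vl]]; apply: ler_eps => e e0.
  have e1 : 0 < e / 2 / (C + 1) by rewrite !divr_gt0// ltr_wpDl.
  have [N1 h1] := ul _ e1.
  have [N2 h2] := vl _ (divr_gt0 e0 (ltr0n R 2)).
  have {h1} h1 := h1 _ (leq_maxl N1 N2); have {h2} h2 := h2 _ (leq_maxr N1 N2).
  set m := l _ in h1 h2.
  rewrite -[y](subrK (lincomb v m)) (le_trans (rnormD _ _))// rnormB.
  have := hC m.
  have : C * rnorm (lincomb u m) <= C * rnorm x + e / 2.
    rewrite -{1}[lincomb u m](subrK x).
    apply: (le_trans (ler_wpM2l C0 (rnormD _ _))).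
    rewrite mulrDr addrC lerD2l.
    move: h1; rewrite ltr_pdivlMr ?ltr_wpDl// => /ltW; apply: le_trans.
    by rewrite mulrC ler_wpM2l ?rnorm_ge0// lerDl.
  lra.
have rel_lin a x y x' y' : rel x y -> rel x' y' -> rel (a *: x + x') (a *: y + y').
  move=> [l [ul vl]] [m [um vm]].
  exists (fun d => [seq (a * c.1, c.2) | c <- l d] ++ m d); split.
    have := tendsD (tendsZ a ul) um; apply: eq_tends; exists 0%N => d _.
    by rewrite lincomb_cat lincombZ.
  have := tendsD (tendsZ a vl) vm; apply: eq_tends; exists 0%N => d _.
  by rewrite lincomb_cat lincombZ.
have rel_uniq x y y' : rel x y -> rel x y' -> y = y'.
  move=> h h'; have := rel_lin (-1) _ _ _ _ h h'.
  rewrite !scaleN1r addNr => /rel_le; rewrite rnorm0 mulr0 => /rnorm_le0/eqP.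
  by rewrite addrC subr_eq0 => /eqP ->.
have [V hV] := choice rel_ex.
exists V; split=> [|i|x].
- apply/bounded_opP; split; last by exists C => // x; exact: rel_le.
  by move=> a x y; apply: rel_uniq (hV _) _; apply: rel_lin.
- apply: rel_uniq (hV _) _; exists (fun=> [:: (1, i)]); rewrite /lincomb.
  by rewrite !big_seq1 !scale1r; split; exact: tends_cst.
- exact: rel_le.
Qed.

Lemma inner_lincomb H X (u : X -> H) l m : inner (lincomb u l) (lincomb u m) =
  \sum_(c <- l) \sum_(b <- m) c.1 * (b.1^* * inner (u c.2) (u b.2)).
Proof.
rewrite inner_suml; apply: eq_bigr => c _; rewrite inner_sumr.
by apply: eq_bigr => b _; rewrite innerZl innerZr.
Qed.

Definition isometric H K (V : H -> K) := forall x y, inner (V x) (V y) = inner x y.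

Lemma isometric_norm H K (V : H -> K) x : isometric V -> rnorm (V x) = rnorm x.
Proof.
move=> iV; have := iV x x; rewrite !innerxx => /(@complexI R) h.
by apply/eqP; rewrite -(eqrXn2 (n := 2)) ?rnorm_ge0// h.
Qed.

Lemma adj_isometric H K (V : H -> K) x : bounded_op V -> isometric V -> adj V (V x) = x.
Proof. by move=> bV iV; apply: inner_inj => y; rewrite adjEr. Qed.

(** Preserving the inner products of a total family gives both the bound needed
    for the extension and V^* V = 1. *)
Lemma extend_isometry H K X (u : X -> H) (v : X -> K) : total_fam u ->
  (forall i j, inner (v i) (v j) = inner (u i) (u j)) ->
  exists V : H -> K, [/\ bounded_op V, forall i, V (u i) = v i & isometric V].
Proof.
move=> tu uv; have [|l|V [bV Vu Vn]] := @extend _ _ _ u v 1 tu; first exact: ler01.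
  rewrite mul1r ler_sqr_nneg ?rnorm_ge0// -lecR -!innerxx !inner_lincomb.
  by under eq_bigr do under eq_bigr do rewrite uv.
exists V; split => // x y; rewrite adjE//; congr (inner x _).
rewrite -[RHS]/(idfun y) -[LHS]/((adj V \o V) y).
apply: (eq_on_total tu _ (bounded_id _)) => [|i].
  by apply: bounded_comp => //; exact: bounded_adj.
by apply: (total_inj tu) => j /=; rewrite adjEr// !Vu uv.
Qed.

(** A limit l of vectors of the range is V (V^* l). *)
Lemma closed_range_isometric H K (V : H -> K) : bounded_op V -> isometric V ->
  closed_subspace (range V).
Proof.
move=> bV iV; apply: closed_subspace_seq.
- by exists 0 => //; exact: op0.
- by move=> a _ _ [x _ <-] [y _ <-]; exists (a *: x + y) => //; rewrite opP.
- move=> u l hu ul.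
  have h d : exists x, V x = u d by have [x _ <-] := hu d; exists x.
  have [x hx] := choice h.
  exists (adj V l) => //.
  have := tends_op bV (tends_op (bounded_adj bV) ul) => /tends_uniq; apply.
  by apply: eq_tends ul; exists 0%N => d _ /=; rewrite -hx adj_isometric.
Qed.

End Riesz.

(** * Uniform boundedness *)

Section UniformBoundedness.
Context {R : realType}.
Implicit Types H K : hilbertType R.

(** One of x + w and x - w has an image at least as large as that of w, because
    their images differ by 2 (A d w); this places the new centre, and continuity
    of A d gives the new radius. *)
Lemma unbounded_step H K (A : nat -> H -> K) : (forall d, bounded_op (A d)) ->
  ~ (exists C : R, forall d x, rnorm (A d x) <= C * rnorm x) ->
  forall (k : nat) (x : H) (r : R), 0 < r -> exists x' (r' : R), [/\ 0 < r', r' <= r / 2,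
    rnorm (x' - x) <= r / 2 &
    exists d, forall y, rnorm (y - x') <= r' -> k%:R < rnorm (A d y)].
Proof.
move=> bA nA k x r r0.
have [d [u hu]] : exists d u, 2 * k.+1%:R / r * rnorm u < rnorm (A d u).
  apply: contrapT => h; apply: nA; exists (2 * k.+1%:R / r) => d u.
  by rewrite leNgt; apply/negP => hu; apply: h; exists d, u.
have u0 : 0 < rnorm u.
  rewrite lt_neqAle rnorm_ge0 andbT eq_sym; apply/negP => /eqP/rnorm0_eq0 u0.
  by move: hu; rewrite u0 op0// !rnorm0 mulr0 ltxx.
pose w := (r / 2 / rnorm u)%:C%C *: u.
have rw : rnorm w = r / 2.
  by rewrite rnormZ rnorm_real ?divfK ?gt_eqF// !divr_ge0// ltW.
have Aw : k.+1%:R < rnorm (A d w).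
  rewrite opZ// rnormZ rnorm_real; last by rewrite !divr_ge0// ltW.
  rewrite mulrAC ltr_pdivlMr// mulrAC ltr_pdivlMr//.
  move: hu; rewrite mulrAC ltr_pdivrMr//.
  set a := rnorm _; set b := rnorm _; set c := _%:R; lra.
have [x' [xx' Ax']] : exists x', rnorm (x' - x) <= r / 2 /\ k.+1%:R < rnorm (A d x').
  have [h|h] := ltP k.+1%:R (rnorm (A d (x + w))).
    by exists (x + w); split=> //; rewrite addrAC subrr add0r rw.
  exists (x - w); split; first by rewrite addrAC subrr add0r rnormN rw.
  have := rnormD (A d (x + w)) (- A d (x - w)).
  have -> : A d (x + w) - A d (x - w) = (2 : R[i]) *: A d w.
    by rewrite -opB// opprB addrC addrA subrK -mulr2n -scaler_nat opZ.
  rewrite rnormZ rnormN.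
  have -> : rnorm (2 : R[i]) = 2.
    by rewrite -[2]/(2%:R) -(rmorph_nat (@real_complex R)) rnorm_real.
  move: h Aw; set a := rnorm _; set b := rnorm _; set c := rnorm _; lra.
have [_ [B B0 hB]] := (bounded_opP _).1 (bA d).
exists x', (Num.min (r / 2) (B + 1)^-1); split => //.
- by rewrite lt_min invr_gt0 !divr_gt0// ltr_wpDl.
- by rewrite ge_min lexx.
exists d => y; rewrite le_min => /andP[_ hy].
have h1 : rnorm (A d (x' - y)) <= 1.
  rewrite (le_trans (hB _))// rnormB.
  apply: (le_trans (ler_wpM2l B0 hy)).
  by rewrite ler_pdivrMr ?ltr_wpDl// mul1r lerDl.
have := rnormD (A d (x' - y)) (A d y).
rewrite -opD// subrK; move: Ax' h1; rewrite -natr1.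
set a := rnorm _; set b := rnorm _; set c := rnorm _; lra.
Qed.

(** If no uniform bound existed, iterating the previous lemma would give nested
    balls whose common point x has A d x arbitrarily large. *)
Lemma uniform_boundedness H K (A : nat -> H -> K) : (forall d, bounded_op (A d)) ->
  (forall x, exists C : R, forall d, rnorm (A d x) <= C) ->
  exists C : R, forall d x, rnorm (A d x) <= C * rnorm x.
Proof.
move=> bA pA; apply: contrapT => nA.
have st := unbounded_step bA nA.
have stc (p : nat * (H * {posnum R})) : exists q : H * {posnum R},
    [/\ q.2%:num <= p.2.2%:num / 2, rnorm (q.1 - p.2.1) <= p.2.2%:num / 2 &
     exists d, forall y, rnorm (y - q.1) <= q.2%:num -> p.1%:R < rnorm (A d y)].
  have [x' [r' [r0 h1 h2 h3]]] := st p.1 p.2.1 p.2.2%:num ltac:(by []).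
  by exists (x', PosNum r0).
have [F hF] := choice stc.
pose s := fix s n := if n is m.+1 then F (m, s m) else (0 : H, PosNum (@ltr01 R)).
have hs n : [/\ (s n.+1).2%:num <= (s n).2%:num / 2,
    rnorm ((s n.+1).1 - (s n).1) <= (s n).2%:num / 2 &
    exists d, forall y, rnorm (y - (s n.+1).1) <= (s n.+1).2%:num -> n%:R < rnorm (A d y)].
  exact: (hF (n, s n)).
have nest m n y : (n <= m)%N -> rnorm (y - (s m).1) <= (s m).2%:num ->
    rnorm (y - (s n).1) <= (s n).2%:num.
  elim: m y => [|m IH] y; first by rewrite leqn0 => /eqP ->.
  rewrite leq_eqVlt => /orP[/eqP ->//|nm] hy; apply: IH => //.
  have [h1 h2 _] := hs m.
  rewrite -(subrK (s m.+1).1 y) -addrA (le_trans (rnormD _ _))//.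
  by rewrite (le_trans (lerD (le_trans hy h1) h2))// -splitr.
have rad n : (s n).2%:num <= n.+1%:R^-1.
  elim: n => [|n IH]; first by rewrite invr1.
  have [h1 _ _] := hs n; rewrite (le_trans h1)//.
  rewrite (le_trans (ler_pM _ _ IH (lexx _)))// -invfM lef_pV2 ?posrE//.
  by rewrite -natrM ler_nat muln2 -addnn addnS addSn ltnS ltnS leq_addr.
have nests m n : (n <= m)%N -> rnorm ((s m).1 - (s n).1) <= (s n).2%:num.
  by move=> nm; apply: (nest m) => //; rewrite subrr rnorm0.
have [e e0|x ux] := @cauchy_tends _ _ (fun n => (s n).1).
  have [N hN] := ler_tends0 (divr_gt0 e0 (ltr0n R 2)).
  exists N => m n Nm Nn.
  have -> : (s m).1 - (s n).1 = ((s m).1 - (s N).1) - ((s n).1 - (s N).1).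
    by rewrite opprB addrA subrK.
  rewrite (le_lt_trans (rnormD _ _))// rnormN.
  move: (nests _ _ Nm) (nests _ _ Nn) (rad N) (hN _ (leqnn N)).
  set a := rnorm _; set b := rnorm _; set c := _%:num; set i := _^-1; lra.
have hx n : rnorm (x - (s n).1) <= (s n).2%:num.
  apply: ler_eps => e /ux[N /(_ _ (leq_maxl N n))].
  have := nests _ _ (leq_maxr N n); rewrite (rnormB _ x); set M := maxn _ _.
  move=> h1 h2; rewrite -(subrK (s M).1 x) -addrA (le_trans (rnormD _ _))//.
  move: h1 h2; lra.
have [C hC] := pA x.
have [_ _ [d hd]] := hs (Num.truncn C).+1.
have := hd _ (hx _); rewrite ltNge => /negP; apply.
rewrite (le_trans (hC d))// ltW//; exact: truncnS_gt.
Qed.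

End UniformBoundedness.

(** * Projection onto an orthogonal complement *)

Section Compression.
Context {R : realType}.
Implicit Types H K : hilbertType R.

Lemma bounded_val H (A : set H) : bounded_op (fun x : ocomp A => (\val x : H)).
Proof. by apply/bounded_opP; split => //; exists 1 => // x; rewrite mul1r. Qed.

Lemma inner_val H (A : set H) (x y : ocomp A) : inner (\val x) (\val y) = inner x y.
Proof. by []. Qed.

Lemma valP_orthocomp H (A : set H) (x : ocomp A) : orthocomp A (\val x).
Proof. exact/orthocomp_predP/(valP x). Qed.

Lemma inner_oproj H (A : set H) x (z : ocomp A) :
  inner (oproj A x) z = inner x (\val z).
Proof.
rewrite /oproj; case: xgetP => [y _ /(_ z)|h].
  by rewrite innerBl => /eqP; rewrite subr_eq0 => /eqP ->.
exfalso; have [p Sp hp] := projection x (closed_orthocomp A).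
apply: (h (Ocomp ((orthocomp_predP _ _).2 Sp))) => w.
exact/hp/valP_orthocomp.
Qed.

Lemma oproj_adj H (A : set H) x :
  oproj A x = adj (fun x : ocomp A => (\val x : H)) x.
Proof.
by apply: inner_inj => z; rewrite inner_oproj adjEr//; exact: bounded_val.
Qed.

Lemma bounded_oproj H (A : set H) : bounded_op (oproj A).
Proof.
have -> : oproj A = adj (fun x : ocomp A => (\val x : H)).
  by apply/funext => x; exact: oproj_adj.
exact/bounded_adj/bounded_val.
Qed.

End Compression.

(** * Ampliations *)

Section TensorBasics.
Context {R : realType} {H K : hilbertType R}.
Variable P : tensor_product H K.

Lemma tensorPl a x x' y :
  tensor P (a *: x + x') y = a *: tensor P x y + tensor P x' y.
Proof. by rewrite linearPl. Qed.

Lemma tensorPr a x y y' :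
  tensor P x (a *: y + y') = a *: tensor P x y + tensor P x y'.
Proof. by rewrite linearPr. Qed.

Lemma tensor0l y : tensor P 0 y = 0.
Proof. by rewrite linear0l. Qed.

Lemma tensorBl x x' y : tensor P (x - x') y = tensor P x y - tensor P x' y.
Proof. by rewrite linearBl. Qed.

Lemma tensor_total : total_fam (fun p : H * K => tensor P p.1 p.2).
Proof.
move=> x hx; apply: (dense_total (@dense_tensor _ _ _ P)) => _ [m [u [v ->]]].
by rewrite inner_sumr big1// => i _; exact: (hx (u i, v i)).
Qed.

Lemma rnorm_tensor x y : rnorm (tensor P x y) = rnorm x * rnorm y.
Proof.
apply/eqP; rewrite -(eqrXn2 (n := 2)) ?mulr_ge0 ?rnorm_ge0//; apply/eqP.
apply: (@complexI R); rewrite -innerxx inner_tensor !innerxx.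
by rewrite exprMn [RHS]rmorphM.
Qed.

Lemma bounded_tensorl y : bounded_op (fun x => tensor P x y).
Proof.
apply/bounded_opP; split; first by move=> a x x'; rewrite tensorPl.
by exists (rnorm y); [exact: rnorm_ge0|move=> x; rewrite rnorm_tensor mulrC].
Qed.

Lemma bounded_tensorr x : bounded_op (tensor P x).
Proof.
apply/bounded_opP; split; first by move=> a y y'; rewrite tensorPr.
by exists (rnorm x); [exact: rnorm_ge0|move=> y; rewrite rnorm_tensor].
Qed.

Lemma tensor_total_fam X Y (u : X -> H) (v : Y -> K) : total_fam u -> total_fam v ->
  total_fam (fun p : X * Y => tensor P (u p.1) (v p.2)).
Proof.
move=> tu tv z hz; apply: tensor_total => -[x y] /=.
rewrite inner_conj (@adjE _ _ _ (fun x => tensor P x y)); last exact: bounded_tensorl.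
set w := adj _ _; suff -> : w = 0 by rewrite inner0r rmorph0.
apply: tu => i; rewrite /w adjEr; last exact: bounded_tensorl.
rewrite inner_conj (@adjE _ _ _ (tensor P (u i))); last exact: bounded_tensorr.
set w' := adj _ _; suff -> : w' = 0 by rewrite inner0r rmorph0.
apply: tv => j; rewrite /w' adjEr; last exact: bounded_tensorr.
exact: (hz (i, j)).
Qed.

Lemma tensor_total_faml X (u : X -> H) : total_fam u ->
  total_fam (fun p : X * K => tensor P (u p.1) p.2).
Proof.
move=> tu; apply: (@tensor_total_fam _ _ u idfun) => // x hx; exact: inner_eq0.
Qed.

End TensorBasics.

Arguments tensor_total {R H K} P.
Arguments bounded_tensorl {R H K} P y.
Arguments bounded_tensorr {R H K} P x.

Section Ampliation.
Context {R : realType}.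
Implicit Types H K L : hilbertType R.

Local Notation amp P := (@ampliation _ _ _ P).

Lemma sum_orthogonal_proj H K (s : seq (H * K)) (y : K) r :
  pairwise (fun p q => inner p.2 q.2 == 0) s -> r \in s ->
  \sum_(q <- s) (inner y q.2 / inner q.2 q.2) * inner q.2 r.2 = inner y r.2.
Proof.
elim: s => [//|q s IH] /= /andP[/allP hq ps]; rewrite in_cons big_cons.
move=> /orP[/eqP ->|rs].
  rewrite big_seq big1 => [|q' /hq/eqP/inner_sym0 ->]; last by rewrite mulr0.
  rewrite addr0; have [q0|q0] := eqVneq (inner q.2 q.2) 0; last by rewrite divfK.
  rewrite q0 mulr0; move: q0; rewrite innerxx => /(@complexI R)/eqP.
  by rewrite sqrf_eq0 => /eqP/rnorm0_eq0 ->; rewrite inner0r.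
by have /eqP -> := hq _ rs; rewrite mulr0 add0r IH.
Qed.

(** Gram-Schmidt in the second factor. Since the rewriting is the same for every
    bilinear map b, it applies at once to a sum of tensors and to its image under
    an ampliation. *)
Lemma orthogonalize H K (l : seq (H * K)) : exists l' : seq (H * K),
  pairwise (fun p q => inner p.2 q.2 == 0) l' /\
  forall (L : hilbertType R) (b : H -> K -> L),
    (forall a x x' y, b (a *: x + x') y = a *: b x y + b x' y) ->
    (forall a x y y', b x (a *: y + y') = a *: b x y + b x y') ->
    \sum_(p <- l) b p.1 p.2 = \sum_(p <- l') b p.1 p.2.
Proof.
elim: l => [|[x y] l [s [ps hs]]]; first by exists [::].
pose c (q : H * K) := inner y q.2 / inner q.2 q.2.
pose yp := y - \sum_(q <- s) c q *: q.2.
exists ((x, yp) :: [seq (c q *: x + q.1, q.2) | q <- s]); split.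
  rewrite /= pairwise_map ps andbT; apply/allP => _ /mapP[q qs ->] /=.
  rewrite innerBl inner_suml.
  under eq_bigr do rewrite innerZl.
  by rewrite sum_orthogonal_proj// subrr.
move=> L b bl br; rewrite !big_cons big_map /= (hs L b)//.
under [in RHS]eq_bigr do rewrite bl.
rewrite big_split/= addrA; congr (_ + _).
have b0 z : b z 0 = 0.
  by have := br (-1) z 0 0; rewrite scaleN1r addNr => ->; rewrite scaleN1r addNr.
rewrite -{1}[y](subrK (\sum_(q <- s) c q *: q.2)) -/yp.
rewrite -[yp]scale1r br !scale1r; congr (_ + _).
elim: s {ps hs yp} => [|q s IH]; first by rewrite !big_nil b0.
by rewrite !big_cons br IH.
Qed.

Lemma rnorm_sum_orthogonal L I (s : seq I) (F : I -> L) :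
  pairwise (fun p q => inner (F p) (F q) == 0) s ->
  rnorm (\sum_(p <- s) F p) ^+ 2 = \sum_(p <- s) rnorm (F p) ^+ 2.
Proof.
elim: s => [|p s IH]; first by rewrite !big_nil rnorm0 expr0n.
rewrite /= => /andP[hp ps]; rewrite !big_cons pythagoras ?IH//.
rewrite inner_sumr; elim: s hp {ps IH} => [|q s IH]; first by rewrite big_nil.
by rewrite /= big_cons => /andP[/eqP -> /IH ->]; rewrite addr0.
Qed.

(** Once the second components are orthogonal, both squared norms are sums of the
    squares of products of norms, and the bound holds term by term. *)
Lemma ampliation_bound H K (P : tensor_product H K) (T : H -> H) (C : R)
    (l : seq (R[i] * (H * K))) : bounded_op T -> 0 <= C ->
  (forall x, rnorm (T x) <= C * rnorm x) ->
  rnorm (lincomb (fun p : H * K => tensor P (T p.1) p.2) l) <=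
    C * rnorm (lincomb (fun p : H * K => tensor P p.1 p.2) l).
Proof.
move=> bT C0 hC.
have E (b : H -> K -> P) : (forall a x x' y, b (a *: x + x') y = a *: b x y + b x' y) ->
    lincomb (fun p => b p.1 p.2) l = \sum_(p <- [seq (c.1 *: c.2.1, c.2.2) | c <- l]) b p.1 p.2.
  move=> bl; rewrite big_map /lincomb; apply: eq_bigr => c _ /=.
  have b0 y : b 0 y = 0.
    by have := bl (-1) 0 0 y; rewrite scaleN1r addNr => ->; rewrite scaleN1r addNr.
  by rewrite -[_ *: c.2.1]addr0 bl b0 addr0.
have bl a x x' y : tensor P (T (a *: x + x')) y = a *: tensor P (T x) y + tensor P (T x') y.
  by rewrite opP// tensorPl.
rewrite (E (fun x y => tensor P (T x) y))// (E (tensor P)); last exact: tensorPl.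
have [s [ps hs]] := orthogonalize [seq (c.1 *: c.2.1, c.2.2) | c <- l].
rewrite (hs _ (fun x y => tensor P (T x) y))//; last by move=> *; exact: tensorPr.
rewrite (hs _ (tensor P))//; [|exact: tensorPl|exact: tensorPr].
rewrite ler_sqr_nneg ?mulr_ge0 ?rnorm_ge0// exprMn !rnorm_sum_orthogonal.
- rewrite mulr_sumr; apply: ler_sum => p _; rewrite !rnorm_tensor -exprMn.
  by rewrite -ler_sqr_nneg ?mulr_ge0 ?rnorm_ge0// mulrA ler_wpM2r// rnorm_ge0.
- by apply: sub_pairwise ps => p q /eqP pq; rewrite inner_tensor pq mulr0.
- by apply: sub_pairwise ps => p q /eqP pq; rewrite inner_tensor pq mulr0.
Qed.

Lemma ampliation_ex H K (P : tensor_product H K) (T : H -> H) (C : R) :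
  bounded_op T -> 0 <= C -> (forall x, rnorm (T x) <= C * rnorm x) ->
  exists S : P -> P, [/\ bounded_op S,
    forall x y, S (tensor P x y) = tensor P (T x) y &
    forall x, rnorm (S x) <= C * rnorm x].
Proof.
move=> bT C0 hC.
have [l|S [bS hS nS]] := @extend _ _ _ _ (fun p : H * K => tensor P p.1 p.2)
   (fun p : H * K => tensor P (T p.1) p.2) C (tensor_total P) C0.
  exact: ampliation_bound.
by exists S; split => // x y; exact: (hS (x, y)).
Qed.

Lemma ampliationP H K (P : tensor_product H K) (T : H -> H) : bounded_op T ->
  bounded_op (amp P T) /\
  forall x y, amp P T (tensor P x y) = tensor P (T x) y.
Proof.
move=> bT; have [_ [C C0 hC]] := (bounded_opP _).1 bT.
have [S [bS hS _]] := @ampliation_ex _ _ P _ _ bT C0 hC.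
rewrite /ampliation; case: xgetP => [S' _ //|h].
by exfalso; exact: (h S).
Qed.

Lemma bounded_ampliation H K (P : tensor_product H K) (T : H -> H) :
  bounded_op T -> bounded_op (amp P T).
Proof. by move=> /(@ampliationP _ _ P _)[]. Qed.

Lemma ampliation_tensor H K (P : tensor_product H K) (T : H -> H) x y :
  bounded_op T -> amp P T (tensor P x y) = tensor P (T x) y.
Proof. by move=> /(@ampliationP _ _ P _)[]. Qed.

Lemma ampliation_uniq H K (P : tensor_product H K) (T : H -> H) (S : P -> P) :
  bounded_op T -> bounded_op S ->
  (forall x y, S (tensor P x y) = tensor P (T x) y) ->
  forall z, S z = amp P T z.
Proof.
move=> bT bS hS; have [bA hA] := @ampliationP _ _ P _ bT.
by apply: (eq_on_total (tensor_total P)) => // -[x y] /=; rewrite hS hA.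
Qed.

Lemma rnorm_ampliation H K (P : tensor_product H K) (T : H -> H) (C : R) z :
  bounded_op T -> 0 <= C -> (forall x, rnorm (T x) <= C * rnorm x) ->
  rnorm (amp P T z) <= C * rnorm z.
Proof.
move=> bT C0 hC; have [S [bS hS nS]] := @ampliation_ex _ _ P _ _ bT C0 hC.
by rewrite -(ampliation_uniq bT bS hS).
Qed.

Lemma ampliation_comp H K (P : tensor_product H K) (S T : H -> H) z :
  bounded_op S -> bounded_op T ->
  amp P (S \o T) z = amp P S (amp P T z).
Proof.
move=> bS bT; symmetry.
apply: (ampliation_uniq (S := amp P S \o amp P T)).
- exact: bounded_comp.
- by apply: bounded_comp; exact: bounded_ampliation.
- by move=> x y /=; rewrite !ampliation_tensor.
Qed.

Lemma ampliation_lin H K (P : tensor_product H K) a (S T : H -> H) z :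
  bounded_op S -> bounded_op T ->
  amp P (fun x => a *: S x + T x) z = a *: amp P S z + amp P T z.
Proof.
move=> bS bT; symmetry.
apply: (ampliation_uniq (S := fun z => a *: amp P S z + amp P T z)).
- exact: bounded_lin.
- by apply: bounded_lin; exact: bounded_ampliation.
- by move=> x y /=; rewrite !ampliation_tensor// tensorPl.
Qed.

Lemma ampliation_id H K (P : tensor_product H K) z : amp P idfun z = z.
Proof.
symmetry; apply: (ampliation_uniq (S := idfun)) => //; exact: bounded_id.
Qed.

(** Convergence is clear on elementary tensors; it passes to all vectors because
    the norms of the A d, hence of their ampliations, are bounded uniformly. *)
Lemma ampliation_sot H K (P : tensor_product H K) (A : nat -> H -> H) (T : H -> H) z :
  (forall d, bounded_op (A d)) -> bounded_op T -> (forall x, tends (A ^~ x) (T x)) ->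
  tends (fun d => amp P (A d) z) (amp P T z).
Proof.
move=> bA bT AT.
have [|C0 hC0] := uniform_boundedness bA.
  by move=> x; exact: tends_bound (AT x).
pose C := Num.max C0 0.
have C1 : 0 <= C by rewrite le_max lexx orbT.
have hC d x : rnorm (A d x) <= C * rnorm x.
  by rewrite (le_trans (hC0 d x))// ler_wpM2r ?rnorm_ge0// le_max lexx.
have [_ [D D0 hD]] := (bounded_opP _).1 bT.
pose S := [set z | tends (fun d => amp P (A d) z) (amp P T z)].
apply: (total_closed (S := S) (tensor_total P)) => [|[x y]]; last first.
  rewrite /S /= ampliation_tensor//.
  apply: eq_tends (tends_op (bounded_tensorl P y) (AT x)).
  by exists 0%N => d _ /=; rewrite ampliation_tensor.
apply: closed_subspace_seq.
- rewrite /S /= op0; last exact: bounded_ampliation.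
  apply: eq_tends (tends_cst _); exists 0%N => d _.
  by rewrite op0//; exact: bounded_ampliation.
- move=> a x y hx hy; rewrite /S /= opP; last exact: bounded_ampliation.
  apply: eq_tends (tendsD (tendsZ a hx) hy); exists 0%N => d _.
  by rewrite opP//; exact: bounded_ampliation.
- move=> u l hu ul; rewrite /S /= => e e0.
  have e1 : 0 < e / 3 by rewrite divr_gt0.
  have e2 : 0 < e / 3 / (C + D + 1) by rewrite divr_gt0// ltr_wpDl// addr_ge0.
  have [N hN] := ul _ e2; have := hN _ (leqnn N); rewrite ltr_pdivlMr; last first.
    by rewrite ltr_wpDl// addr_ge0.
  move=> h1; have [N' hN'] := hu N _ e1; exists N' => d /hN' h2.
  have bAd := @bounded_ampliation _ _ P _ (bA d); have bT' := @bounded_ampliation _ _ P _ bT.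
  have -> : amp P (A d) l - amp P T l =
     (amp P (A d) (u N) - amp P T (u N)) -
     (amp P (A d) (u N - l) - amp P T (u N - l)).
    rewrite (opB _ _ bAd) (opB _ _ bT').
    by rewrite opprB addrA addrA subrK opprB [RHS]addrC addrA subrK.
  have h3 := @rnorm_ampliation _ _ P _ _ (u N - l) (bA d) C1 (hC d).
  have h4 := @rnorm_ampliation _ _ P _ _ (u N - l) bT D0 hD.
  rewrite (le_lt_trans (rnormD _ _))// rnormN.
  have := rnormD (amp P (A d) (u N - l)) (- amp P T (u N - l)).
  rewrite rnormN; have := rnorm_ge0 (u N - l); move: h1 h2 h3 h4.
  set a := rnorm _; set b := rnorm _; set c := rnorm _; set f := rnorm _.
  set g := rnorm _; lra.
Qed.

End Ampliation.

Arguments bounded_ampliation {R H K} P {T}.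

(** * Square-summable sequences of vectors *)

Section ScalarSeries.
Context {R : realType}.

Lemma nneg_series_cvg (a : nat -> R) (C : R) : (forall k, 0 <= a k) ->
  (forall d, \sum_(k < d) a k <= C) ->
  (fun d => \sum_(k < d) a k) @ \oo --> sup (range (fun d => \sum_(k < d) a k)).
Proof.
move=> a0 aC; apply: nondecreasing_cvgn.
  apply/nondecreasing_seqP => d; rewrite big_ord_recr/= lerDl; exact: a0.
by exists C => _ [d _ <-].
Qed.

Lemma tends_complex (u : nat -> R[i]) (a b : R) :
  (fun d => complex.Re (u d)) @ \oo --> a -> (fun d => complex.Im (u d)) @ \oo --> b ->
  tends u (a +i* b)%C.
Proof.
move=> /cvgrPdist_lt ua /cvgrPdist_lt ub e e0.
have e2 : 0 < e / 2 by rewrite divr_gt0.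
have [N _ hN] := ua _ e2; have [N' _ hN'] := ub _ e2.
exists (maxn N N') => d; rewrite geq_max => /andP[/hN h /hN' h'].
have -> : u d - (a +i* b)%C =
    ((complex.Re (u d) - a)%:C + 'i%C * (complex.Im (u d) - b)%:C)%C.
  by rewrite [u d]complexE; apply/eqP; rewrite eq_complex/=; apply/andP; split; apply/eqP; ring.
rewrite (le_lt_trans (rnormD _ _))// rnormM.
have rr (r : R) : rnorm (r%:C)%C = `|r|.
  by rewrite /rnorm normc_def /= expr0n addr0 sqrtr_sqr.
have -> : rnorm ('i%C : R[i]) = 1.
  by rewrite /rnorm normc_def /= expr0n add0r expr1n sqrtr1.
rewrite mul1r !rr (splitr e) ltrD//.
  by rewrite distrC; exact: h.
by rewrite distrC; exact: h'.
Qed.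

Lemma normr_Re_le (a : R[i]) : `|complex.Re a| <= rnorm a.
Proof.
rewrite -[leRHS]ger0_norm ?rnorm_ge0// -ler_sqr ?nnegrE ?normr_ge0// !real_normK ?num_real//.
case: a => a b; rewrite /rnorm normc_def/= sqr_sqrtr ?addr_ge0 ?sqr_ge0//.
by rewrite lerDl sqr_ge0.
Qed.

Lemma normr_Im_le (a : R[i]) : `|complex.Im a| <= rnorm a.
Proof.
rewrite -[leRHS]ger0_norm ?rnorm_ge0// -ler_sqr ?nnegrE ?normr_ge0// !real_normK ?num_real//.
case: a => a b; rewrite /rnorm normc_def/= sqr_sqrtr ?addr_ge0 ?sqr_ge0//.
by rewrite lerDr sqr_ge0.
Qed.

(** Such a series is the difference of two bounded series of nonnegative terms. *)
Lemma dominated_series_cvg (a b : nat -> R) (C : R) : (forall k, `|a k| <= b k) ->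
  (forall d, \sum_(k < d) b k <= C) -> exists l : R, (fun d => \sum_(k < d) a k) @ \oo --> l.
Proof.
move=> ab bC.
have b0 k : 0 <= b k by exact: le_trans (ab k).
have h1 := nneg_series_cvg b0 bC.
have h2 : (fun d => \sum_(k < d) (a k + b k)) @ \oo -->
    sup (range (fun d => \sum_(k < d) (a k + b k))).
  apply: (@nneg_series_cvg (fun k => a k + b k) (2 * C)) => [k|d].
    by have := ab k; rewrite ler_norml => /andP[h _]; rewrite -subr_ge0 opprK in h.
  rewrite big_split/= mulr_natl mulr2n lerD//; last exact: bC.
  by rewrite (le_trans _ (bC d))// ler_sum// => k _; exact: le_trans (ler_norm _) (ab k).
have E : (fun d => \sum_(k < d) a k) =
    (fun d => \sum_(k < d) (a k + b k) - \sum_(k < d) b k).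
  by apply/funext => d; rewrite big_split/= addrK.
rewrite E; eexists; exact: cvgB h2 h1.
Qed.

Lemma abs_summable (a : nat -> R[i]) (C : R) :
  (forall d, \sum_(k < d) rnorm (a k) <= C) -> exists l, tends (fun d => \sum_(k < d) a k) l.
Proof.
move=> aC.
have [x hx] := @dominated_series_cvg (fun k => complex.Re (a k)) _ C
   (fun k => normr_Re_le (a k)) aC.
have [y hy] := @dominated_series_cvg (fun k => complex.Im (a k)) _ C
   (fun k => normr_Im_le (a k)) aC.
exists (x +i* y)%C; apply: tends_complex.
  by under eq_fun do rewrite raddf_sum.
by under eq_fun do rewrite raddf_sum.
Qed.

Lemma ler_mul_sqrD (p q : R) : p * q <= p ^+ 2 + q ^+ 2.
Proof.
have := sqr_ge0 (p - q); have := sqr_ge0 (p + q).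
rewrite sqrrD sqrrB; lra.
Qed.

Lemma tends_Re (u : nat -> R[i]) l : tends u l -> forall e : R, 0 < e -> exists N,
  forall d, (N <= d)%N -> `|complex.Re (u d) - complex.Re l| < e.
Proof.
move=> ul e /ul[N h]; exists N => d /h; apply: le_lt_trans.
by rewrite -raddfB normr_Re_le.
Qed.

Lemma tends_sum (V : normedZmodType R[i]) I (r : seq I) (u : I -> nat -> V) l :
  (forall i, tends (u i) (l i)) ->
  tends (fun d => \sum_(i <- r) u i d) (\sum_(i <- r) l i).
Proof.
move=> ul; elim: r => [|i r IH].
  by rewrite big_nil; apply: eq_tends (tends_cst _); exists 0%N => d _; rewrite big_nil.
rewrite big_cons; apply: eq_tends (tendsD (ul i) IH).
by exists 0%N => d _; rewrite big_cons.
Qed.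

End ScalarSeries.

Section L2.
Context {R : realType} {G : hilbertType R}.

Definition l2_set : set (nat -> G) :=
  [set x : nat -> G | exists C : R, forall d, \sum_(k < d) rnorm (x k) ^+ 2 <= C].

Definition l2_pred : {pred (nat -> G)} := mem l2_set.

Lemma l2_predP x : x \in l2_pred <-> l2_set x.
Proof. by split=> [/set_mem|/mem_set]. Qed.

Lemma sqr_rnormD (x y : G) : rnorm (x + y) ^+ 2 <= 2 * rnorm x ^+ 2 + 2 * rnorm y ^+ 2.
Proof. by rewrite -parallelogram lerDl sqr_ge0. Qed.

Fact l2_submod : submod_closed l2_pred.
Proof.
split=> [|a x y /l2_predP[C hC] /l2_predP[D hD]]; apply/l2_predP.
  by exists 0 => d; rewrite big1// => k _; rewrite rnorm0 expr0n.
exists (2 * (rnorm a ^+ 2 * C) + 2 * D) => d.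
apply: (@le_trans _ _ (\sum_(k < d)
    (2 * (rnorm a ^+ 2 * rnorm (x k) ^+ 2) + 2 * rnorm (y k) ^+ 2))).
  by apply: ler_sum => k _; rewrite (le_trans (sqr_rnormD _ _))// rnormZ exprMn.
rewrite big_split/= -!mulr_sumr lerD//.
  by apply: ler_wpM2l => //; apply: ler_wpM2l (hC d); exact: sqr_ge0.
by apply: ler_wpM2l => //; exact: hD.
Qed.

HB.instance Definition _ :=
  GRing.isSubmodClosed.Build _ _ l2_pred l2_submod.

Record l2 : predArgType := L2 { l2_val :> nat -> G ; _ : l2_val \in l2_pred }.

HB.instance Definition _ := [isSub for @l2_val].
HB.instance Definition _ := [Choice of l2 by <:].
HB.instance Definition _ := [SubChoice_isSubLmodule of l2 by <:].

Lemma l2_bound (x : l2) : exists C : R, forall d, \sum_(k < d) rnorm (x k) ^+ 2 <= C.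
Proof. exact/l2_predP/(valP x). Qed.

Lemma l2B (x y : l2) k : (x - y) k = x k - y k. Proof. by []. Qed.
Lemma l2_inj (x y : l2) : (forall k, x k = y k) -> x = y.
Proof. by move=> h; apply/val_inj/funext. Qed.

Definition l2_inner (x y : l2) : R[i] :=
  xget 0 [set l | tends (fun d => \sum_(k < d) inner (x k) (y k)) l].

Lemma l2_inner_tends (x y : l2) :
  tends (fun d => \sum_(k < d) inner (x k) (y k)) (l2_inner x y).
Proof.
rewrite /l2_inner; case: xgetP => [//|h].
have [C hC] := l2_bound x; have [D hD] := l2_bound y.
have [d|l hl] := @abs_summable _ (fun k => inner (x k) (y k)) (C + D); last first.
  by exfalso; exact: (h l).
rewrite (le_trans _ (lerD (hC d) (hD d)))// -big_split/= ler_sum// => k _.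
rewrite (le_trans (cauchy_schwarz _ _))//.
exact: ler_mul_sqrD.
Qed.

Lemma l2_inner_eq (x y : l2) l :
  tends (fun d => \sum_(k < d) inner (x k) (y k)) l -> l2_inner x y = l.
Proof. exact: (tends_uniq (l2_inner_tends x y)). Qed.

Lemma l2_innerPl a x y z : l2_inner (a *: x + y) z = a * l2_inner x z + l2_inner y z.
Proof.
apply: l2_inner_eq.
apply: eq_tends (tendsD (tendsM a (l2_inner_tends x z)) (l2_inner_tends y z)).
exists 0%N => d _; rewrite mulr_sumr -big_split/=.
by apply: eq_bigr => k _; rewrite -innerPl.
Qed.

Lemma l2_innerC x y : l2_inner x y = (l2_inner y x)^*.
Proof.
apply: l2_inner_eq; apply: eq_tends (tends_conj (l2_inner_tends y x)).
by exists 0%N => d _; rewrite rmorph_sum; apply: eq_bigr => k _; rewrite [RHS]inner_conj.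
Qed.

Lemma l2_innerPr a x y z : l2_inner z (a *: x + y) = a^* * l2_inner z x + l2_inner z y.
Proof.
by rewrite l2_innerC l2_innerPl rmorphD rmorphM/= -!l2_innerC.
Qed.

Definition l2_sqnorm (x : l2) : R := complex.Re (l2_inner x x).

Lemma l2_innerxx x : l2_inner x x = (l2_sqnorm x)%:C%C.
Proof.
rewrite /l2_sqnorm RRe_real//; apply/CrealP; by rewrite -l2_innerC.
Qed.

Lemma l2_sqnorm_le (x : l2) (C : R) :
  (forall d, \sum_(k < d) rnorm (x k) ^+ 2 <= C) <-> l2_sqnorm x <= C.
Proof.
have E d : complex.Re (\sum_(k < d) inner (x k) (x k)) = \sum_(k < d) rnorm (x k) ^+ 2.
  by rewrite raddf_sum; apply: eq_bigr => k _; rewrite innerxx.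
have t := tends_Re (l2_inner_tends x x).
split=> [h|h d].
  apply: ler_eps => e /t[N /(_ _ (leqnn N))]; rewrite E.
  have := h N; rewrite -/(l2_sqnorm x) ltr_norml => h1 /andP[h2 h3]; lra.
rewrite (le_trans _ h)//; apply: ler_eps => e /t[N /(_ _ (leq_maxl N d))].
rewrite E -/(l2_sqnorm x) ltr_norml => /andP[h2 h3].
have : \sum_(k < d) rnorm (x k) ^+ 2 <= \sum_(k < maxn N d) rnorm (x k) ^+ 2.
  rewrite -(big_mkord xpredT (fun k => rnorm (x k) ^+ 2)).
  rewrite -(big_mkord xpredT (fun k => rnorm (x k) ^+ 2)).
  rewrite (@big_cat_nat _ _ _ d 0 (maxn N d))//= ?leq_maxr//.
  by rewrite lerDl sumr_ge0// => k _; exact: sqr_ge0.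
lra.
Qed.

Lemma l2_sqnorm_ge0 x : 0 <= l2_sqnorm x.
Proof.
by have /l2_sqnorm_le/(_ 0%N) := lexx (l2_sqnorm x); rewrite big_ord0.
Qed.

Lemma rnorm_l2_le (x : l2) k : rnorm (x k) ^+ 2 <= l2_sqnorm x.
Proof.
have /l2_sqnorm_le/(_ k.+1) := lexx (l2_sqnorm x); apply: le_trans.
by rewrite big_ord_recr/= lerDr sumr_ge0// => *; exact: sqr_ge0.
Qed.

Lemma l2_sqnorm_eq0 x : l2_sqnorm x = 0 -> x = 0.
Proof.
move=> x0; apply: l2_inj => k; apply: rnorm0_eq0; apply/eqP.
by rewrite -sqrf_eq0 eq_le sqr_ge0 andbT -x0 rnorm_l2_le.
Qed.

Fact l2_innerBl (y : l2) : zmod_morphism (l2_inner ^~ y).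
Proof. by move=> x z; rewrite addrC -scaleN1r l2_innerPl mulN1r addrC. Qed.

Fact l2_innerBr (y : l2) : zmod_morphism (l2_inner y).
Proof. by move=> x z; rewrite addrC -scaleN1r l2_innerPr rmorphN1 mulN1r addrC. Qed.

Lemma l2_inner0l y : l2_inner 0 y = 0.
Proof. by rewrite -(subrr 0) l2_innerBl subrr. Qed.

Lemma l2_inner0r y : l2_inner y 0 = 0.
Proof. by rewrite l2_innerC l2_inner0l rmorph0. Qed.

Fact l2_innerZl (y : l2) : scalable_for *%R (l2_inner ^~ y).
Proof. by move=> a x; rewrite -[a *: x]addr0 l2_innerPl l2_inner0l addr0. Qed.

Fact l2_innerZr (y : l2) : scalable_for (@Num.conj R[i] \; *%R) (l2_inner y).
Proof. by move=> a x; rewrite -[a *: x]addr0 l2_innerPr l2_inner0r addr0. Qed.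

HB.instance Definition _ := isBilinear.Build _ _ _ _ _ _ l2_inner
  l2_innerBl l2_innerBr l2_innerZl l2_innerZr.

Fact l2_inner_herm (x y : l2) :
  l2_inner x y = (-1) ^+ false * Num.conj (l2_inner y x).
Proof. by rewrite expr0 mul1r l2_innerC. Qed.

HB.instance Definition _ := isHermitianSesquilinear.Build _ _ _ _ l2_inner l2_inner_herm.

Fact l2_inner_gt0 (x : l2) : x != 0 -> 0 < l2_inner x x.
Proof.
move=> x0; rewrite l2_innerxx ltcR lt_neqAle l2_sqnorm_ge0 eq_sym andbT.
by apply: contraNneq x0 => /l2_sqnorm_eq0 ->.
Qed.

HB.instance Definition _ := isDotProduct.Build _ _ l2_inner l2_inner_gt0.

Definition l2_norm (x : l2) : R[i] := (Num.sqrt (l2_sqnorm x))%:C%C.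

Lemma l2_sqnorm_lin (s t : R) x y :
  l2_sqnorm (s%:C%C *: x + t%:C%C *: y) =
  s ^+ 2 * l2_sqnorm x + t ^+ 2 * l2_sqnorm y + 2 * (s * t * complex.Re (l2_inner x y)).
Proof.
have cr (r : R) : ((r%:C)%C)^* = (r%:C)%C :> R[i].
  by apply/CrealP; rewrite realE !lecR; exact: num_real.
apply: (@complexI R); rewrite -l2_innerxx l2_innerPl !l2_innerPr.
have Z a b c : l2_inner b (a *: c) = a^* * l2_inner b c by exact: l2_innerZr.
have Zl a b c : l2_inner (a *: b) c = a * l2_inner b c by exact: l2_innerZl.
rewrite !Zl !Z !cr !l2_innerxx (l2_innerC y x); case: (l2_inner x y) => a b.
by apply/eqP; rewrite eq_complex/=; apply/andP; split; apply/eqP; ring.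
Qed.

Lemma l2_sqnormD x y :
  l2_sqnorm (x + y) = l2_sqnorm x + l2_sqnorm y + 2 * complex.Re (l2_inner x y).
Proof.
by have := l2_sqnorm_lin 1 1 x y; rewrite !scale1r expr1n !mul1r.
Qed.

Lemma l2_cauchy_schwarz x y :
  complex.Re (l2_inner x y) <= Num.sqrt (l2_sqnorm x) * Num.sqrt (l2_sqnorm y).
Proof.
set a := Num.sqrt (l2_sqnorm x); set b := Num.sqrt (l2_sqnorm y).
have a2 : a ^+ 2 = l2_sqnorm x by rewrite sqr_sqrtr// l2_sqnorm_ge0.
have b2 : b ^+ 2 = l2_sqnorm y by rewrite sqr_sqrtr// l2_sqnorm_ge0.
have a0 : 0 <= a by exact: sqrtr_ge0.
have b0 : 0 <= b by exact: sqrtr_ge0.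
clearbody a b.
have [az|az] := eqVneq a 0.
  have -> : x = 0 by apply: l2_sqnorm_eq0; rewrite -a2 az expr0n.
  by rewrite l2_inner0l az mul0r.
have [bz|bz] := eqVneq b 0.
  have -> : y = 0 by apply: l2_sqnorm_eq0; rewrite -b2 bz expr0n.
  by rewrite l2_inner0r bz mulr0.
have ab : 0 < a * b by rewrite lt_neqAle mulr_ge0// andbT eq_sym mulf_neq0.
have := l2_sqnorm_ge0 (b%:C%C *: x + (- a)%:C%C *: y).
rewrite l2_sqnorm_lin -a2 -b2; set c := complex.Re _ => h.
rewrite -subr_ge0 -(pmulr_rge0 _ ab); move: h.
have -> : b ^+ 2 * a ^+ 2 + (- a) ^+ 2 * b ^+ 2 + 2 * (b * - a * c) =
  2 * (a * b * (a * b - c)) by ring.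
lra.
Qed.

Fact l2_normD (x y : l2) : l2_norm (x + y) <= l2_norm x + l2_norm y.
Proof.
rewrite /l2_norm -rmorphD/= lecR -ler_sqr ?nnegrE ?addr_ge0 ?sqrtr_ge0//.
have h1 := sqr_sqrtr (l2_sqnorm_ge0 x); have h2 := sqr_sqrtr (l2_sqnorm_ge0 y).
have h3 := l2_cauchy_schwarz x y.
rewrite sqr_sqrtr ?l2_sqnorm_ge0// l2_sqnormD sqrrD h1 h2.
by rewrite addrAC lerD2r lerD2l -[(_ * _) *+ 2]mulr_natl ler_wpM2l.
Qed.

Fact l2_normZ (l : R[i]) (x : l2) : l2_norm (l *: x) = `|l| * l2_norm x.
Proof.
rewrite /l2_norm; have -> : l2_sqnorm (l *: x) = rnorm l ^+ 2 * l2_sqnorm x.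
  apply: (@complexI R); rewrite -l2_innerxx.
  have -> : l2_inner (l *: x) (l *: x) = l * (l^* * l2_inner x x).
    by rewrite l2_innerZl; congr (_ * _); exact: l2_innerZr.
  by rewrite mulrA -normCK l2_innerxx normE rmorphM rmorphXn.
rewrite sqrtrM ?sqr_ge0// sqrtr_sqr ger0_norm ?rnorm_ge0//.
by rewrite [LHS]rmorphM/= -normE.
Qed.

Fact l2_norm_eq0 (x : l2) : l2_norm x = 0 -> x = 0.
Proof.
move=> /(@complexI R)/eqP; rewrite sqrtr_eq0 => h.
by apply: l2_sqnorm_eq0; apply/le_anti; rewrite h l2_sqnorm_ge0.
Qed.

HB.instance Definition _ := Lmodule_isNormed.Build R[i] l2
  l2_normD l2_normZ l2_norm_eq0.

Lemma rnorm_l2 (x : l2) : rnorm x = Num.sqrt (l2_sqnorm x).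
Proof. by []. Qed.

Lemma rnorm_l2_coord (x : l2) k : rnorm (x k) <= rnorm x.
Proof.
rewrite ler_sqr_nneg ?rnorm_ge0// rnorm_l2 sqr_sqrtr ?l2_sqnorm_ge0//.
exact: rnorm_l2_le.
Qed.

(** Coordinates converge, and the Cauchy estimate passes to the limit on every
    finite section. *)
Lemma l2_cauchy (u : nat -> l2) :
  (forall e : R, 0 < e -> exists N, forall m n, (N <= m)%N -> (N <= n)%N ->
     rnorm (u m - u n) < e) -> exists l, tends u l.
Proof.
move=> cu.
have hk k : exists l, tends (fun n => u n k) l.
  apply: cauchy_tends => e /cu[N hN]; exists N => m n Nm Nn.
  by rewrite -l2B (le_lt_trans (rnorm_l2_coord _ _))// hN.
have [l hl] := choice hk.
have key e : 0 < e -> exists N, forall n, (N <= n)%N -> forall d,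
    \sum_(k < d) rnorm (u n k - l k) ^+ 2 <= e ^+ 2.
  move=> e0; have [N hN] := cu e e0; exists N => n Nn d.
  have t : tends (fun m => \sum_(k < d) inner (u n k - u m k) (u n k - l k))
      (\sum_(k < d) inner (u n k - l k) (u n k - l k)).
    apply: (@tends_sum _ _ _ _ (fun (k : 'I_d) m => inner (u n k - u m k) (u n k - l k))).
    move=> k; apply: tends_innerl; apply: tendsB; [exact: tends_cst|exact: hl].
  have E : \sum_(k < d) rnorm (u n k - l k) ^+ 2 =
      complex.Re (\sum_(k < d) inner (u n k - l k) (u n k - l k)).
    by rewrite raddf_sum; apply: eq_bigr => k _; rewrite innerxx.
  set S := \sum_(k < d) rnorm (u n k - l k) ^+ 2 in E *.
  apply: ler_eps => eps eps0.
  have [M hM] := tends_Re t (divr_gt0 eps0 (ltr0n R 2)).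
  have {hM} := hM _ (leq_maxr N M); rewrite -E.
  set m := maxn N M; have Nm : (N <= m)%N by rewrite leq_maxl.
  have S1 : \sum_(k < d) rnorm (u n k - u m k) ^+ 2 <= e ^+ 2.
    have /ltW h := hN _ _ Nn Nm.
    have : l2_sqnorm (u n - u m) <= e ^+ 2.
      have := sqr_sqrtr (l2_sqnorm_ge0 (u n - u m)); rewrite -rnorm_l2 => <-.
      by rewrite -ler_sqr_nneg ?rnorm_ge0// ltW.
    by move=> /l2_sqnorm_le/(_ d).
  have S2 : 2 * complex.Re (\sum_(k < d) inner (u n k - u m k) (u n k - l k)) <=
      \sum_(k < d) rnorm (u n k - u m k) ^+ 2 + S.
    rewrite raddf_sum mulr_sumr -big_split/= ler_sum// => k _.
    have := sqr_ge0 (rnorm ((u n k - u m k) - (u n k - l k))).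
    by rewrite (rnormB2 (u n k - u m k) (u n k - l k)) /rdot subr_ge0.
  rewrite ltr_norml => /andP[h1 h2]; lra.
have [N0 hN0] := key 1 ltr01.
have lP : l \in l2_pred.
  have w : (u N0 : nat -> G) - l \in l2_pred.
    apply/l2_predP; exists (1 ^+ 2) => d; exact: (hN0 N0 (leqnn _) d).
  have -> : l = (-1) *: ((u N0 : nat -> G) - l) + u N0.
    by rewrite scaleN1r opprB subrK.
  by apply: l2_submod.2 => //; exact: valP.
exists (L2 lP) => e e0.
have [N hN] := key (e / 2) (divr_gt0 e0 (ltr0n R 2)).
exists N => d /hN h; rewrite (@le_lt_trans _ _ (e / 2))//; last first.
  by rewrite ltr_pdivrMr// ltr_pMr// ltr1n.
rewrite ler_sqr_nneg ?rnorm_ge0//; last by rewrite divr_ge0// ltW.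
rewrite rnorm_l2 sqr_sqrtr ?l2_sqnorm_ge0//.
by apply/l2_sqnorm_le => n; exact: h.
Qed.

Fact l2_complete (F : set_system l2) : ProperFilter F -> cauchy F -> cvg F.
Proof.
move=> FF /cauchy_ballP cF.
have cF' (n : nat) : exists A, F A /\ forall x y, A x -> A y -> rnorm (x - y) < n.+1%:R^-1.
  have [|[A B] /= [FA FB] AB] := cF (n.+1%:R^-1%:C)%C; first by rewrite /= ltcR invr_gt0.
  exists (A `&` B); split; first exact: filterI.
  move=> x y [Ax _] [_ By]; have := AB (x, y) (conj Ax By).
  by rewrite -ball_normE/= normE ltcR.
have [A hA] := choice cF'.
have FB n : F (\bigcap_(k in [set k | (k <= n)%N]) A k).
  elim: n => [|n IH].
    by apply: filterS (hA 0%N).1 => x Ax k /=; rewrite leqn0 => /eqP ->.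
  apply: filterS (filterI IH (hA n.+1).1) => x [Bx Ax] k /=.
  by rewrite leq_eqVlt => /orP[/eqP ->//|kn]; exact: Bx.
have hu n : exists x, forall k, (k <= n)%N -> A k x.
  by have [x Bx] := filter_ex (FB n); exists x => k; exact: Bx.
have [u uA] := choice hu.
have [e e0|l ul] := @l2_cauchy u.
  have [N hN] := ler_tends0 e0; exists N => m n Nm Nn.
  apply: lt_trans (hN N (leqnn N)); apply: (hA N).2; exact: uA.
apply/cvg_ex; exists l; apply/cvgrPdist_lt => e e0.
have e0' : 0 < complex.Re e by move: e0; rewrite ltcE => /andP[].
have ee : e = (complex.Re e)%:C%C by rewrite RRe_real// gtr0_real.
have e2 : 0 < complex.Re e / 2 by rewrite divr_gt0.
have [N hN] := ler_tends0 e2; have [N' hN'] := ul _ e2.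
rewrite nearE; apply: filterS (hA N).1 => x Ax.
rewrite /= normE ee ltcR.
have := hN' _ (leq_maxr N N'); have /(hA N).2/(_ Ax) := uA _ _ (leq_maxl N N').
have := hN N (leqnn N); set m := maxn _ _.
have := rnormD (l - u m) (u m - x); rewrite addrA subrK (rnormB l (u m)).
move: (rnorm (l - x)) (rnorm (u m - l)) (rnorm (u m - x)) (_^-1) (complex.Re e).
by move=> r1 r2 r3 r4 r5; lra.
Qed.

HB.instance Definition _ := Uniform_isComplete.Build l2 l2_complete.

Fact l2_inner_norm (x : l2) : l2_inner x x = `|x| ^+ 2.
Proof. by rewrite l2_innerxx normE -rmorphXn/= sqr_sqrtr ?l2_sqnorm_ge0. Qed.

HB.instance Definition _ := isHilbert.Build R l2 l2_inner_norm.

End L2.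

Arguments l2 {R} G.

(** * Existence of Hilbert space tensor products *)

Section FrameTensor.
Context {R : realType} {A G : hilbertType R}.
Variable p : nat -> A.
Hypothesis parseval : forall x y,
  tends (fun d => \sum_(k < d) inner x (p k) * inner (p k) y) (inner x y).

Definition tensor_seq (x : A) (g : G) : nat -> G := fun k => inner x (p k) *: g.

Fact tensor_seq_l2 x g : tensor_seq x g \in l2_pred.
Proof.
apply/l2_predP; have [C hC] := tends_bound (parseval x x).
exists (C * rnorm g ^+ 2) => d; rewrite /tensor_seq.
under eq_bigr do rewrite rnormZ exprMn.
rewrite -mulr_suml ler_wpM2r ?sqr_ge0//; apply: le_trans (hC d).
have -> : \sum_(k < d) inner x (p k) * inner (p k) x =
    ((\sum_(k < d) rnorm (inner x (p k)) ^+ 2)%:C)%C.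
  rewrite rmorph_sum; apply: eq_bigr => k _.
  by rewrite (inner_conj (p k)) -normCK normE rmorphXn.
by rewrite rnorm_real// sumr_ge0// => k _; exact: sqr_ge0.
Qed.

(** Sending x (x) g to the sequence of coefficients of x times g identifies the
    tensor product with a closed subspace of the square-summable sequences;
    the Parseval identity says that inner products are preserved. *)
Definition tensor_l2 x g : l2 G := L2 (tensor_seq_l2 x g).

Lemma inner_tensor_l2 x g x' g' :
  inner (tensor_l2 x g) (tensor_l2 x' g') = inner x x' * inner g g'.
Proof.
apply: l2_inner_eq; rewrite mulrC.
apply: eq_tends (tendsM (inner g g') (parseval x x')); exists 0%N => d _.
rewrite mulr_sumr; apply: eq_bigr => k _.
rewrite /= /tensor_seq innerZl innerZr (inner_conj (p k)); ring.
Qed.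

Definition elementary_l2 : set (l2 G) := range (fun u : A * G => tensor_l2 u.1 u.2).

(** The double orthogonal complement, that is, the closed linear span. *)
Definition frame_space := ocomp (orthocomp elementary_l2).

Fact tensor_l2_mem x g : tensor_l2 x g \in orthocomp_pred (orthocomp elementary_l2).
Proof. by apply/orthocomp_predP => y /(_ _ (imageT _ (x, g)))/inner_sym0. Qed.

Definition frame_tensor (x : A) (g : G) : frame_space := Ocomp (tensor_l2_mem x g).

Fact frame_tensorPl g : linear_for *:%R (frame_tensor ^~ g).
Proof.
move=> a x y; apply/val_inj/l2_inj => k /=.
by rewrite /tensor_seq innerPl scalerDl -scalerA.
Qed.

Fact frame_tensorPr x : linear_for *:%R (frame_tensor x).
Proof.
move=> a g h; apply/val_inj/l2_inj => k /=.
by rewrite /tensor_seq scalerDr scalerA mulrC -scalerA.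
Qed.

HB.instance Definition _ := bilinear_isBilinear.Build _ _ _ _ _ _ frame_tensor
  (frame_tensorPl, frame_tensorPr).

Fact inner_frame_tensor x x' y y' :
  inner (frame_tensor x y) (frame_tensor x' y') = inner x x' * inner y y'.
Proof. exact: inner_tensor_l2. Qed.

Lemma frame_tensor_total : total_fam (fun u : A * G => frame_tensor u.1 u.2).
Proof.
move=> z hz; apply: rnorm0_eq0; apply/eqP; rewrite -sqrf_eq0; apply/eqP.
apply: (@complexI R); rewrite -innerxx.
have /orthocomp_predP := valP z; apply => _ [u _ <-]; exact: (hz u).
Qed.

Fact frame_tensor_dense : dense [set z | exists m (x : 'I_m -> A) (y : 'I_m -> G),
    z = \sum_(i < m) frame_tensor (x i) (y i)].
Proof.
apply/denseP => z e e0.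
have [l hl] := total_dense z frame_tensor_total e0.
eexists; last exact: hl.
exists (size l), (fun i => (nth (0, (0, 0)) l i).1 *: (nth (0, (0, 0)) l i).2.1),
  (fun i => (nth (0, (0, 0)) l i).2.2).
rewrite /lincomb (big_nth (0, (0, 0))) big_mkord; apply: eq_bigr => i _.
by rewrite linearZl_LR.
Qed.

Definition frame_tensor_product : tensor_product A G :=
  TensorProduct inner_frame_tensor frame_tensor_dense.

End FrameTensor.

Section Bases.
Context {R : realType} {H : hilbertType R}.
Variable p : nat -> H.
Hypothesis p_orth : forall j k, j != k -> inner (p j) (p k) = 0.
Hypothesis p_norm : forall k, inner (p k) (p k) = 1 \/ p k = 0.
Hypothesis p_total : total_fam p.

Definition partial_sum d x := \sum_(k < d) inner x (p k) *: p k.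

Lemma partial_sum_orth d x k : (k < d)%N -> inner (x - partial_sum d x) (p k) = 0.
Proof.
move=> kd; rewrite innerBl inner_suml (bigD1 (Ordinal kd))//=.
rewrite innerZl big1 => [|j jk]; last by rewrite innerZl p_orth// mulr0.
by rewrite addr0; case: (p_norm k) => ->; rewrite ?inner0r ?mulr1 ?mulr0 subrr.
Qed.

Lemma bessel d x : rnorm (partial_sum d x) <= rnorm x.
Proof.
rewrite ler_sqr_nneg ?rnorm_ge0// -[in leRHS](subrK (partial_sum d x) x).
rewrite pythagoras ?lerDr ?sqr_ge0// inner_sumr big1// => k _.
by rewrite innerZr partial_sum_orth// mulr0.
Qed.

Lemma bounded_partial_sum d : bounded_op (partial_sum d).
Proof.
apply/bounded_opP; split.
  move=> a x y; rewrite /partial_sum scaler_sumr -big_split/=.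
  by apply: eq_bigr => k _; rewrite innerPl scalerDl scalerA.
by exists 1 => // x; rewrite mul1r bessel.
Qed.

(** The set of vectors for which this holds is closed because the partial sums are
    contractions, and it contains the total family p. *)
Lemma partial_sum_tends x : tends (fun d => partial_sum d x) x.
Proof.
apply: (total_closed (S := [set x | tends (fun d => partial_sum d x) x]) p_total).
  apply: closed_subspace_seq.
  - apply: eq_tends (tends_cst _); exists 0%N => d _.
    by rewrite (op0 (bounded_partial_sum d)).
  - move=> a u v hu hv; apply: eq_tends (tendsD (tendsZ a hu) hv).
    by exists 0%N => d _; rewrite (opP _ _ _ (bounded_partial_sum d)).
  move=> u l hu ul e e0.
  have e3 : 0 < e / 3 by rewrite divr_gt0.
  have [N /(_ _ (leqnn N)) h1] := ul _ e3; have [N' hN'] := hu N _ e3.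
  exists N' => d /hN' h2.
  have -> : partial_sum d l - l = (partial_sum d (u N) - u N) +
      ((u N - l) - partial_sum d (u N - l)).
    rewrite (opB _ _ (bounded_partial_sum d)) opprB [RHS]addrA [in RHS](addrA (_ - _)) subrK.
    by rewrite [RHS]addrC addrA subrK.
  rewrite (le_lt_trans (rnormD _ _))//.
  have := rnormD (u N - l) (- partial_sum d (u N - l)); rewrite rnormN.
  have := bessel d (u N - l); move: h1 h2.
  move: (rnorm (u N - l)) (rnorm (partial_sum d (u N - l)))
    (rnorm (partial_sum d (u N) - u N)) (rnorm (_ + _)) => a b c f.
  lra.
move=> j e e0; exists j.+1 => d jd.
have : inner (p j - partial_sum d (p j)) (p j) = 0 by exact: partial_sum_orth.
rewrite /partial_sum (bigD1 (Ordinal jd))//= big1 => [|k kj]; last first.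
  by rewrite p_orth ?scale0r// eq_sym.
by case: (p_norm j) => ->; rewrite ?scale1r ?scaler0 addr0 subrr rnorm0.
Qed.

Lemma parseval_basis x y :
  tends (fun d => \sum_(k < d) inner x (p k) * inner (p k) y) (inner x y).
Proof.
apply: eq_tends (tends_innerl y (partial_sum_tends x)).
by exists 0%N => d _; rewrite inner_suml; apply: eq_bigr => k _; rewrite innerZl.
Qed.

End Bases.

Section CountableBasis.
Context {R : realType} {H : hilbertType R} {I : countType}.
Variable e : I -> H.
Hypothesis e_orth : forall i j, inner (e i) (e j) = (i == j)%:R.
Hypothesis e_total : total_fam e.

(** The basis listed along the coding of I by natural numbers; a number that codes
    no index contributes 0, which changes no sum. *)
Definition basis_seq (k : nat) : H := oapp e 0 (pickle_inv k).

Lemma basis_seq_orth j k : j != k -> inner (basis_seq j) (basis_seq k) = 0.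
Proof.
rewrite /basis_seq => jk.
case Ej: (@pickle_inv I j) => [u|]; last by rewrite /= inner0l.
case Ek: (@pickle_inv I k) => [v|]; last by rewrite /= inner0r.
rewrite /= e_orth; case: eqP => // uv; exfalso; move/eqP: jk; apply.
have := @pickle_invK I j; have := @pickle_invK I k; rewrite Ej Ek /= uv.
by move=> <- <-.
Qed.

Lemma basis_seq_norm k : inner (basis_seq k) (basis_seq k) = 1 \/ basis_seq k = 0.
Proof.
by rewrite /basis_seq; case: (@pickle_inv I k) => [u|]; [left; rewrite e_orth eqxx|right].
Qed.

Lemma basis_seq_total : total_fam basis_seq.
Proof.
by move=> x hx; apply: e_total => i; have := hx (pickle i); rewrite /basis_seq pickleK_inv.
Qed.

Lemma parseval_countable x y :
  tends (fun d => \sum_(k < d) inner x (basis_seq k) * inner (basis_seq k) y) (inner x y).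
Proof.
apply: parseval_basis; [exact: basis_seq_orth|exact: basis_seq_norm|exact: basis_seq_total].
Qed.

Lemma tensor_product_ex (G : hilbertType R) : inhabited (tensor_product H G).
Proof. exact: (inhabits (frame_tensor_product parseval_countable)). Qed.

(** The projection of an orthonormal basis to a closed subspace need not be a basis,
    but it satisfies the Parseval identity there. *)
Lemma tensor_product_ocomp_ex (D : set H) (G : hilbertType R) :
  inhabited (tensor_product (ocomp D) G).
Proof.
have h (x y : ocomp D) : tends (fun d => \sum_(k < d)
    inner x (oproj D (basis_seq k)) * inner (oproj D (basis_seq k)) y) (inner x y).
  apply: eq_tends (parseval_countable (\val x) (\val y)); exists 0%N => d _.
  apply: eq_bigr => k _.
  by rewrite inner_oproj (inner_conj x) inner_oproj -inner_conj.
by constructor; exact: (@frame_tensor_product R (ocomp D) G (fun k => oproj D (basis_seq k)) h).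
Qed.

End CountableBasis.

(** * Sequential strong closure of an algebra of operators *)

Section SotAlgebra.
Context {R : realType} {n : nat} {H : hilbertType R}.
Variable M : 'I_n -> H -> H.

(** Limits are taken along sequences: a pointwise convergent sequence of operators
    is uniformly bounded, so that its ampliations converge too. *)
Inductive sot_alg : (H -> H) -> Prop :=
| sot_id : sot_alg idfun
| sot_gen i : sot_alg (M i)
| sot_comp S T : sot_alg S -> sot_alg T -> sot_alg (S \o T)
| sot_lin a S T : sot_alg S -> sot_alg T -> sot_alg (fun x => a *: S x + T x)
| sot_lim A T : (forall d : nat, sot_alg (A d)) -> bounded_op T ->
    (forall x, tends (A ^~ x) (T x)) -> sot_alg T.

Hypothesis bM : forall i, bounded_op (M i).

Lemma sot_alg_bounded A : sot_alg A -> bounded_op A.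
Proof.
elim=> [|i|S T _ bS _ bT|a S T _ bS _ bT|B T _ _ bT _] //.
- exact: bounded_id.
- exact: bounded_comp.
- exact: bounded_lin.
Qed.

Lemma sot_alg_invariant (K : hilbertType R) (P : tensor_product H K) (S : set P) A :
  closed_subspace S -> (forall i x, S x -> S (ampliation (M i) x)) -> sot_alg A ->
  forall x, S x -> S (ampliation A x).
Proof.
move=> cS SM; elim=> [|i|B T sB hB sT hT|a B T sB hB sT hT|B T sB hB bT BT] x Sx.
- by rewrite ampliation_id.
- exact: SM.
- rewrite ampliation_comp; [exact/hB/hT| |]; exact: sot_alg_bounded.
- rewrite ampliation_lin; [|exact: sot_alg_bounded..].
  by apply: csubP => //; [exact: hB|exact: hT].
- apply: (csub_tends cS (fun d => hB d x Sx)).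
  by apply: ampliation_sot => // d; exact: sot_alg_bounded.
Qed.

Lemma sot_0 : sot_alg (fun=> 0).
Proof.
have := sot_lin (-1) sot_id sot_id; congr sot_alg.
by apply/funext => x; rewrite scaleN1r addNr.
Qed.

Lemma sot_scale a A : sot_alg A -> sot_alg (fun x => a *: A x).
Proof.
move=> sA; have := sot_lin a sA sot_0; congr sot_alg.
by apply/funext => x; rewrite addr0.
Qed.

Lemma sot_sum I (r : seq I) (P : pred I) (A : I -> H -> H) :
  (forall i, sot_alg (A i)) -> sot_alg (fun x => \sum_(i <- r | P i) A i x).
Proof.
move=> sA; elim: r => [|i r IH].
  have := sot_0; congr sot_alg.
  by apply/funext => x; rewrite big_nil.
have := sot_lin (P i)%:R (sA i) IH; congr sot_alg; apply/funext => x.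
rewrite big_cons; case: (P i); first by rewrite scale1r.
by rewrite scale0r add0r.
Qed.

Lemma sot_opword (Y : 'I_n -> H -> H) w : (forall i, sot_alg (Y i)) ->
  sot_alg (opword Y w).
Proof.
by move=> sY; elim: w => [|i w IH] /=; [exact: sot_id|exact: sot_comp].
Qed.

Lemma sot_optrunc a (Y : 'I_n -> H -> H) d : (forall i, sot_alg (Y i)) ->
  sot_alg (optrunc a Y d).
Proof.
move=> sY; rewrite /optrunc /wsum; apply: sot_sum => k; apply: sot_sum => w.
by apply: sot_scale; exact: sot_opword.
Qed.

End SotAlgebra.

Section OpWords.
Context {R : realType} {n : nat} {H : hilbertType R}.
Implicit Types Y : 'I_n -> H -> H.

Lemma bounded_opword Y w : (forall i, bounded_op (Y i)) -> bounded_op (opword Y w).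
Proof.
by move=> bY; elim: w => [|i w IH] /=; [exact: bounded_id|exact: bounded_comp].
Qed.

Lemma bounded_optrunc a Y d : (forall i, bounded_op (Y i)) -> bounded_op (optrunc a Y d).
Proof.
move=> bY; rewrite /optrunc /wsum; apply: bounded_sum => k; apply: bounded_sum => w.
have := bounded_lin (a w) (bounded_opword w bY) (bounded_0 H H).
by congr bounded_op; apply/funext => x; rewrite addr0.
Qed.

End OpWords.

(** * Right-invariant operators *)

Lemma cat_suffix_inj (T : eqType) (g : seq T) : injective (cat^~ g).
Proof.
move=> v w /= vw; have vwE : size v = size w.
  by apply: (@addIn (size g)); rewrite -!size_cat vw.
by apply/eqP; move/eqP: vw; rewrite eqseq_cat// => /andP[].
Qed.

Section RightShift.
Context {R : realType} {n : nat} {H : hilbertType R}.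
Variable e : word n -> H.
Hypothesis e_orth : forall v w, inner (e v) (e w) = (v == w)%:R.
Hypothesis e_total : total_fam e.

(** In H^2(f) this is right multiplication by f_g. *)
Definition right_shift (g : word n) (S : H -> H) :=
  bounded_op S /\ forall w, S (e w) = e (w ++ g).

Lemma right_shift_ex g : exists S, right_shift g S.
Proof.
have [v w|S [bS hS _]] := @extend_isometry _ _ _ _ e (fun w => e (w ++ g)) e_total.
  by rewrite !e_orth (inj_eq (@cat_suffix_inj _ g)).
by exists S.
Qed.

(** Such operators play the role of analytic Toeplitz operators: left multiplications
    commute with right multiplications. *)
Definition right_invariant (A : H -> H) :=
  forall g S, right_shift g S -> forall x, A (S x) = S (A x).

Lemma right_invariant_basis A : bounded_op A ->
  (forall g S w, right_shift g S -> A (e (w ++ g)) = S (A (e w))) -> right_invariant A.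
Proof.
move=> bA h g S hS x; have [bS Se] := hS.
rewrite -[LHS]/((A \o S) x) -[RHS]/((S \o A) x).
apply: (eq_on_total e_total); [exact: bounded_comp|exact: bounded_comp|].
by move=> w /=; rewrite Se; exact: h.
Qed.

Lemma right_invariant_id : right_invariant idfun. Proof. by []. Qed.

Lemma right_invariant_comp A B : right_invariant A -> right_invariant B ->
  right_invariant (A \o B).
Proof. by move=> hA hB g S hS x /=; rewrite (hB _ _ hS) (hA _ _ hS). Qed.

Lemma right_invariant_opword (Y : 'I_n -> H -> H) w :
  (forall i, right_invariant (Y i)) -> right_invariant (opword Y w).
Proof. by move=> hY; elim: w => [//|i w IH] /=; exact: right_invariant_comp. Qed.

Lemma right_invariant_optrunc a (Y : 'I_n -> H -> H) d :
  (forall i, right_invariant (Y i)) -> right_invariant (optrunc a Y d).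
Proof.
move=> hY g S hS x; have [bS _] := hS; rewrite /optrunc /wsum (op_sum _ _ _ bS).
apply: eq_bigr => k _; rewrite (op_sum _ _ _ bS); apply: eq_bigr => w _.
by rewrite (opZ _ _ bS) (right_invariant_opword w hY hS).
Qed.

(** Commuting with S is a condition on the matrix coefficients at (S x, y) and at
    (x, S^* y), two at a time, so it survives weak limits. *)
Lemma right_invariant_wot (D : set (H -> H)) A :
  (forall B, D B -> right_invariant B) -> wot_closure D A -> right_invariant A.
Proof.
move=> hD [bA hA] g S hS x; have [bS _] := hS; apply: inner_inj => y.
apply/eqP; rewrite -subr_eq0; apply/eqP/rnorm_le0/ler_eps => eps eps0.
pose X (i : 'I_2) := if i == ord0 then S x else x.
pose Y (i : 'I_2) := if i == ord0 then y else adj S y.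
have [B DB hB] := hA 2%N X Y _ (divr_gt0 eps0 (ltr0n R 2)).
have := hB ord0; have := hB ord_max; rewrite /X /Y /= !innerBl.
rewrite (hD _ DB _ _ hS) -!adjE// => h1 h2.
have -> : inner (A (S x)) y - inner (S (A x)) y =
   (inner (A (S x)) y - inner (S (B x)) y) - (inner (S (A x)) y - inner (S (B x)) y).
  by rewrite opprB addrA subrK.
rewrite (le_trans (rnormD _ _))// rnormN add0r [leRHS]splitr.
by rewrite addrC lerD// ltW// addrC.
Qed.

(** At most one split of b has first part w, namely the one at the length of w. *)
Lemma word_split_sum (w g b : word n) : (w ++ g == b)%:R =
  \sum_(i < (size b).+1) (drop i b == g)%:R * (w == take i b)%:R :> R[i].
Proof.
have [sw|sw] := leqP (size w) (size b); last first.
  rewrite big1 => [|i _]; last first.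
    case: (w =P _) => wi; last by rewrite mulr0.
    by move: sw; rewrite wi size_take_min ltnNge geq_minr.
  by case: eqP => // wb; move: sw; rewrite -wb size_cat ltnNge leq_addr.
rewrite (bigD1 (Ordinal (n := (size b).+1) (m := size w) sw))//= big1 => [|i iw]; last first.
  case: (w =P _) => wi; last by rewrite mulr0.
  exfalso; move/eqP: iw; apply; apply/val_inj => /=.
  by rewrite wi size_take_min; apply/esym/minn_idPl; rewrite -ltnS.
rewrite addr0 -natrM mulnb; congr (_%:R); congr nat_of_bool.
apply/eqP/andP => [<-|[/eqP bg /eqP wb]].
  by rewrite take_size_cat// drop_size_cat.
by rewrite {1}wb -bg cat_take_drop.
Qed.

(** A right-invariant operator sends e_(ag) to the right translate by g of its value
    at e_a, so its matrix is a convolution. *)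
Lemma right_invariant_coef A a g b : bounded_op A -> right_invariant A ->
  inner (A (e (a ++ g))) (e b) =
  \sum_(i < (size b).+1) inner (A (e a)) (e (take i b)) * (drop i b == g)%:R.
Proof.
move=> bA hA; have [S hS] := right_shift_ex g; have [bS Se] := hS.
rewrite -Se (hA _ _ hS) (adjE _ _ bS).
suff -> : adj S (e b) = \sum_(i < (size b).+1) (drop i b == g)%:R *: e (take i b).
  by rewrite inner_sumr; apply: eq_bigr => i _; rewrite innerZr conjC_nat mulrC.
apply: (total_inj e_total) => w; rewrite (adjEr _ _ bS) Se inner_suml.
rewrite e_orth eq_sym word_split_sum; apply: eq_bigr => i _.
by rewrite innerZl e_orth eq_sym [take _ _ == _]eq_sym.
Qed.

End RightShift.

(** * The Wold decomposition of an invariant subspace *)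

Section Forms.
Context {R : realType}.
Implicit Types H K L : hilbertType R.

Lemma form_total H K X (u : X -> H) (A B : H -> K) c : total_fam u ->
  bounded_op A -> bounded_op B ->
  (forall i j, inner (A (u i)) (B (u j)) = c * inner (u i) (u j)) ->
  forall x y, inner (A x) (B y) = c * inner x y.
Proof.
move=> tu bA bB h x y.
have bC : bounded_op (adj B \o A) by apply: bounded_comp => //; exact: bounded_adj.
have bI : bounded_op (fun z : H => c *: idfun z + 0).
  by apply: bounded_lin; [exact: bounded_id|exact: bounded_0].
rewrite -(adjEr y (A x) bB) -innerZl; congr (inner _ y).
rewrite -[LHS]/((adj B \o A) x).
rewrite (eq_on_total tu bC bI) ?addr0// => i /=; rewrite addr0.
by apply: (total_inj tu) => j; rewrite adjEr// innerZl.
Qed.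

Lemma adj_isometric_orth H K (V : H -> K) x y : bounded_op V -> isometric V ->
  inner (y - V (adj V y)) (V x) = 0.
Proof.
move=> bV iV; apply: inner_sym0.
by rewrite (adjE _ _ bV) (opB _ _ (bounded_adj bV)) adj_isometric// subrr inner0r.
Qed.

Lemma rnorm_adj_isometric H K (V : H -> K) y : bounded_op V -> isometric V ->
  rnorm (adj V y) <= rnorm y.
Proof.
move=> bV iV; rewrite -(isometric_norm (adj V y) iV) ler_sqr_nneg ?rnorm_ge0//.
rewrite -[in leRHS](subrK (V (adj V y)) y) (pythagoras (adj_isometric_orth _ _ bV iV)).
by rewrite lerDr sqr_ge0.
Qed.

Lemma form_ampliation H K (P : tensor_product H K) (A B : H -> H) c :
  bounded_op A -> bounded_op B ->
  (forall x y, inner (A x) (B y) = c * inner x y) ->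
  forall x y : P, inner (ampliation A x) (ampliation B y) = c * inner x y.
Proof.
move=> bA bB h.
have := @form_total P P _ (fun p : H * K => tensor P p.1 p.2)
  (ampliation A) (ampliation B) c (tensor_total P)
  (@bounded_ampliation _ _ _ P _ bA) (@bounded_ampliation _ _ _ P _ bB).
apply => -[x y] [x' y'] /=; rewrite !ampliation_tensor// !inner_tensor h.
by rewrite mulrA.
Qed.

(** The projection p of x to S satisfies x - p in the complement of S, hence in that
    of D, so that x - p is orthogonal to x and to p. *)
Lemma biorthocomp_sub H (D S : set H) x : closed_subspace S -> D `<=` S ->
  (forall y, orthocomp D y -> inner x y = 0) -> S x.
Proof.
move=> cS DS hx; have [p Sp hp] := projection x cS.
have h : orthocomp D (x - p) by move=> y /DS; exact: hp.
have : inner (x - p) (x - p) = 0.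
  by rewrite innerBl (hx _ h) (inner_sym0 (hp _ Sp)) subrr.
rewrite innerxx => /(@complexI R)/eqP; rewrite sqrf_eq0 => /eqP/rnorm0_eq0/eqP.
by rewrite subr_eq0 => /eqP ->.
Qed.

Lemma closure_min_subspace H (D S : set H) : closed_subspace S -> D `<=` S -> closure D `<=` S.
Proof.
move=> [_ _ /closedP cS] DS x /closureP cx; apply: cS => e /cx[a Da xa].
by exists a => //; exact: DS.
Qed.

End Forms.

Section Wold.
Context {R : realType} {n : nat} {H K : hilbertType R}.
Variable e : word n -> H.
Hypothesis e_orth : forall v w, inner (e v) (e w) = (v == w)%:R.
Hypothesis e_total : total_fam e.
Variable T : 'I_n -> H -> H.
Hypothesis bT : forall j, bounded_op (T j).
Hypothesis T_basis : forall j w, T j (e w) = e (j :: w).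
Variables (HK : tensor_product H K) (S : set HK).
Hypothesis cS : closed_subspace S.
Hypothesis S_inv : forall j x, S x -> S (ampliation (T j) x).

Let bTw w : bounded_op (opword T w). Proof. exact: bounded_opword. Qed.

Lemma opword_basis w v : opword T w (e v) = e (w ++ v).
Proof. by elim: w => [//|j w IH] /=; rewrite IH T_basis. Qed.

Lemma shift_form j l x y : inner (T j x) (T l y) = (j == l)%:R * inner x y.
Proof.
apply: (form_total e_total (bT j) (bT l)) => v w.
by rewrite !T_basis !e_orth eqseq_cons -natrM mulnb.
Qed.

Lemma amp_shift_form j l (x y : HK) :
  inner (ampliation (T j) x) (ampliation (T l) y) = (j == l)%:R * inner x y.
Proof. by apply: form_ampliation => // u v; exact: shift_form. Qed.

Lemma amp_opword_cons j w (x : HK) :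
  ampliation (opword T (j :: w)) x = ampliation (T j) (ampliation (opword T w) x).
Proof. exact: ampliation_comp. Qed.

Lemma S_inv_opword w x : S x -> S (ampliation (opword T w) x).
Proof.
move=> Sx; elim: w => [|j w IH]; first by rewrite ampliation_id.
by rewrite amp_opword_cons; exact: S_inv.
Qed.

(** The orthogonal complement of this set is the wandering subspace of S: the part
    of S orthogonal to the images of S under all the T j. *)
Definition wandering_compl : set HK :=
  [set z | orthocomp S z \/ exists j s, S s /\ z = ampliation (T j) s].

Local Notation W := (ocomp wandering_compl).

Lemma wandering_orth (w : W) j s : S s -> inner (\val w) (ampliation (T j) s) = 0.
Proof. by move=> Ss; apply: (valP_orthocomp w); right; exists j, s. Qed.

Lemma wandering_sub (w : W) : S (\val w).
Proof.
apply: (biorthocomp_sub (D := S)) => // y Sy.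
by apply: (valP_orthocomp w); left.
Qed.

Lemma wandering_intro x : S x ->
  (forall j s, S s -> inner x (ampliation (T j) s) = 0) -> exists w : W, \val w = x.
Proof.
move=> Sx hx; have xW : x \in orthocomp_pred wandering_compl.
  apply/orthocomp_predP => z [hz|[j [s [Ss ->]]]]; last exact: hx.
  by apply: inner_sym0; exact: hz.
by exists (Ocomp xW).
Qed.

(** After removing the common prefix, either the first letters differ, and the T j
    have orthogonal ranges, or a wandering vector is paired with the image of a
    vector of S under some T j. *)
Lemma wandering_form v w (x y : W) :
  inner (ampliation (opword T v) (\val x)) (ampliation (opword T w) (\val y)) =
  (v == w)%:R * inner x y.
Proof.
elim: v w => [|j v IH] [|l w].
- by rewrite !ampliation_id eqxx mul1r.
- rewrite ampliation_id amp_opword_cons wandering_orth ?mul0r//.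
  exact/S_inv_opword/wandering_sub.
- rewrite ampliation_id amp_opword_cons [LHS](inner_sym0 (wandering_orth _ _ _)) ?mul0r//.
  exact/S_inv_opword/wandering_sub.
- by rewrite !amp_opword_cons amp_shift_form IH mulrA -natrM mulnb -eqseq_cons.
Qed.

Variable HW : tensor_product H W.

(** The Fourier representation of S; it preserves inner products by the previous
    lemma. *)
Lemma wold_ex : exists V : HW -> HK, [/\ bounded_op V, isometric V &
  forall v (w : W), V (tensor HW (e v) w) = ampliation (opword T v) (\val w)].
Proof.
have [[v x] [w y]|V [bV hV iV]] := @extend_isometry _ _ _ _
  (fun p : word n * W => tensor HW (e p.1) p.2)
  (fun p => ampliation (opword T p.1) (\val p.2) : HK) (tensor_total_faml e_total).
  by rewrite /= wandering_form inner_tensor e_orth.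
by exists V; split => // v w; exact: (hV (v, w)).
Qed.

Variable V : HW -> HK.
Hypothesis bV : bounded_op V.
Hypothesis iV : isometric V.
Hypothesis hV : forall v (w : W), V (tensor HW (e v) w) = ampliation (opword T v) (\val w).

Lemma wold_sub y : S (V y).
Proof.
apply: (total_closed (S := [set y | S (V y)]) (tensor_total_faml e_total)) => [|[v w]].
  apply: closed_subspace_seq => [|a x z hx hz|u l hu ul].
  - by rewrite /= op0//; exact: csub0.
  - by rewrite /= opP//; exact: csubP.
  - exact: (csub_tends cS hu (tends_op bV ul)).
rewrite /= hV; exact/S_inv_opword/wandering_sub.
Qed.

Lemma wold_shift j y : ampliation (T j) (V y) = V (ampliation (T j) y).
Proof.
rewrite -[LHS]/((ampliation (T j) \o V) y) -[RHS]/((V \o ampliation (T j)) y).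
apply: (eq_on_total (tensor_total_faml e_total)).
- by apply: bounded_comp => //; exact: bounded_ampliation.
- by apply: bounded_comp => //; exact: bounded_ampliation.
- move=> [v w] /=; rewrite hV ampliation_tensor// T_basis hV.
  by rewrite -amp_opword_cons.
Qed.

(** The projection of such an r to S is a wandering vector. *)
Lemma wold_step r : (forall j s, S s -> inner r (ampliation (T j) s) = 0) ->
  exists y, forall s, S s -> inner (r - V y) s = 0.
Proof.
move=> hr; have [p Sp hp] := projection r cS.
have [|w wp] := @wandering_intro p Sp.
  move=> j s Ss; have := hp _ (S_inv j Ss).
  by rewrite innerBl hr// sub0r => /eqP; rewrite oppr_eq0 => /eqP.
by exists (tensor HW (e [::]) w) => s Ss; rewrite hV ampliation_id wp hp.
Qed.

(** By induction on b. If e_b (x) k = V y + r with r orthogonal to S, then T j r is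
    orthogonal to every T l S because the T j are isometries with orthogonal
    ranges, so its projection to S is wandering. *)
Lemma wold_approx b k : exists y, forall s, S s -> inner (tensor HK (e b) k - V y) s = 0.
Proof.
elim: b => [|j b [y hy]].
  apply: wold_step => j s _; apply: inner_sym0.
  have bA := @bounded_ampliation _ _ _ HK _ (bT j).
  rewrite (adjE _ _ bA); suff -> : adj (ampliation (T j)) (tensor HK (e [::]) k) = 0.
    by rewrite inner0r.
  apply: (tensor_total_faml e_total) => -[v y] /=; rewrite (adjEr _ _ bA).
  by rewrite ampliation_tensor// T_basis inner_tensor e_orth mul0r.
set r := tensor HK (e b) k - V y in hy.
have [l s Ss|y1 hy1] := @wold_step (ampliation (T j) r).
  by rewrite amp_shift_form hy// mulr0.
exists (ampliation (T j) y + y1) => s Ss; rewrite -(hy1 s Ss); congr (inner _ s).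
have bA := @bounded_ampliation _ _ _ HK _ (bT j).
rewrite /r (opB _ _ bA) ampliation_tensor// T_basis (opD _ _ bV) -wold_shift.
by rewrite opprD addrA.
Qed.

(** Since the projections to S of all basis tensors lie in the closed range of V, a
    vector of S orthogonal to this range is orthogonal to a total family. *)
Lemma wold_range : range V = S.
Proof.
apply/seteqP; split=> [_ [y _ <-]|s Ss]; first exact: wold_sub.
have [q [y _ yq] hq] := projection s (closed_range_isometric bV iV).
have Sq : S q by rewrite -yq; exact: wold_sub.
exists y => //; rewrite yq; apply/eqP; rewrite eq_sym -subr_eq0; apply/eqP.
apply: (tensor_total_faml e_total (K := K) (P := HK)) => -[b k] /=.
have [z hz] := wold_approx b k.
rewrite -(subrK (V z) (tensor HK (e b) k)) innerDr (hq _ (imageT V z)) addr0.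
by apply: inner_sym0; apply: hz; exact: csubB.
Qed.

(** Both sides are bounded functionals of x, and on basis tensors the identity is
    the convolution formula for the matrix of A. *)
Lemma wold_coef A a x b k : bounded_op A -> right_invariant e A ->
  inner (ampliation A (ampliation (opword T a) x)) (tensor HK (e b) k) =
  \sum_(i < (size b).+1) inner (A (e a)) (e (take i b)) * inner x (tensor HK (e (drop i b)) k).
Proof.
move=> bA hA.
have bB : bounded_op (ampliation A \o ampliation (opword T a) : HK -> HK).
  by apply: bounded_comp; exact: bounded_ampliation.
rewrite -[ampliation A _]/((ampliation A \o ampliation (opword T a)) x) (adjE _ _ bB).
suff -> : adj (ampliation A \o ampliation (opword T a)) (tensor HK (e b) k) =
    \sum_(i < (size b).+1) (inner (A (e a)) (e (take i b)))^* *: tensor HK (e (drop i b)) k.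
  by rewrite inner_sumr; apply: eq_bigr => i _; rewrite innerZr conjCK.
apply: (total_inj (tensor_total_faml e_total)) => -[g y] /=.
rewrite (adjEr _ _ bB) inner_suml /=.
rewrite !ampliation_tensor// opword_basis inner_tensor (inner_conj (e b)).
rewrite (right_invariant_coef e_orth e_total)// rmorph_sum mulr_suml.
apply: eq_bigr => i _; rewrite innerZl inner_tensor e_orth rmorphM /=.
by rewrite conjC_nat mulrA.
Qed.

Lemma wold_coef_vector h (w : W) b k : inner (V (tensor HW h w)) (tensor HK (e b) k) =
  \sum_(i < (size b).+1) inner h (e (take i b)) * inner (\val w) (tensor HK (e (drop i b)) k).
Proof.
have bL : bounded_op (V \o (fun h => tensor HW h w)).
  by apply: bounded_comp => //; exact: bounded_tensorl.
rewrite -[V _]/((V \o (fun h => tensor HW h w)) h) (adjE _ _ bL).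
suff -> : adj (V \o (fun h => tensor HW h w)) (tensor HK (e b) k) =
    \sum_(i < (size b).+1) (inner (\val w) (tensor HK (e (drop i b)) k))^* *: e (take i b).
  by rewrite inner_sumr; apply: eq_bigr => i _; rewrite innerZr conjCK mulrC.
apply: (total_inj e_total) => a; rewrite (adjEr _ _ bL) /= inner_suml hV.
have := wold_coef a (\val w) b k (bounded_id H) (@right_invariant_id _ _ _ e).
rewrite ampliation_id => E; rewrite [LHS]inner_conj E rmorph_sum.
apply: eq_bigr => i _; rewrite innerZl rmorphM /= mulrC; congr (_ * _).
by rewrite -inner_conj.
Qed.

(** Both sides have the same convolution formula for their coefficients. *)
Lemma wold_intertwine A y : bounded_op A -> right_invariant e A ->
  ampliation A (V y) = V (ampliation A y).
Proof.
move=> bA hA.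
rewrite -[LHS]/((ampliation A \o V) y) -[RHS]/((V \o ampliation A) y).
apply: (eq_on_total (tensor_total_faml e_total)).
- by apply: bounded_comp => //; exact: bounded_ampliation.
- by apply: bounded_comp => //; exact: bounded_ampliation.
- move=> [a w] /=; rewrite hV ampliation_tensor//.
  apply: (total_inj (tensor_total_faml e_total)) => -[b k] /=.
  by rewrite wold_coef// wold_coef_vector.
Qed.

End Wold.

(** * Invariant subspaces of the model of a variety *)

Section VarietyModel.
Context {R : realType} {n : nat} {H K : hilbertType R}.
Variable e : word n -> H.
Hypothesis e_orth : forall v w, inner (e v) (e w) = (v == w)%:R.
Hypothesis e_total : total_fam e.
Variable M : 'I_n -> H -> H.
Hypothesis bM : forall i, bounded_op (M i).
Hypothesis M_right : forall i, right_invariant e (M i).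
Variable T : 'I_n -> H -> H.
Hypothesis T_basis : forall j w, T j (e w) = e (j :: w).
Hypothesis T_alg : forall j, sot_alg M (T j).
Variable J : set (H -> H).
Hypothesis J_ideal : wot_closed_ideal M J.
Local Notation N := (variety_space J).
Local Notation B := (@variety_model _ _ _ M J).
Variable NK : tensor_product N K.

Let bT j : bounded_op (T j). Proof. exact: (sot_alg_bounded bM). Qed.

Definition ideal_range : set H := closure [set y : H | exists2 A, J A & exists h, y = A h].

Local Notation PN := (@oproj R H ideal_range).

Lemma hardy_gen i : hardy_algebra M (M i).
Proof.
split=> // m x y eps eps0; exists (optrunc (ncX i) M 2); first by exists (ncX i), 2%N.
move=> k; suff -> : optrunc (ncX i) M 2 (x k) = M i (x k).
  by rewrite subrr inner0l rnorm0.
rewrite /optrunc big_ord_recl big_ord_recl big_ord0 addr0 /wsum /=.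
rewrite big1 ?add0r => [|w _]; last by rewrite tuple0 /ncX scale0r.
rewrite (bigD1 [tuple i])//= big1 => [|w wi].
  by rewrite addr0 /ncX eqxx scale1r.
rewrite /ncX; suff /negPf -> : (tval w != [:: i]) by rewrite scale0r.
by apply: contraNneq wi => wi; apply/eqP/val_inj.
Qed.

Lemma hardy_right_invariant A : hardy_algebra M A -> right_invariant e A.
Proof.
by apply: right_invariant_wot => _ [p [d ->]]; exact: right_invariant_optrunc.
Qed.

Lemma ideal_bounded A : J A -> bounded_op A.
Proof. by move=> /(ideal_sub J_ideal)[]. Qed.

Lemma ideal_range_inv i x : ideal_range x -> ideal_range (M i x).
Proof.
have [_ [C C0 hC]] := (bounded_opP _).1 (bM i).
move=> /closureP hx; apply/closureP => eps eps0.
have e1 : 0 < eps / (C + 1) by rewrite divr_gt0// ltr_wpDl.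
have [_ [A JA [h ->]] xa] := hx _ e1; exists (M i (A h)).
  by exists (M i \o A); [apply: (ideal_mull J_ideal) => //; exact: hardy_gen|exists h].
rewrite -(opB _ _ (bM i)) (le_lt_trans (hC _))//.
move: xa; rewrite ltr_pdivlMr ?ltr_wpDl//; apply: le_lt_trans.
by rewrite mulrC ler_wpM2l ?rnorm_ge0// lerDl.
Qed.

(** The range of the ideal is invariant under M i, so N is invariant under the adjoint
    of M i. *)
Lemma compression_proj i h : PN (M i (\val (PN h))) = PN (M i h).
Proof.
apply: inner_inj => z; rewrite !inner_oproj.
rewrite (adjE _ _ (bM i)) (adjE _ _ (bM i)).
have hz : orthocomp ideal_range (adj (M i) (\val z)).
  move=> y hy; rewrite (adjEr _ _ (bM i)).
  exact: (valP_orthocomp z (ideal_range_inv hy)).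
pose z' : N := Ocomp ((orthocomp_predP _ _).2 hz).
by rewrite -[adj _ _]/(\val z') inner_val inner_oproj.
Qed.

Lemma PN_ideal A h : J A -> PN (A h) = 0.
Proof.
move=> JA; apply: inner_eq0 => z; rewrite inner_oproj.
apply: inner_sym0; apply: (valP_orthocomp z).
by apply: subset_closure; exists A => //; exists h.
Qed.

Lemma bounded_variety_model i : bounded_op (B i).
Proof.
have -> : B i = PN \o (M i \o (fun x : N => \val x)) by [].
apply: bounded_comp; first exact: bounded_oproj.
by apply: bounded_comp => //; exact: bounded_val.
Qed.

Lemma inclusion_ex (L : hilbertType R) (NL : tensor_product N L) (HL : tensor_product H L) :
  exists I : NL -> HL, [/\ bounded_op I, isometric I,
    forall x y, I (tensor NL x y) = tensor HL (\val x) y &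
    forall h y, adj I (tensor HL h y) = tensor NL (PN h) y].
Proof.
have [[x y] [x' y']|I [bI hI iI]] := @extend_isometry _ _ _ _
  (fun p : N * L => tensor NL p.1 p.2)
  (fun p => tensor HL (\val p.1) p.2) (tensor_total NL).
  by rewrite /= !inner_tensor inner_val.
have hI' x y : I (tensor NL x y) = tensor HL (\val x) y by exact: (hI (x, y)).
exists I; split => // h y; apply: (total_inj (tensor_total NL)) => -[x y'] /=.
by rewrite (adjEr _ _ bI) hI' !inner_tensor inner_oproj.
Qed.

Lemma adj_inclusion_intertwine (L : hilbertType R) (NL : tensor_product N L)
    (HL : tensor_product H L) (I : NL -> HL) i x : bounded_op I ->
  (forall h y, adj I (tensor HL h y) = tensor NL (PN h) y) ->
  adj I (ampliation (M i) x) = ampliation (B i) (adj I x).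
Proof.
move=> bI hI; have bA := bounded_adj bI.
rewrite -[LHS]/((adj I \o ampliation (M i)) x) -[RHS]/((ampliation (B i) \o adj I) x).
apply: (eq_on_total (tensor_total HL)).
- by apply: bounded_comp => //; exact: bounded_ampliation.
- by apply: bounded_comp => //; apply: bounded_ampliation; exact: bounded_variety_model.
- move=> [h y] /=; rewrite hI !ampliation_tensor//; last exact: bounded_variety_model.
  by rewrite hI -compression_proj.
Qed.

(** The preimage S' of S in H (x) K is invariant under the ampliations of the M i,
    hence of the T j, and V maps H (x) W isometrically onto it. Compressing V to N
    on both sides gives Theta. It still maps onto S, because V followed by the
    projection to N (x) K annihilates the complement of N (x) W: for A in the
    ideal, V carries (A h) (x) w to a vector in the range of the ampliation of A,
    which the projection annihilates. *)
Lemma invariant_subspace_partial_isometry (S : set NK) : closed_subspace S ->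
  (forall i x, S x -> S (ampliation (B i) x)) ->
  exists (G : hilbertType R) (NG : tensor_product N G) (Theta : NG -> NK),
    [/\ partial_isometry Theta,
        forall i, Theta \o ampliation (B i) = ampliation (B i) \o Theta &
        S = range Theta].
Proof.
move=> cS SB.
have [HK] := tensor_product_ex e_orth e_total K.
have [I [bI iI hI hI']] := inclusion_ex NK HK.
have bI' := bounded_adj bI.
pose S' : set HK := [set x | S (adj I x)].
have cS' : closed_subspace S'.
  apply: closed_subspace_seq => [|a x y hx hy|u l hu ul].
  - by rewrite /S' /= (op0 bI'); exact: csub0.
  - by rewrite /S' /= (opP _ _ _ bI'); exact: csubP.
  - exact: (csub_tends cS hu (tends_op bI' ul)).
have S'M i x : S' x -> S' (ampliation (M i) x).
  by rewrite /S' /= (adj_inclusion_intertwine i x bI hI'); exact: SB.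
have S'T j x : S' x -> S' (ampliation (T j) x).
  exact: (sot_alg_invariant bM cS' S'M).
pose W := ocomp (wandering_compl T S').
have [HW] := tensor_product_ex e_orth e_total W.
have [NW] : inhabited (tensor_product N W) by exact: (tensor_product_ocomp_ex e_orth e_total).
have [V [bV iV hV]] := wold_ex e_orth e_total bT T_basis cS' S'T HW.
have rV := wold_range e_orth e_total bT T_basis cS' S'T bV iV hV.
have VA A y : bounded_op A -> right_invariant e A -> ampliation A (V y) = V (ampliation A y).
  exact: (wold_intertwine e_orth e_total bT T_basis bV hV).
have [I1 [bI1 iI1 hI1 hI1']] := inclusion_ex NW HW.
have bI1' := bounded_adj bI1.
pose Q := adj I \o V : HW -> NK.
have bQ : bounded_op Q by exact: bounded_comp.
(* Q annihilates the orthogonal complement of N (x) W. *)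
have QP y : Q (I1 (adj I1 y)) = Q y.
  rewrite -[LHS]/((Q \o (I1 \o adj I1)) y).
  apply: (eq_on_total (tensor_total HW)); [|exact: bQ|].
    by apply: bounded_comp => //; exact: bounded_comp.
  move=> [h w] /=; rewrite hI1' hI1; apply/eqP.
  rewrite -subr_eq0 -(opB _ _ bQ) -tensorBl; apply/eqP.
  pose Z : set H := [set h | Q (tensor HW h w) = 0].
  have bZ : bounded_op (Q \o (fun h => tensor HW h w)).
    by apply: bounded_comp => //; exact: bounded_tensorl.
  have cZ : closed_subspace Z.
    apply: closed_subspace_seq => [|a x y' hx hy|u l hu ul].
    - by rewrite /Z /= tensor0l (op0 bQ).
    - by rewrite /Z /= tensorPl (opP _ _ _ bQ) hx hy scaler0 addr0.
    - apply: (tends_uniq (tends_op bZ ul)).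
      by apply: eq_tends (tends_cst _); exists 0%N => d _ /=; rewrite hu.
  apply: (biorthocomp_sub (D := ideal_range) cZ).
    apply: closure_min_subspace => // _ [A JA [x ->]].
    have bA := ideal_bounded JA.
    rewrite /Z /= /Q /= -(ampliation_tensor HW x w bA).
    rewrite -VA//; last exact/hardy_right_invariant/(ideal_sub J_ideal).
    rewrite -[LHS]/((adj I \o ampliation A) (V (tensor HW x w))).
    apply: (zero_on_total (tensor_total HK)).
      by apply: bounded_comp => //; exact: bounded_ampliation.
    move=> [h' k] /=; rewrite ampliation_tensor// hI' PN_ideal//.
    by rewrite tensor0l.
  move=> y' hy'; rewrite innerBl.
  pose z : N := Ocomp ((orthocomp_predP _ _).2 hy').
  by rewrite -[y']/(\val z) inner_val inner_oproj subrr.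
pose Theta : NW -> NK := Q \o I1.
have bTh : bounded_op Theta by exact: bounded_comp.
have ThS x : S (Theta x).
  have : S' (V (I1 x)) by rewrite -rV; exists (I1 x).
  by [].
(* Such short preimages make Theta a partial isometry: a vector x orthogonal to the
   kernel is the projection of any preimage x' of Theta x, so it is at most as long
   as x', hence as Theta x. *)
have lift s : S s -> exists2 x, Theta x = s & rnorm x <= rnorm s.
  move=> Ss; have [y _ hy] : range V (I s).
    by rewrite rV /S' /= adj_isometric.
  exists (adj I1 y).
    by rewrite /Theta /= QP /Q /= hy adj_isometric.
  rewrite -(isometric_norm s iI) -hy (isometric_norm y iV).
  exact: rnorm_adj_isometric.
exists W, NW, Theta; split.
- split=> // x hx.
  have [x' Tx xs] := lift _ (ThS x).
  have h0 : Theta (x - x') = 0 by rewrite (opB _ _ bTh) Tx subrr.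
  have xx' : inner x (x - x') = 0 by exact: hx.
  apply/eqP; rewrite !normE (inj_eq (@complexI R)).
  have le1 : rnorm x <= rnorm x'.
    have : rnorm (x' - x + x) ^+ 2 = rnorm (x' - x) ^+ 2 + rnorm x ^+ 2.
      by apply: pythagoras; rewrite -opprB -scaleN1r innerZl (inner_sym0 xx') mulr0.
    by rewrite subrK ler_sqr_nneg ?rnorm_ge0// => ->; rewrite lerDr sqr_ge0.
  have le2 : rnorm (Theta x) <= rnorm x.
    rewrite /Theta /= /Q /=.
    by rewrite (le_trans (rnorm_adj_isometric _ bI iI))// !isometric_norm.
  by rewrite eq_le le2 (le_trans le1 xs).
- move=> i; apply/funext => x /=.
  have bBi := @bounded_variety_model i.
  rewrite /Q /= -(adj_inclusion_intertwine i _ bI hI').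
  rewrite VA//.
  rewrite -[RHS]/(Q (ampliation (M i) (I1 x))) -QP.
  rewrite (adj_inclusion_intertwine i _ bI1 hI1') adj_isometric//.
- apply/seteqP; split=> [s /lift[x <- _]|_ [x _ <-]]; [by exists x|exact: ThS].
Qed.

End VarietyModel.

(** * Noncommutative power series *)

Section SeriesAlgebra.
Context {R : realType} {n : nat}.
Local Notation series := (ncseries R n).
Local Notation word := (word n).
Implicit Types (a b c : series) (u v w : word).

Definition delta w : series := fun v => (v == w)%:R.

Lemma wsum_delta (V : lmodType R[i]) d w (F : word -> V) :
  \sum_(k < d) wsum k (fun u => (u == w)%:R *: F u) = if (size w < d)%N then F w else 0.
Proof.
have E k : k != size w -> wsum k (fun u => (u == w)%:R *: F u) = 0.
  move=> kw; rewrite /wsum big1// => u _; case: eqP => uw; last by rewrite scale0r.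
  by move: kw; rewrite -uw size_tuple eqxx.
case: ltnP => wd; last first.
  by rewrite big1// => k _; apply: E; rewrite neq_ltn (leq_trans _ wd).
rewrite (bigD1 (Ordinal wd))//= big1 ?addr0 => [|k kw]; last first.
  by apply: E; apply: contraNneq kw => kw; apply/eqP/val_inj.
rewrite /wsum (bigD1 (in_tuple w))//= eqxx scale1r big1 ?addr0// => u uw.
suff /negPf -> : tval u != w by rewrite scale0r.
by apply: contraNneq uw => uw; apply/eqP/val_inj.
Qed.

Lemma wsum_delta_scalar d w (F : word -> R[i]) :
  \sum_(k < d) wsum k (fun u => F u * (w == u)%:R) = if (size w < d)%N then F w else 0.
Proof.
rewrite -(@wsum_delta R[i]^o); apply: eq_bigr => k _; apply: eq_bigr => u _.
by rewrite mulrC eq_sym.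
Qed.

Lemma poly_delta d a : degree_lt d a ->
  a = fun v => \sum_(k < d) wsum k (fun w => a w * delta w v).
Proof.
move=> ad; apply/funext => v; rewrite wsum_delta_scalar.
by case: ltnP => // /ad.
Qed.

Lemma ncmul_nil a b : ncmul a b [::] = a [::] * b [::].
Proof. by rewrite /ncmul big_ord_recl big_ord0 addr0. Qed.

(** Splitting off the empty prefix; this recursion is what makes associativity a
    plain induction on the word. *)
Lemma ncmul_cons a b x w :
  ncmul a b (x :: w) = a [::] * b (x :: w) + ncmul (fun u => a (x :: u)) b w.
Proof. by rewrite /ncmul big_ord_recl. Qed.

Lemma ncmul_suml I (r : seq I) (F : I -> series) (s : I -> R[i]) b w :
  ncmul (fun v => \sum_(i <- r) s i * F i v) b w = \sum_(i <- r) s i * ncmul (F i) b w.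
Proof.
rewrite /ncmul; under eq_bigr do rewrite mulr_suml.
rewrite exchange_big/=; apply: eq_bigr => i _; rewrite mulr_sumr.
by apply: eq_bigr => k _; rewrite mulrA.
Qed.

Lemma ncmul_sumr I (r : seq I) (F : I -> series) (s : I -> R[i]) a w :
  ncmul a (fun v => \sum_(i <- r) s i * F i v) w = \sum_(i <- r) s i * ncmul a (F i) w.
Proof.
rewrite /ncmul; under eq_bigr do rewrite mulr_sumr.
rewrite exchange_big/=; apply: eq_bigr => i _; rewrite mulr_sumr.
by apply: eq_bigr => k _; rewrite mulrCA.
Qed.

Lemma ncmulPl s a a' b w :
  ncmul (fun v => s * a v + a' v) b w = s * ncmul a b w + ncmul a' b w.
Proof.
rewrite /ncmul mulr_sumr -big_split/=; apply: eq_bigr => k _.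
by rewrite mulrDl mulrA.
Qed.

Lemma ncmulA a b c : ncmul (ncmul a b) c = ncmul a (ncmul b c).
Proof.
apply/funext => w; elim: w a b => [|x w IH] a b; first by rewrite !ncmul_nil mulrA.
rewrite !ncmul_cons ncmul_nil.
have -> : (fun u => ncmul a b (x :: u)) =
    (fun u => a [::] * b (x :: u) + ncmul (fun u => a (x :: u)) b u).
  by apply/funext => u; rewrite ncmul_cons.
by rewrite ncmulPl IH mulrDr addrA mulrA.
Qed.

Lemma delta_mul v w : ncmul (delta v) (delta w) = delta (v ++ w).
Proof.
apply/funext => u; rewrite /ncmul /delta [u == _]eq_sym word_split_sum.
by apply: eq_bigr => i _; rewrite mulrC [take _ _ == _]eq_sym.
Qed.

Lemma nc1_mul a : ncmul nc1 a = a.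
Proof.
apply/funext => -[|x w]; first by rewrite ncmul_nil /nc1 eqxx mul1r.
rewrite ncmul_cons /nc1 eqxx mul1r /ncmul big1 ?addr0// => k _.
by rewrite mul0r.
Qed.

Lemma ncword_cat (g : 'I_n -> series) v w : ncword g (v ++ w) = ncmul (ncword g v) (ncword g w).
Proof. by elim: v => [|i v IH] /=; rewrite ?nc1_mul// IH ncmulA. Qed.

Lemma ncword_X w : ncword (@ncX R n) w = delta w.
Proof. by elim: w => [//|i w IH] /=; rewrite IH -[ncX i]/(delta [:: i]) delta_mul. Qed.

Lemma nctrunc_delta w (g : 'I_n -> series) d v :
  nctrunc (delta w) g d v = if (size w < d)%N then ncword g w v else 0.
Proof. exact: (@wsum_delta R[i]^o d w (fun u => ncword g u v)). Qed.

Lemma nctrunc_sum I (r : seq I) (s : I -> R[i]) (F : I -> series) g d v :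
  nctrunc (fun u => \sum_(i <- r) s i * F i u) g d v = \sum_(i <- r) s i * nctrunc (F i) g d v.
Proof.
rewrite /nctrunc.
under eq_bigr => k _ do
  (rewrite /wsum; under eq_bigr => u _ do rewrite mulr_suml; rewrite exchange_big/=).
rewrite exchange_big/=; apply: eq_bigr => i _; rewrite mulr_sumr.
apply: eq_bigr => k _; rewrite /wsum mulr_sumr.
by apply: eq_bigr => u _; rewrite mulrA.
Qed.

Lemma nctruncP s a b g d v :
  nctrunc (fun u => s * a u + b u) g d v = s * nctrunc a g d v + nctrunc b g d v.
Proof.
rewrite /nctrunc mulr_sumr -big_split/=; apply: eq_bigr => k _.
rewrite /wsum mulr_sumr -big_split/=; apply: eq_bigr => u _.
by rewrite mulrDl mulrA.
Qed.

Lemma nctrunc_widen d d' a g v : (d <= d')%N -> degree_lt d a ->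
  nctrunc a g d' v = nctrunc a g d v.
Proof.
move=> /subnKC <- ad; rewrite /nctrunc big_split_ord/= [X in _ + X]big1 ?addr0//.
move=> k _; rewrite /wsum big1// => w _.
by rewrite ad ?mul0r// size_tuple leq_addr.
Qed.

(** Turns the double sums over lengths and words into single sums over a list. *)
Definition words_lt d : seq word :=
  flatten [seq [seq tval t | t <- enum {: k.-tuple 'I_n}] | k <- iota 0 d].

Lemma sum_words (V : nmodType) d (F : word -> V) :
  \sum_(k < d) wsum k F = \sum_(w <- words_lt d) F w.
Proof.
have -> : words_lt d = flatten [seq [seq tval t | t <- enum {: k.-tuple 'I_n}] |
    k <- index_iota 0 d] by rewrite /index_iota subn0.
rewrite big_flatten big_map big_mkord.
by apply: eq_bigr => k _; rewrite big_map big_enum.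
Qed.

Lemma size_words_lt d w : w \in words_lt d -> (size w < d)%N.
Proof.
move=> /flattenP[_ /mapP[k kd ->] /mapP[u _ ->]]; rewrite size_tuple.
by move: kd; rewrite mem_iota add0n.
Qed.

Lemma poly_words d a : degree_lt d a ->
  a = fun v => \sum_(w <- words_lt d) a w * delta w v.
Proof.
move=> ad; rewrite {1}(poly_delta ad); apply/funext => v.
exact: (sum_words d (fun w => a w * delta w v)).
Qed.

Lemma nctruncE a g d :
  nctrunc a g d = fun v => \sum_(w <- words_lt d) a w * ncword g w v.
Proof. by apply/funext => v; rewrite -(sum_words d (fun w => a w * ncword g w v)). Qed.

(** Both factors are finite combinations of words, on which this is the
    compatibility of substitution with concatenation. *)
Lemma nctrunc_mul d d' a b g : degree_lt d a -> degree_lt d' b ->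
  nctrunc (ncmul a b) g (d + d') = ncmul (nctrunc a g d) (nctrunc b g d').
Proof.
move=> ad bd.
have -> : ncmul a b = fun u => \sum_(w <- words_lt d) a w *
    \sum_(w' <- words_lt d') b w' * delta (w ++ w') u.
  apply/funext => u; rewrite {1}(poly_words ad) ncmul_suml; apply: eq_bigr => w _.
  rewrite {1}(poly_words bd) ncmul_sumr; congr (_ * _); apply: eq_bigr => w' _.
  by rewrite delta_mul.
apply/funext => v; rewrite (nctrunc_sum _ a) !nctruncE ncmul_suml.
apply: eq_big_seq => w /size_words_lt wd.
rewrite (nctrunc_sum _ b) ncmul_sumr; congr (_ * _).
apply: eq_big_seq => w' /size_words_lt wd'.
rewrite nctrunc_delta size_cat ncword_cat ifT//.
by rewrite -addSn leq_add// ltnW.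
Qed.

End SeriesAlgebra.

(** * Coefficients in a basis *)

Section Coefficients.
Context {R : realType} {n : nat} {H : hilbertType R}.
Variable e : word n -> H.
Hypothesis e_orth : forall v w, inner (e v) (e w) = (v == w)%:R.
Hypothesis e_total : total_fam e.
Local Notation coef := (coef e).

Lemma coef_basis w : coef (e w) = delta w.
Proof. by apply/funext => v; rewrite /coef e_orth /delta eq_sym. Qed.

Lemma coefP s h h' w : coef (s *: h + h') w = s * coef h w + coef h' w.
Proof. exact: innerPl. Qed.

Lemma coef_inj h h' : coef h = coef h' -> h = h'.
Proof. by move=> hh; apply: (total_inj e_total) => w; rewrite -!/(coef _ w) hh. Qed.

(** A functional in Riesz form. Identities between coefficients of a general vector
    are proved below by checking them on the basis. *)
Definition functional (phi : H -> R[i]) := exists y, forall h, phi h = inner h y.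

Lemma functional_eq phi psi : functional phi -> functional psi ->
  (forall w, phi (e w) = psi (e w)) -> forall h, phi h = psi h.
Proof.
move=> [y hy] [z hz] E h; rewrite hy hz; congr (inner h _).
apply: (total_inj e_total) => w.
by rewrite inner_conj -hy E hz -inner_conj.
Qed.

Lemma functional_coef w : functional (fun h => coef h w).
Proof. by exists (e w). Qed.

Lemma functional_comp phi S : bounded_op S -> functional phi -> functional (fun h => phi (S h)).
Proof. by move=> bS [y hy]; exists (adj S y) => h; rewrite hy adjE. Qed.

Lemma functionalM phi s : functional phi -> functional (fun h => phi h * s).
Proof. by move=> [y hy]; exists (s^* *: y) => h; rewrite hy innerZr conjCK mulrC. Qed.

Lemma functional_sum I (r : seq I) (P : pred I) (phi : I -> H -> R[i]) :
  (forall i, functional (phi i)) -> functional (fun h => \sum_(i <- r | P i) phi i h).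
Proof.
move=> hphi; have [y hy] := choice hphi.
exists (\sum_(i <- r | P i) y i) => h; rewrite inner_sumr.
by apply: eq_bigr => i _; rewrite hy.
Qed.

Lemma functional_trunc (c : word n -> R[i]) d :
  functional (fun h => \sum_(k < d) wsum k (fun w => coef h w * c w)).
Proof.
apply: functional_sum => k; apply: functional_sum => w.
exact/functionalM/functional_coef.
Qed.

Lemma functional_optrunc (E : hilbertType R) (Y : 'I_n -> E -> E) d x z :
  functional (fun h => inner (optrunc (coef h) Y d x) z).
Proof.
have := functional_trunc (fun w => inner (opword Y w x) z) d.
congr functional; apply/funext => h; rewrite inner_suml; apply: eq_bigr => k _.
by rewrite /wsum inner_suml; apply: eq_bigr => w _; rewrite innerZl.
Qed.

Lemma optrunc_delta (E : hilbertType R) (Y : 'I_n -> E -> E) d x w :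
  optrunc (delta w) Y d x = if (size w < d)%N then opword Y w x else 0.
Proof. exact: (wsum_delta d w (fun u => opword Y u x)). Qed.

Lemma opword_cat (E : hilbertType R) (Y : 'I_n -> E -> E) v w x :
  opword Y (v ++ w) x = opword Y v (opword Y w x).
Proof. by elim: v => [//|i v IH] /=; rewrite IH. Qed.

(** Right multiplication by the word g becomes composition with g(Y) on the right.
    Both sides are functionals of h, so it is enough to look at basis vectors. *)
Lemma optrunc_shift (E : hilbertType R) (Y : 'I_n -> E -> E) d x g S h : right_shift e g S ->
  optrunc (coef (S h)) Y (d + size g) x = optrunc (coef h) Y d (opword Y g x).
Proof.
move=> [bS Se]; apply: inner_inj => z; move: h; apply: functional_eq.
- by apply: (functional_comp (phi := fun h => inner (optrunc (coef h) Y _ x) z)) => //;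
    exact: functional_optrunc.
- exact: functional_optrunc.
- move=> w; rewrite Se !coef_basis !optrunc_delta size_cat ltn_add2r.
  by case: ifP => // _; rewrite opword_cat.
Qed.

Lemma nctrunc_shift (f : 'I_n -> ncseries R n) d v g S h : right_shift e g S ->
  nctrunc (coef (S h)) f (d + size g) v = ncmul (nctrunc (coef h) f d) (ncword f g) v.
Proof.
move=> [bS Se]; move: h; apply: functional_eq.
- by apply: (functional_comp (phi := fun h => nctrunc (coef h) f _ v)) => //;
    exact: functional_trunc.
- by apply: functional_sum => k; apply: functionalM; exact: functional_trunc.
- move=> w; rewrite Se !coef_basis nctrunc_delta size_cat ltn_add2r ncword_cat.
  have -> : nctrunc (delta w) f d = if (size w < d)%N then ncword f w else (fun=> 0).
    by apply/funext => u; rewrite nctrunc_delta; case: ifP.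
  by case: ifP => // _; rewrite /ncmul big1// => k _; rewrite mul0r.
Qed.

Lemma degree_shift d g S h : right_shift e g S -> degree_lt d (coef h) ->
  degree_lt (d + size g) (coef (S h)).
Proof.
move=> [bS Se] hd u du; suff -> : coef (S h) u =
    \sum_(i < (size u).+1) coef h (take i u) * (drop i u == g)%:R.
  rewrite big1// => i _; case: eqP => [ug|]; last by rewrite mulr0.
  have iu : (i <= size u)%N by rewrite -ltnS.
  rewrite hd ?mul0r// -(leq_add2r (size g)) (leq_trans du)//.
  by rewrite -ug size_take_min size_drop (minn_idPl iu) subnKC.
move: h {hd}; apply: functional_eq.
- by apply: (functional_comp (phi := fun h => coef h u)) => //; exact: functional_coef.
- by apply: functional_sum => i; exact/functionalM/functional_coef.
- move=> w; rewrite Se !coef_basis /delta [u == _]eq_sym word_split_sum.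
  by apply: eq_bigr => i _; rewrite mulrC [take _ _ == _]eq_sym.
Qed.

End Coefficients.

(** * Evaluation of series at operators *)

Section Evaluation.
Context {R : realType}.

Section OpNorm.
Context {H K : hilbertType R}.
Variable T : H -> K.
Hypothesis bT : bounded_op T.

Lemma opnorm_has_sup : has_sup [set rnorm (T x) | x in [set x : H | rnorm x <= 1]].
Proof.
split; first by exists (rnorm (T 0)), 0 => //=; rewrite rnorm0.
have [_ [C C0 hC]] := (bounded_opP _).1 bT.
exists C => _ [x /= x1 <-]; rewrite (le_trans (hC x))//.
by rewrite -[leRHS]mulr1 ler_wpM2l.
Qed.

Lemma rnorm_opnorm x : rnorm (T x) <= opnorm T * rnorm x.
Proof.
have [->|x0] := eqVneq x 0; first by rewrite (op0 bT) !rnorm0 mulr0.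
have n0 : 0 < rnorm x.
  by rewrite lt_neqAle rnorm_ge0 eq_sym andbT; apply: contraNneq x0 => /rnorm0_eq0 ->.
rewrite -ler_pdivrMr//.
have -> : rnorm (T x) / rnorm x = rnorm (T (((rnorm x)^-1)%:C%C *: x)).
  by rewrite (opZ _ _ bT) rnormZ rnorm_real ?invr_ge0 ?ltW// mulrC.
apply: sup_ubound; first exact: opnorm_has_sup.2.
exists (((rnorm x)^-1)%:C%C *: x) => //=.
have n1 : rnorm x != 0 by rewrite gt_eqF.
by rewrite rnormZ rnorm_real ?invr_ge0 ?rnorm_ge0// mulVf.
Qed.

Lemma opnorm_ge0 : 0 <= opnorm T.
Proof.
apply: (@le_trans _ _ (rnorm (T 0))); first exact: rnorm_ge0.
apply: sup_ubound; first exact: opnorm_has_sup.2.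
by exists 0 => //=; rewrite rnorm0.
Qed.

Lemma opnorm_le C : 0 <= C -> (forall x, rnorm (T x) <= C * rnorm x) -> opnorm T <= C.
Proof.
move=> C0 hC; apply: ge_sup; first exact: opnorm_has_sup.1.
move=> _ [x /= x1 <-]; rewrite (le_trans (hC x))//.
by rewrite -[leRHS]mulr1 ler_wpM2l.
Qed.

End OpNorm.

Context {n : nat} {H : hilbertType R}.
Implicit Types (a : ncseries R n) (Y : 'I_n -> H -> H) (T : H -> H).

Lemma norm_evalP a Y T : (forall i, bounded_op (Y i)) -> norm_eval a Y T <->
  bounded_op T /\ forall eps : R, 0 < eps -> exists N, forall d, (N <= d)%N ->
    forall x, rnorm (optrunc a Y d x - T x) <= eps * rnorm x.
Proof.
move=> bY; split=> -[bT h]; split => //.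
  move=> eps eps0; move/cvgrPdist_lt : h => /(_ eps eps0)[N _ hN].
  exists N => d Nd x; have bD := bounded_sub (bounded_optrunc a d bY) bT.
  apply: (le_trans (rnorm_opnorm bD x)); rewrite ler_wpM2r ?rnorm_ge0// ltW//.
  by have := hN d Nd; rewrite /= sub0r normrN ger0_norm// opnorm_ge0.
apply/cvgrPdist_lt => eps eps0; have [N hN] := h _ (divr_gt0 eps0 (ltr0n R 2)).
exists N => // d Nd /=; have bD := bounded_sub (bounded_optrunc a d bY) bT.
rewrite sub0r normrN ger0_norm ?opnorm_ge0//.
rewrite (@le_lt_trans _ _ (eps / 2))//; last by rewrite ltr_pdivrMr// ltr_pMr// ltr1n.
by apply: (opnorm_le bD); [rewrite divr_ge0// ltW|exact: hN].
Qed.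

Lemma norm_eval_tends a Y T x : (forall i, bounded_op (Y i)) -> norm_eval a Y T ->
  tends (fun d => optrunc a Y d x) (T x).
Proof.
move=> bY /(norm_evalP a T bY)[_ h] eps eps0.
have e1 : 0 < eps / (rnorm x + 1) by rewrite divr_gt0// ltr_wpDl// rnorm_ge0.
have [N hN] := h _ e1; exists N => d /hN/(_ x) /le_lt_trans; apply.
rewrite mulrAC ltr_pdivrMr ?ltr_wpDl ?rnorm_ge0//.
by rewrite ltr_pM2l// ltrDl.
Qed.

Lemma norm_eval_uniq a Y T T' : (forall i, bounded_op (Y i)) -> norm_eval a Y T ->
  norm_eval a Y T' -> T = T'.
Proof.
move=> bY hT hT'; apply/funext => x.
exact: tends_uniq (norm_eval_tends x bY hT) (norm_eval_tends x bY hT').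
Qed.

Lemma norm_eval_sot_alg (M : 'I_n -> H -> H) a Y T : (forall i, bounded_op (M i)) ->
  (forall i, sot_alg M (Y i)) -> norm_eval a Y T -> sot_alg M T.
Proof.
move=> bM sY hT; have [bT _] := hT.
apply: (sot_lim (A := fun d => optrunc a Y d)) => // [d|x]; first exact: sot_optrunc.
by apply: norm_eval_tends hT => i; exact: sot_alg_bounded (sY i).
Qed.

Lemma sot_eval_sot_alg (M : 'I_n -> H -> H) a T : sot_eval a M T -> sot_alg M T.
Proof.
move=> [bT hT]; apply: (sot_lim (A := fun d => optrunc a M d)) => // [d|x].
  by apply: sot_optrunc => i; exact: sot_gen.
exact/tendsP.
Qed.

Lemma rad_eval_sot_alg (M : 'I_n -> H -> H) a T : (forall i, bounded_op (M i)) -> rad_eval a M T ->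
  sot_alg M T.
Proof.
move=> bM [bT [delta [/andP[d0 d1] [F [hF FT]]]]].
(* A sequence of admissible radii tending to 1. *)
pose r (k : nat) : R := 1 - (1 - delta) / k.+2%:R.
have pk (k : nat) : 0 < (1 - delta) / k.+2%:R by rewrite divr_gt0// subr_gt0.
have rk k : delta < r k < 1.
  rewrite /r ltrBlDr ltrDl pk andbT ltrBrDr -ltrBrDl.
  by rewrite ltr_pdivrMr// ltr_pMr ?subr_gt0// ltr1n.
apply: (sot_lim (A := fun k => F (r k))) => // [k|x].
  apply: (norm_eval_sot_alg (Y := fun i x => (r k)%:C%C *: M i x)) => //.
    by move=> i; apply: sot_scale; exact: sot_gen.
  exact: hF.
move=> e e0; have /cvgrPdist_lt/(_ (e%:C)%C) := FT x.
rewrite ltcR => /(_ e0)[eta /= eta0 h].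
have [N hN] := ler_tends0 (divr_gt0 eta0 (ltr01 : 0 < (1 : R))).
exists N => k Nk; rewrite rnormB -ltcR -normE.
apply: h; last by have /andP[] := rk k.
rewrite /= /r opprB addrC subrK gtr0_norm ?pk//.
have := hN k Nk; rewrite divr1; apply: le_lt_trans.
rewrite -[leRHS]mul1r ler_pM ?invr_ge0 ?subr_ge0 ?(ltW d1)// ?gerBl ?(ltW d0)//.
by rewrite lef_pV2 ?posrE// ler_nat.
Qed.

Lemma sot_or_rad_sot_alg (M : 'I_n -> H -> H) (f : 'I_n -> ncseries R n)
    (T : 'I_n -> H -> H) :
  (forall i, bounded_op (M i)) -> sot_or_rad_eval f M T -> forall j, sot_alg M (T j).
Proof.
move=> bM [] hT j; first exact: sot_eval_sot_alg (hT j).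
exact: rad_eval_sot_alg (hT j).
Qed.

End Evaluation.

(** * Consequences of the model property *)

(** The part of the model property on which the invariant subspace theorem rests;
    T j is left multiplication by f_j. *)
Definition model_structure (R : realType) n (H : hilbertType R) (e : word n -> H)
    (M : 'I_n -> H -> H) :=
  [/\ forall i, bounded_op (M i), forall i, right_invariant e (M i) &
    exists2 T : 'I_n -> H -> H, (forall j w, T j (e w) = e (j :: w)) &
      forall j, sot_alg M (T j)].

(** * The model property for polynomial automorphisms *)

Section CaseA.
Context {R : realType} {n : nat} {H : hilbertType R}.
Variables (f : 'I_n -> ncseries R n) (e : word n -> H) (M : 'I_n -> H -> H).
Hypothesis e_orth : forall v w, inner (e v) (e w) = (v == w)%:R.
Hypothesis e_total : total_fam e.
Local Notation coef := (coef e).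

Lemma degree_ncmul d d' (a b : ncseries R n) : degree_lt d a -> degree_lt d' b ->
  degree_lt (d + d') (ncmul a b).
Proof.
move=> ad bd w dw; rewrite /ncmul big1// => k _.
have kw : (k <= size w)%N by rewrite -ltnS.
have [dk|kd] := leqP d k.
  by rewrite ad ?mul0r// size_take_min (minn_idPl kw).
rewrite bd ?mulr0// size_drop leq_subRL// (leq_trans _ dw)// leq_add2r ltnW//.
Qed.

(** Substituting q undoes substituting f on each word, hence on polynomials. *)
Lemma substitution_inj (q : 'I_n -> ncseries R n) d a :
  (forall i, poly_comp (f i) q (ncX i)) -> degree_lt d a ->
  (forall v, nctrunc a f d v = 0) -> forall w, a w = 0.
Proof.
move=> fq ad a0 v.
have hw w : exists dw, degree_lt dw (ncword f w) /\ nctrunc (ncword f w) q dw = delta w.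
  elim: w => [|i w [d2 [h2 E2]]].
    exists 1%N; split; first by case.
    by apply/funext => u; rewrite -[ncword f [::]]/(delta [::]) nctrunc_delta.
  have [d1 h1 E1] := fq i; exists (d1 + d2)%N; split; first exact: degree_ncmul.
  by rewrite nctrunc_mul// E2 -E1 -[ncX i]/(delta [:: i]) delta_mul.
have [dw hdw] := choice hw.
(* A truncation degree large enough for every word that occurs in a. *)
pose D := (\sum_(w <- words_lt d) dw w)%N.
have : nctrunc (nctrunc a f d) q D v = 0.
  rewrite /nctrunc big1// => k _; rewrite /wsum big1// => w _.
  by rewrite -/(nctrunc a f d w) a0 mul0r.
rewrite (nctruncE a f d) (nctrunc_sum _ a) => <-; rewrite {1}(poly_words ad).
apply: eq_big_seq => w wd; have [h1 h2] := hdw w; congr (_ * _).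
rewrite -h2; symmetry; apply: nctrunc_widen => //.
by rewrite /D (big_rem w)//= leq_addr.
Qed.

Hypothesis hA : modelA f e M.

(** The vector h of H^2(f) is the polynomial p. *)
Definition represents h p := poly_comp (coef h) f p.

Lemma represents_inj h h' p : represents h p -> represents h' p -> h = h'.
Proof.
move=> [d hd hp] [d' hd' hp'].
have [q [_ fq _]] := modelA_inv hA.
apply: (coef_inj e_total); apply/funext => w; apply/eqP; rewrite eq_sym -subr_eq0; apply/eqP.
have := @substitution_inj q (maxn d d') (fun w => -1 * coef h w + coef h' w) fq.
have hm := leq_maxl d d'; have hm' := leq_maxr d d'.
have -> : coef h' w - coef h w = -1 * coef h w + coef h' w by rewrite mulN1r addrC.
apply.
  move=> u du; rewrite (hd u) ?(leq_trans hm)// (hd' u) ?(leq_trans hm')//.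
  by rewrite mulr0 addr0.
move=> v; rewrite nctruncP (nctrunc_widen _ _ hm hd) (nctrunc_widen _ _ hm' hd').
by rewrite -hp -hp' mulN1r addNr.
Qed.

Lemma represents_lin s h h' p p' : represents h p -> represents h' p' ->
  represents (s *: h + h') (fun v => s * p v + p' v).
Proof.
move=> [d hd ->] [d' hd' ->]; exists (maxn d d').
  move=> w dw; rewrite coefP (hd w) ?(leq_trans (leq_maxl d d'))//.
  by rewrite (hd' w) ?(leq_trans (leq_maxr d d'))// mulr0 addr0.
apply/funext => v.
rewrite -(nctrunc_widen _ _ (leq_maxl d d') hd) -(nctrunc_widen _ _ (leq_maxr d d') hd').
by rewrite -nctruncP; congr nctrunc; apply/funext => w; rewrite coefP.
Qed.

Lemma represents_sum (r : seq (word n)) (s : word n -> R[i]) (h : word n -> H) p :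
  (forall w, represents (h w) (p w)) ->
  represents (\sum_(w <- r) s w *: h w) (fun v => \sum_(w <- r) s w * p w v).
Proof.
move=> hp; elim: r => [|w r IH].
  rewrite big_nil; exists 0%N => [w _|]; first by rewrite /coef inner0l.
  by apply/funext => v; rewrite big_nil /nctrunc big_ord0.
rewrite big_cons; have := represents_lin (s w) (hp w) IH; congr represents.
by apply/funext => v; rewrite big_cons.
Qed.

Lemma represents_basis w : represents (e w) (ncword f w).
Proof.
rewrite /represents (coef_basis e_orth); exists (size w).+1.
  by move=> v wv; rewrite /delta; case: eqP => // vw; move: wv; rewrite vw ltnn.
by apply/funext => v; rewrite nctrunc_delta ltnSn.
Qed.

Lemma represents_shift g S h p : right_shift e g S -> represents h p ->
  represents (S h) (ncmul p (ncword f g)).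
Proof.
move=> hS [d hd ->]; exists (d + size g)%N; first exact: (degree_shift e_orth e_total).
by apply/funext => v; rewrite (nctrunc_shift e_orth e_total _ _ _ _ hS).
Qed.

Lemma represents_opword u h p : represents h p ->
  represents (opword M u h) (ncmul (ncword (@ncX R n) u) p).
Proof.
move=> hp; elim: u => [|i u IH] /=; first by rewrite nc1_mul.
by rewrite ncmulA; exact: (modelA_mulZ hA).
Qed.

Lemma modelA_structure : model_structure e M.
Proof.
have bM := modelA_bounded hA; split=> // [i|].
  apply: (right_invariant_basis e_total) => // g S w hS.
  apply: (@represents_inj _ _ (ncmul (ncX i) (ncword f (w ++ g)))).
    by apply: (modelA_mulZ hA); exact: represents_basis.
  rewrite ncword_cat -ncmulA; apply: represents_shift => //.
  by apply: (modelA_mulZ hA); exact: represents_basis.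
have [d hd] := choice (modelA_poly hA).
exists (fun j => optrunc (f j) M (d j)) => [j w|j]; last first.
  by apply: sot_optrunc => i; exact: sot_gen.
apply: (@represents_inj _ _ (ncmul (f j) (ncword f w))); last exact: represents_basis.
have -> : ncmul (f j) (ncword f w) =
    ncmul (fun v => \sum_(u <- words_lt (d j)) f j u * delta u v) (ncword f w).
  by rewrite -(poly_words (hd j)).
have := @represents_sum (words_lt (d j)) (f j) (fun u => opword M u (e w))
  (fun u => ncmul (delta u) (ncword f w)).
have -> : \sum_(u <- words_lt (d j)) f j u *: opword M u (e w) =
    optrunc (f j) M (d j) (e w).
  by rewrite -(sum_words (d j) (fun u => f j u *: opword M u (e w))).
have -> : (fun v => \sum_(u <- words_lt (d j)) f j u * ncmul (delta u) (ncword f w) v) =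
    ncmul (fun v => \sum_(u <- words_lt (d j)) f j u * delta u v) (ncword f w).
  by apply/funext => v; rewrite ncmul_suml.
apply => u; rewrite -ncword_X; apply: represents_opword; exact: represents_basis.
Qed.

End CaseA.

(** * The model property for formal power series *)

Section CaseS.
Context {R : realType} {n : nat} {H : hilbertType R}.
Variables (f : 'I_n -> ncseries R n) (e : word n -> H) (M : 'I_n -> H -> H).
Hypothesis e_orth : forall v w, inner (e v) (e w) = (v == w)%:R.
Hypothesis e_total : total_fam e.
Local Notation coef := (coef e).
Local Notation fs := (formal_series f e).

Lemma ncmul_low (c b : ncseries R n) v :
  (forall u, (size u < size v)%N -> b u = 0) -> ncmul c b v = c [::] * b v.
Proof.
case: v => [|x v] hb; first by rewrite ncmul_nil.
rewrite ncmul_cons [X in _ + X]big1 ?addr0// => k _.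
rewrite hb ?mulr0// ltnS size_drop; exact: leq_subr.
Qed.

Hypothesis f0 : forall i, f i [::] = 0.

Lemma ncword_low w v : (size v < size w)%N -> ncword f w v = 0.
Proof.
elim: w v => [//|i w IH] [|x v] vw /=; first by rewrite ncmul_nil f0 mul0r.
rewrite ncmul_cons f0 mul0r add0r ncmul_low ?IH ?mulr0// => u uv.
by apply: IH; rewrite (ltn_trans uv).
Qed.

(** Since f has no constant term, on words of equal length only the linear part
    of f contributes. *)
Lemma ncword_cons i w x v : size w = size v ->
  ncword f (i :: w) (x :: v) = f i [:: x] * ncword f w v.
Proof.
move=> wv; rewrite /= ncmul_cons f0 mul0r add0r ncmul_low// => u uv.
by apply: ncword_low; rewrite wv.
Qed.

Lemma functional_formal_series v : functional (fun h => fs h v).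
Proof. exact: functional_trunc. Qed.

Lemma formal_series_basis w : fs (e w) = ncword f w.
Proof.
apply/funext => v; rewrite /formal_series (coef_basis e_orth) nctrunc_delta ltnS.
by case: leqP => // /ncword_low.
Qed.

Lemma formal_series_shift g S h : right_shift e g S ->
  fs (S h) = ncmul (fs h) (ncword f g).
Proof.
move=> hS; apply/funext => v; have [bS Se] := hS; move: h.
apply: (functional_eq e_total).
- by apply: (functional_comp (phi := fun h => fs h v)) => //; exact: functional_formal_series.
- apply: functional_sum => k; apply: functionalM; exact: functional_formal_series.
- by move=> w; rewrite Se !formal_series_basis ncword_cat.
Qed.

Hypothesis jac : \det (jacobian0 f) != 0.

Lemma wsum_cons k (F : word n -> R[i]) :
  wsum k.+1 F = \sum_i wsum k (fun w => F (i :: w)).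
Proof.
rewrite /wsum pair_big/= (reindex (fun p : 'I_n * k.-tuple 'I_n => [tuple of p.1 :: p.2]))//=.
exists (fun t => (thead t, [tuple of behead t])) => [[i w] _|t _] /=.
  by congr pair; apply/val_inj.
by rewrite [in RHS](tuple_eta t); apply/val_inj.
Qed.

(** On words of length d the leading part of the f_w is the d-th tensor power of the
    Jacobian matrix; this inverts it one letter at a time. *)
Lemma jacobian_free d (c : word n -> R[i]) :
  (forall v, size v = d -> wsum d (fun w => c w * ncword f w v) = 0) ->
  forall w, size w = d -> c w = 0.
Proof.
elim: d c => [|d IH] c hc w.
  move=> /size0nil ->; have := hc [::] erefl.
  rewrite /wsum (bigD1 [tuple])//= big1 ?addr0; first by rewrite /nc1 eqxx mulr1.
  by move=> t /negP[]; apply/eqP; exact: tuple0.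
case: w => [//|i w] [wd].
pose r : 'rV[R[i]]_n := \row_j c (j :: w).
have : r *m jacobian0 f = 0.
  apply/rowP => x; rewrite !mxE.
  have Ex : \sum_j c (j :: w) * f j [:: x] = 0.
    apply: (IH (fun w' => \sum_j c (j :: w') * f j [:: x])) => // v vd.
    have := hc (x :: v); rewrite /= vd => /(_ erefl).
    rewrite wsum_cons /wsum exchange_big/= => E; rewrite -[RHS]E.
    apply: eq_bigr => t _; rewrite mulr_suml; apply: eq_bigr => j _.
    by rewrite -mulrA -ncword_cons// size_tuple.
  by rewrite -[RHS]Ex; apply: eq_bigr => j _; rewrite !mxE.
move=> /(congr1 (mulmx^~ (invmx (jacobian0 f)))).
rewrite mulmxK ?unitmxE ?unitfE// mul0mx => /rowP/(_ i).
by rewrite !mxE.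
Qed.

(** The homogeneous part of lowest degree of a difference would be a combination
    of the leading parts of the f_w, which are linearly independent. *)
Lemma formal_series_inj h h' : fs h = fs h' -> h = h'.
Proof.
move=> hh; apply: (coef_inj e_total); apply/funext => w.
pose c w := -1 * coef h w + coef h' w.
suff : forall d w, (size w < d)%N -> c w = 0.
  move=> /(_ (size w).+1 w (ltnSn _)); rewrite /c mulN1r => /eqP.
  by rewrite addrC subr_eq0 => /eqP.
elim=> [//|d IH] {}w; rewrite ltnS leq_eqVlt => /orP[/eqP|]; last exact: IH.
apply: jacobian_free => v vd.
have : nctrunc c f d.+1 v = 0.
  by rewrite nctruncP -vd -!/(formal_series f e _ v) hh mulN1r addNr.
rewrite /nctrunc big_ord_recr/= big1 ?add0r// => k _; rewrite /wsum big1// => u _.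
by rewrite IH ?mul0r// size_tuple.
Qed.

Hypothesis hS : modelS f e M.

Lemma modelS_structure : model_structure e M.
Proof.
have bM := modelS_bounded hS; split=> // [i|].
  apply: (right_invariant_basis e_total) => // g S w gS.
  apply: formal_series_inj.
  rewrite (formal_series_shift _ gS) !(modelS_mulZ hS) !formal_series_basis.
  by rewrite ncword_cat ncmulA.
have [T hT Tf] := modelS_mulf hS.
exists T => [j w|]; last exact: (sot_or_rad_sot_alg bM hT).
by apply: formal_series_inj; rewrite Tf !formal_series_basis.
Qed.

End CaseS.

(** * The model property for free holomorphic functions *)

Section CaseF.
Context {R : realType} {n : nat} {E H : hilbertType R}.
Variables (f : 'I_n -> ncseries R n) (e : word n -> H) (M : 'I_n -> H -> H).
Hypothesis e_orth : forall v w, inner (e v) (e w) = (v == w)%:R.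
Hypothesis e_total : total_fam e.
Local Notation coef := (coef e).
Implicit Types X Y : 'I_n -> E -> E.

Lemma comp_eval_basis X Y w : (forall i, bounded_op (Y i)) ->
  (forall j, norm_eval (f j) X (Y j)) -> comp_eval (coef (e w)) f X (opword Y w).
Proof.
move=> bY hY; exists Y => //; apply/norm_evalP => //; split; first exact: bounded_opword.
move=> eps eps0; exists (size w).+1 => d wd x.
rewrite (coef_basis e_orth) optrunc_delta wd subrr rnorm0.
by rewrite mulr_ge0 ?rnorm_ge0// ltW.
Qed.

Lemma comp_eval_shift X g S h V Y : (forall i, bounded_op (X i)) ->
  (forall j, norm_eval (f j) X (Y j)) -> right_shift e g S ->
  comp_eval (coef h) f X V -> comp_eval (coef (S h)) f X (V \o opword Y g).
Proof.
move=> bX hY gS [Y' hY' hV].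
have YY : Y' = Y by apply/funext => j; exact: norm_eval_uniq (hY' j) (hY j).
rewrite {}YY in hV; have bY i : bounded_op (Y i) by have [] := hY i.
have [bV hV'] := (norm_evalP _ _ bY).1 hV.
have bg := bounded_opword g bY; have [_ [C C0 hC]] := (bounded_opP _).1 bg.
exists Y => //; apply/norm_evalP => //; split; first exact: bounded_comp.
move=> eps eps0; have [N hN] := hV' (eps / (C + 1)) (divr_gt0 eps0 (ltr_wpDl C0 ltr01)).
exists (N + size g)%N => d Nd x /=.
have gd : (size g <= d)%N by rewrite (leq_trans _ Nd)// leq_addl.
rewrite -(subnK gd) (optrunc_shift e_orth e_total _ _ _ _ gS).
apply: (le_trans (hN _ _ _)); first by rewrite leq_subRL// addnC.
rewrite -mulrA ler_wpM2l ?(ltW eps0)// mulrC ler_pdivrMr ?ltr_wpDl//.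
by rewrite (le_trans (hC x))// mulrC ler_wpM2l ?rnorm_ge0// lerDl.
Qed.

Lemma comp_eval_sub X h h' V : (forall i, bounded_op (X i)) ->
  comp_eval (coef h) f X V -> comp_eval (coef h') f X V ->
  comp_eval (coef (h - h')) f X (fun=> 0).
Proof.
move=> bX [Y hY hV] [Y' hY' hV'].
have YY : Y' = Y by apply/funext => j; exact: norm_eval_uniq (hY' j) (hY j).
rewrite {}YY in hV'; have bY i : bounded_op (Y i) by have [] := hY i.
exists Y => //; apply/norm_evalP => //; split; first exact: bounded_0.
have [_ h1] := (norm_evalP _ _ bY).1 hV; have [_ h2] := (norm_evalP _ _ bY).1 hV'.
move=> eps eps0; have e2 : 0 < eps / 2 by rewrite divr_gt0.
have [N hN] := h1 _ e2; have [N' hN'] := h2 _ e2.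
exists (maxn N N') => d; rewrite geq_max => /andP[/hN h3 /hN' h4] x.
have -> : optrunc (coef (h - h')) Y d x = optrunc (coef h) Y d x - optrunc (coef h') Y d x.
  rewrite /optrunc -sumrB; apply: eq_bigr => k _; rewrite /wsum -sumrB.
  by apply: eq_bigr => w _; rewrite /coef innerBl scalerBl.
rewrite subr0 -(subrK (V x) (optrunc (coef h) Y d x)) -addrA.
rewrite (le_trans (rnormD _ _))// [eps]splitr mulrDl lerD//.
by rewrite rnormB.
Qed.

Lemma wsum_coef_le h k : wsum k (fun w => rnorm (coef h w) ^+ 2) <= rnorm h ^+ 2.
Proof.
pose s : H := \sum_(w : k.-tuple 'I_n) coef h w *: e w.
have hs : inner h s = (wsum k (fun w => rnorm (coef h w) ^+ 2))%:C%C.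
  rewrite inner_sumr rmorph_sum; apply: eq_bigr => w _.
  by rewrite innerZr -/(coef h w) mulrC -normCK normE rmorphXn.
have ss : inner s s = inner h s.
  rewrite inner_suml hs rmorph_sum; apply: eq_bigr => w _.
  rewrite innerZl inner_sumr (bigD1 w)//= big1 ?addr0 => [|v vw].
    by rewrite innerZr e_orth eqxx mulr1 -normCK normE rmorphXn.
  by rewrite innerZr e_orth val_eqE eq_sym (negPf vw) mulr0.
have hss : inner (h - s) s = 0 by rewrite innerBl ss subrr.
have := pythagoras hss; rewrite subrK => ->.
rewrite -lecR -hs -ss innerxx lecR lerDr; exact: sqr_ge0.
Qed.

(** By Bessel the sums under the root are bounded, and the k-th roots of a constant
    tend to 1. *)
Lemma free_holomorphic_coef h : free_holomorphic 1 (coef h).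
Proof.
rewrite /free_holomorphic invr1.
pose C := rnorm h ^+ 2 + 1.
have C1 : 1 <= C by rewrite lerDr sqr_ge0.
have C0 : 0 < C by rewrite (lt_le_trans ltr01).
pose v (k : nat) : R := C `^ ((2 * k)%:R^-1).
have vE k : v k = expR ((2 * k)%:R^-1 * ln C) by rewrite /v /powR gt_eqF.
have xk : (fun k : nat => (2 * k)%:R^-1 : R) @ \oo --> (0 : R).
  apply: (squeeze_cvgr (f := fun=> 0) (h := @harmonic R)).
  - near=> k; rewrite invr_ge0 ler0n /=.
    have k0 : (0 < k)%N by near: k; exists 1%N.
    rewrite lef_pV2 ?posrE ?ltr0n ?muln_gt0// ler_nat.
    by rewrite mul2n -addnn -addn1 leq_add2l.
  - exact: cvg_cst.
  - exact: cvg_harmonic.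
have v1 : v @ \oo --> (1 : R).
  have -> : v = expR \o (fun k => (2 * k)%:R^-1 * ln C) by apply/funext => k; exact: vE.
  suff : (expR \o (fun k => (2 * k)%:R^-1 * ln C)) @ \oo --> expR (0 : R).
    by rewrite expR0.
  apply: continuous_cvg; first exact: continuous_expR.
  by have := cvgM xk (cvg_cst (ln C)); rewrite mul0r; apply.
have : limn_esup (fun k => (v k)%:E) = 1%:E.
  by apply: (cvg_limn_einf_sup _).2; apply: cvg_EFin => //; near=> k.
move=> <-; rewrite !limn_esup_lim; apply: lee_lim.
- exact: is_cvg_esups.
- exact: is_cvg_esups.
near=> N; apply: ub_ereal_sup => _ [k /= Nk <-].
apply: (@le_trans _ _ (v k)%:E); last by apply: ereal_sup_ubound; exists k.
rewrite lee_fin; apply: ge0_ler_powR; rewrite ?invr_ge0 ?nnegrE//.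
- by rewrite /wsum sumr_ge0// => w _; exact: sqr_ge0.
- exact: ltW.
- by rewrite (le_trans (wsum_coef_le h k))// lerDl.
Unshelve. all: by end_near. Qed.

Hypothesis hF : modelF E f e M.

Lemma modelF_structure : model_structure e M.
Proof.
have [gamma g0 [fhol fball finj _ [bM mulZ [T hT mulf]]]] := hF.
have bX X : row_ball gamma X -> forall i, bounded_op (X i) by move=> [].
have ev X : row_ball gamma X -> exists Y : 'I_n -> E -> E,
    (forall i, bounded_op (Y i)) /\ forall j, norm_eval (f j) X (Y j).
  by move=> hX; have [Y [bY _] hY] := fball X hX; exists Y.
(* No nonzero G has G o f = 0; this is applied to the difference of the two
   series of coefficients. *)
have uniq h h' : (forall X, row_ball gamma X -> exists V,
    comp_eval (coef h) f X V /\ comp_eval (coef h') f X V) -> h = h'.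
  move=> hV; apply: (coef_inj e_total); apply/funext => w.
  apply/eqP; rewrite -subr_eq0 -innerBl; apply/eqP.
  apply: (finj (coef (h - h')) (free_holomorphic_coef _)) => X hX.
  have [V [h1 h2]] := hV X hX; exact: comp_eval_sub (bX X hX) h1 h2.
split=> // [i|].
  apply: (right_invariant_basis e_total) => // g S w gS; apply: uniq => X hX.
  have [Y [bY hY]] := ev X hX; exists (X i \o opword Y (w ++ g)); split.
    by apply: mulZ => //; exact: comp_eval_basis.
  have -> : X i \o opword Y (w ++ g) = (X i \o opword Y w) \o opword Y g.
    by apply/funext => x /=; rewrite opword_cat.
  apply: (comp_eval_shift (bX X hX) hY gS).
  by apply: mulZ => //; exact: comp_eval_basis.
exists T => [j w|]; last exact: (sot_or_rad_sot_alg bM hT).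
apply: uniq => X hX; have [Y [bY hY]] := ev X hX.
exists (Y j \o opword Y w); split; last exact: (comp_eval_basis (j :: w)).
by apply: mulf => //; exact: comp_eval_basis.
Qed.

End CaseF.

Lemma universal_model_structure (R : realType) n (E H : hilbertType R)
    (f : 'I_n -> ncseries R n) (e : word n -> H) (M : 'I_n -> H -> H) :
  universal_model E f e M ->
  [/\ forall v w, inner (e v) (e w) = (v == w)%:R, total_fam e & model_structure e M].
Proof.
move=> [[e_orth e_dense] hM].
have e_total : total_fam e.
  move=> x hx; apply: (dense_total e_dense) => _ [d [c ->]].
  rewrite inner_sumr big1// => k _; rewrite inner_sumr big1// => w _.
  by rewrite innerZr hx mulr0.
split=> //; case: hM => hM.
- exact: (modelA_structure e_orth e_total hM).
- exact: (modelS_structure e_orth e_total (modelS_f0 hM) (modelS_jacobian hM) hM).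
- exact: (modelF_structure e_orth e_total hM).
Qed.

(** * The invariant subspace theorem *)

Theorem theorem6p1 (R : realType) (E : hilbertType R)
    (E_infinite : infinite_dimensional E)
    (n : nat) (n_gt0 : (0 < n)%N) (f : 'I_n -> ncseries R n)
    (H : hilbertType R) (e : word n -> H) (M : 'I_n -> H -> H)
    (f_model : universal_model E f e M)
    (J : set (H -> H)) (J_ideal : wot_closed_ideal M J)
    (J_proper : J <> hardy_algebra M)
    (K : hilbertType R) (NK : tensor_product (variety_space J) K)
    (S : set NK) (S_closed : closed_subspace S) :
  (forall i x, S x -> S (ampliation (variety_model M i) x)) <->
  exists (G : hilbertType R) (NG : tensor_product (variety_space J) G)
      (Theta : NG -> NK),
    [/\ partial_isometry Theta,
        forall i, Theta \o ampliation (variety_model M i) =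
                  ampliation (variety_model M i) \o Theta &
        S = range Theta].
Proof.
have [e_orth e_total [bM M_right [T T_basis T_alg]]] := universal_model_structure f_model.
split=> [SB|]; last first.
  case=> G; case=> NG; case=> Theta; case=> _ ThetaB -> i _ [x _ <-].
  by exists (ampliation (variety_model M i) x); rewrite // -[RHS]/((_ \o Theta) x) -ThetaB.
exact: (invariant_subspace_partial_isometry e_orth e_total bM M_right T_basis T_alg J_ideal).
Qed.
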